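(* Let $x=(x^1,\dots,x^m):[0,T]\to\mathbb{R}^m$, where $x^j$ is Hölder continuous of order $\beta_j>1/2$ for $j=1,\dots,m$, and put $\beta=\min_{1\le j\le m}\beta_j$. Let $\widetilde\Gamma$ be a finite (nonempty) subset of $\Gamma$ having the hierarchical structure, let $N=\max\{|\alpha|:\alpha\in\widetilde\Gamma\}$, and let $$\theta=\min\{\beta_{\alpha(1)}+\cdots+\beta_{\alpha(|\alpha|)}-1:\ \alpha\in\Gamma\setminus\widetilde\Gamma\}.$$ Assume $V=(V^i_j)_{1\le i\le d,1\le j\le m}\in C^{N+1}_b(\mathbb{R}^d;\mathbb{R}^{d\times m})$. Let $y$ be the solution of $dy_t=V(y_t)\,dx_t$ on $[0,T]$ with initial value $y_0\in\mathbb{R}^d$, and let $y^n$ be the incomplete Taylor scheme: $y^n_0=y_0$ and $$y^n_t=y^n_{t_k}+\widetilde{\mathcal E}^{(N)}_{t_k,t}(y^n_{t_k}),\qquad t\in[t_k,t_{k+1}],\ k=0,1,\dots,n-1,\qquad t_k=\tfrac{kT}{n},$$ where $\widetilde{\mathcal E}^{(N)}_{s,t}(y)=\sum_{\gamma\in\widetilde\Gamma}\mathcal V_\gamma I(y)\,x^\gamma_{s,t}$. Then for all $n\ge 1$ $$\sup_{t\in[0,T]}|y_t-y^n_t|\le G\,n^{-\theta},\qquad G=C\exp\Big(C\|x\|_\beta^{1/\beta^2+(N-1)/\beta}+C\sum_{j=1}^m\|x^j\|_{\beta_j}\Big),$$ where $C$ is a constant that does not depend on $n$ or on $x$ (it may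 depend on $T$, on $V$ and on the fixed parameters $d,m,\widetilde\Gamma,\beta_1,\dots,\beta_m$).
   Context: $\Gamma_r$ is the set of multi-indices $\alpha=(\alpha(1),\dots,\alpha(r))$ of length $|\alpha|=r\ge1$ with entries in $\{1,\dots,m\}$, and $\Gamma=\bigcup_{r\ge1}\Gamma_r$. Hierarchical structure: for $\alpha,\alpha'\in\Gamma$ with $|\alpha|=r$, $|\alpha'|=r+1$, write $\alpha\Subset\alpha'$ if there is an injection $\rho:\{1,\dots,r\}\to\{1,\dots,r+1\}$ with $\alpha(i)=\alpha'(\rho(i))$ for all $i$. A subset $\widetilde\Gamma\subset\Gamma$ has the hierarchical structure if, whenever $\alpha\in\Gamma\setminus\widetilde\Gamma$ and $\alpha\Subset\alpha'$, also $\alpha'\in\Gamma\setminus\widetilde\Gamma$. $\mathcal V_j f=\sum_{i=1}^d V^i_j\,\partial_i f$ for $j=1,\dots,m$, $\mathcal V_\gamma=\mathcal V_{\gamma(1)}\cdots\mathcal V_{\gamma(r)}$ for $\gamma\in\Gamma_r$, and $I$ is the identity function on $\mathbb{R}^d$ (operators act componentwise). For $\gamma\in\Gamma_r$, $x^\gamma_{s,t}=\int_s^t\int_s^{u_r}\cdots\int_s^{u_2}dx^{\gamma(1)}_{u_1}\cdots dx^{\gamma(r)}_{u_r}$ (iterated Riemann–Stieltjes/Young integrals). $\|z\|_\delta=\sup_{0\le u<v\le T}|z_u-z_v|/(v-u)^\delta$ is the $\delta$-Hölder seminorm on $[0,T]$. *)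

(* Defs.v *)
From HB Require Import structures.
From mathcomp Require Import all_boot all_order all_algebra.
From mathcomp Require Import all_classical all_reals all_analysis.

Set Implicit Arguments.
Unset Strict Implicit.
Unset Printing Implicit Defensive.

Import Order.TTheory GRing.Theory Num.Theory.
Import numFieldNormedType.Exports.

Local Open Scope classical_set_scope.
Local Open Scope ring_scope.

Definition is_minimum disp (X : porderType disp) (A : set X) (a : X) : Prop :=
  A a /\ lbound A a.

Definition is_maximum disp (X : porderType disp) (A : set X) (a : X) : Prop :=
  A a /\ ubound A a.

(** * Multi-indices

    A multi-index of length [r] is a sequence of size [r] over ['I_m]; the
    letters [1, ..., m] are represented by [0, ..., m - 1]. *)

Definition Gamma (m : nat) : set (seq 'I_m) := [set a | (0 < size a)%N].
Arguments Gamma m _ : clear implicits.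

(** [hsub a a'] is the relation written with a double-struck subset sign; the
    injection is not required to preserve the order of the letters. *)
Definition hsub (m : nat) (a a' : seq 'I_m) : Prop :=
  size a' = (size a).+1 /\
  exists rho : 'I_(size a) -> 'I_(size a'),
    injective rho /\
    forall i, tnth (in_tuple a) i = tnth (in_tuple a') (rho i).

Definition hierarchical (m : nat) (Gt : set (seq 'I_m)) : Prop :=
  forall a a', (Gamma m `\` Gt) a -> hsub a a' -> (Gamma m `\` Gt) a'.

Section Analysis.
Context {R : realType}.

(** The norm that the library puts on ['rV[R]_k] is the maximum norm. *)
Definition enorm (k : nat) (z : 'rV[R]_k) : R := Num.sqrt (\sum_i z 0 i ^+ 2).

(** * Hölder functions on [[0, T]] *)

Definition holder_quotients (U : zmodType) (nrm : U -> R) (T delta : R)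
    (z : R -> U) : set R :=
  [set r | exists u v, [/\ 0 <= u, u < v, v <= T &
                        r = nrm (z u - z v) / (v - u) `^ delta]].

Definition holder (U : zmodType) (nrm : U -> R) (T delta : R) (z : R -> U)
    : Prop := has_ubound (holder_quotients nrm T delta z).

(** [sup] is [0] on unbounded sets, so this is meaningful for [holder]
    functions only. *)
Definition holder_seminorm (U : zmodType) (nrm : U -> R) (T delta : R)
    (z : R -> U) : R := sup (holder_quotients nrm T delta z).

(** * Riemann-Stieltjes integrals

    The convergence is in the sense of the mesh.  The points of the partition
    are [a :: p], and [xi k] is the tag of its [k]-th interval. *)

Definition tagged_partition (a b : R) (p : seq R) (xi : nat -> R) : Prop :=
  itv_partition a b p /\
  forall k, (k < size p)%N -> nth 0 (a :: p) k <= xi k <= nth 0 (a :: p) k.+1.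

Definition mesh_lt (a : R) (p : seq R) (e : R) : Prop :=
  forall k, (k < size p)%N -> nth 0 (a :: p) k.+1 - nth 0 (a :: p) k < e.

Definition RS_sum (f g : R -> R) (a : R) (p : seq R) (xi : nat -> R) : R :=
  \sum_(k < size p) f (xi k) * (g (nth 0 (a :: p) k.+1) - g (nth 0 (a :: p) k)).

Definition is_RS_integral (f g : R -> R) (a b I : R) : Prop :=
  forall e : R, 0 < e -> exists2 eta : R, 0 < eta &
    forall p xi, tagged_partition a b p xi -> mesh_lt a p eta ->
      `|RS_sum f g a p xi - I| < e.

(** The value is [0] when the integral does not exist. *)
Definition RS_integral (f g : R -> R) (a b : R) : R :=
  xget 0 [set I | is_RS_integral f g a b I].

(** The first letter is the innermost integrator, the last one the outermost. *)
Definition iterated_integral (m : nat) (x : R -> 'rV[R]_m) (g : seq 'I_m)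
    (s t : R) : R :=
  foldl (fun (F : R -> R) (j : 'I_m) =>
           fun u => RS_integral F (fun v => x v 0 j) s u)
        (fun=> 1) g t.

(** * Vector fields *)

Definition partial (d : nat) (i : 'I_d) (f : 'rV[R]_d -> R) : 'rV[R]_d -> R :=
  'D_(delta_mx 0 i) f.

(** [k] times continuously differentiable, the function itself and its partial
    derivatives of order at most [k] being bounded. *)
Fixpoint Cb (d k : nat) (f : 'rV[R]_d -> R) : Prop :=
  [/\ continuous f,
      exists M : R, forall z, `|f z| <= M &
      match k with
      | 0%N => True
      | k'.+1 => forall i : 'I_d,
          (forall z, derivable f z (delta_mx 0 i)) /\ Cb k' (partial i f)
      end].

Definition calV (d m : nat) (V : 'rV[R]_d -> 'M[R]_(d, m)) (j : 'I_m)
    (f : 'rV[R]_d -> R) : 'rV[R]_d -> R :=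
  fun z => \sum_(i < d) V z i j * partial i f z.

Definition calVs (d m : nat) (V : 'rV[R]_d -> 'M[R]_(d, m)) (g : seq 'I_m)
    (f : 'rV[R]_d -> R) : 'rV[R]_d -> R :=
  foldr (calV V) f g.

Definition calVsI (d m : nat) (V : 'rV[R]_d -> 'M[R]_(d, m)) (g : seq 'I_m)
    (z : 'rV[R]_d) : 'rV[R]_d :=
  \row_(i < d) calVs V g (fun w => w 0 i) z.

(** * The equation and the scheme *)

(** The Hölder condition on [y] is the one under which the integrals in the
    equation are Young integrals, [x] being Hölder continuous of order [beta]. *)
Definition is_solution (d m : nat) (T beta : R) (V : 'rV[R]_d -> 'M[R]_(d, m))
    (x : R -> 'rV[R]_m) (y0 : 'rV[R]_d) (y : R -> 'rV[R]_d) : Prop :=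
  (exists lambda : R, [/\ 0 < lambda, 1 < lambda + beta &
                         holder (@enorm d) T lambda y]) /\
  forall t, 0 <= t <= T ->
    y t = y0 + \row_(i < d) \sum_(j < m)
                 RS_integral (fun u => V (y u) i j) (fun u => x u 0 j) 0 t.

Definition incomplete_expansion (d m : nat) (Gt : set (seq 'I_m))
    (V : 'rV[R]_d -> 'M[R]_(d, m)) (x : R -> 'rV[R]_m) (s t : R)
    (z : 'rV[R]_d) : 'rV[R]_d :=
  \sum_(g \in Gt) iterated_integral x g s t *: calVsI V g z.

Definition grid (T : R) (n k : nat) : R := k%:R * T / n%:R.

Definition is_incomplete_taylor_scheme (d m : nat) (T : R)
    (Gt : set (seq 'I_m)) (V : 'rV[R]_d -> 'M[R]_(d, m)) (x : R -> 'rV[R]_m)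
    (y0 : 'rV[R]_d) (n : nat) (yn : R -> 'rV[R]_d) : Prop :=
  yn 0 = y0 /\
  forall k, (k < n)%N ->
    forall t, grid T n k <= t <= grid T n k.+1 ->
      yn t = yn (grid T n k) +
             incomplete_expansion Gt V x (grid T n k) t (yn (grid T n k)).

End Analysis.

(* Main.v *)
Require Import Defs.
From HB Require Import structures.
From mathcomp Require Import all_boot all_order all_algebra.
From mathcomp Require Import ring lra.
From mathcomp Require Import all_classical all_reals all_analysis.

(** The solution is compared with the scheme on the grid, through the recursion
    that their difference satisfies.

    Local error.  Expanding [y] from the left end [s] of a step, by repeated use
    of the chain rule along the words of [Gt], leaves exactly the iterated
    integrals of the words [j :: w] that are not in [Gt] while [w] is in [Gt] or
    empty ([taylor_expansion]; this is where the hierarchical structure enters).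
    An iterated Young integral along a word is of the order of the sum of the
    Hölder exponents of its letters ([iter_int_bound]), so every remaining term
    is [O(n^(-1-theta))], with a constant polynomial in the Hölder constants.

    Stability.  Let [X] be a Hölder constant of the driver for the exponent
    [beta], and let [h] be such that [X h^beta] is a small constant.  On
    intervals of length [h] the estimates of Young are contractions: the
    solution and the scheme have Hölder constants [O(X)] there
    ([solution_holder], [scheme_block_holder]), and the difference [D] of the two
    at most doubles over a block of grid points of length [h], up to the local
    errors made in the block ([block_stability]).  There are about
    [T / h ~ X^(1/beta)] blocks, hence the factor [exp (C X^(1/beta))] in front
    of the sum of the local errors, which is [O(n^(-theta))] ([fine_error]).
    When the mesh [T / n] is larger than [h] there are at most [T / h] steps, and
    it is enough to bound the displacements of [y] and of the scheme separately
    ([coarse_error]).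

    Both the existence of the integrals and the stability of the scheme come
    from one inequality on almost additive families, [discrete_sewing], applied
    once to Riemann sums and once to the grid.

    The theorem follows since [1 / beta <= 1 / beta ^+ 2 + (N - 1) / beta] for
    [beta <= 1], and since powers of the Hölder constants are absorbed by the
    exponential of their sum.  If [beta > 1] the argument runs with the exponent
    [1] in place of [beta], and [X] itself is dominated by that sum. *)

Set Implicit Arguments.
Unset Strict Implicit.
Unset Printing Implicit Defensive.

Import Order.TTheory GRing.Theory Num.Theory.
Import numFieldNormedType.Exports.

Local Open Scope classical_set_scope.
Local Open Scope ring_scope.

(** * The discrete sewing inequality *)

Section Powers.
Context {R : realType}.
Implicit Types (a b c r s t mu nu : R).

Lemma le_powR r a b : 0 <= r -> 0 <= a -> a <= b -> a `^ r <= b `^ r.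
Proof.
move=> r0 a0 ab; apply: ge0_ler_powR => //; rewrite nnegrE //.
exact: le_trans ab.
Qed.

Lemma powRD_pos a r s : 0 < r -> 0 < s -> a `^ (r + s) = a `^ r * a `^ s.
Proof. by move=> r0 s0; rewrite powRD // gt_eqF ?addr_gt0. Qed.

Lemma cvg_mesh_powR c nu : 0 <= c -> 0 < nu ->
  (c / n.+1%:R) `^ nu @[n --> \oo] --> (0 : R).
Proof.
move=> c0 nu0; apply/cvgr0Pnorm_lt => e e0.
have e'0 : 0 < e `^ nu^-1 by rewrite powR_gt0.
have c1 : 0 < c + 1 by rewrite ltr_wpDl.
have q0 : 0 < e `^ nu^-1 / (c + 1) by rewrite divr_gt0.
near=> n.
have H : n.+1%:R^-1 < e `^ nu^-1 / (c + 1).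
  by near: n; exact: (near_infty_natSinv_lt (PosNum q0)).
rewrite ger0_norm ?powR_ge0 //.
have -> : e = (e `^ nu^-1) `^ nu.
  by rewrite -powRrM mulVf ?lt0r_neq0 // powRr1 // ltW.
rewrite ltr_pdivlMr // in H.
have h0 : 0 < n.+1%:R^-1 * (c + 1) by rewrite mulr_gt0 ?invr_gt0.
apply: (@le_lt_trans _ _ ((n.+1%:R^-1 * (c + 1)) `^ nu)).
  rewrite le_powR ?(ltW nu0) ?divr_ge0 // mulrC ler_wpM2l ?invr_ge0 //.
  by rewrite lerDl.
by apply: gt0_ltr_powR => //; rewrite nnegrE ltW.
Unshelve. all: by end_near. Qed.

End Powers.

Section Sewing.
Context {R : realType}.
Implicit Types (a b s t u v mu K M : R).

(** The bound [K] of [discrete_sewing] reproduces itself under bisection: the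
    two halves contribute [K * 2 `^ (1 - mu)], and the cut contributes [2]. *)
Definition sewing_constant mu K := 0 <= K /\ 2 + K * 2 `^ (1 - mu) <= K.

Lemma sewing_constant_exists mu : 1 < mu -> exists K, sewing_constant mu K.
Proof.
move=> mu1; set q : R := 2 `^ (1 - mu).
have q1 : q < 1.
  rewrite /q /powR pnatr_eq0 /= -[ltRHS]expR0 ltr_expR.
  by rewrite pmulr_llt0 ?ln_gt0 ?ltr1n // subr_lt0.
have h : 0 < 1 - q by rewrite subr_gt0.
exists (2 / (1 - q)); split; first by rewrite divr_ge0 // ltW.
rewrite -/q le_eqVlt; apply/orP; left; apply/eqP; field.
by rewrite gt_eqF.
Qed.

Lemma sewing_constant_le mu nu K : mu <= nu ->
  sewing_constant mu K -> sewing_constant nu K.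
Proof.
move=> mn [K0 hK]; split => //; apply: le_trans hK.
by rewrite lerD2l ler_wpM2l // ler_powR ?ler1n // lerD2l lerN2.
Qed.

(** Cut where half of the length is used up: each part is at most half as long,
    so that the errors of the two parts amount to [2 `^ (1 - mu) < 1] times the
    bound, while the cut adds two defects of additivity. *)
Lemma discrete_sewing (tau : nat -> R) (A : nat -> nat -> R) mu K M n0 n :
  1 < mu -> sewing_constant mu K -> 0 <= M ->
  (forall i j, (n0 <= i)%N -> (i <= j)%N -> (j <= n)%N -> tau i <= tau j) ->
  (forall i j k, (n0 <= i)%N -> (i <= j)%N -> (j <= k)%N -> (k <= n)%N ->
    `|A i k - A i j - A j k| <= M * (tau k - tau i) `^ mu) ->
  forall i j, (n0 <= i)%N -> (i <= j)%N -> (j <= n)%N ->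
  `|\sum_(i <= l < j) A l l.+1 - A i j| <= K * M * (tau j - tau i) `^ mu.
Proof.
move=> mu1 [K0 hK] M0 htau hA i j.
have mu0 : 0 < mu by apply: lt_trans mu1.
have [len le_len] := ubnP (j - i); elim: len => // len IH in i j le_len *.
move=> n0i ij jn; have := ij; rewrite leq_eqVlt => /predU1P[eij|ltij].
  subst j; rewrite big_geq // sub0r normrN.
  have := hA i i i n0i (leqnn _) (leqnn _) jn.
  by rewrite (subrr (tau i)) powR0 ?gt_eqF // !mulr0 subrr sub0r normrN.
set w := tau j - tau i.
have w0 : 0 <= w by rewrite subr_ge0 htau.
pose P k := [&& (i <= k)%N, (k < j)%N & tau k - tau i <= w / 2].
have exP : exists k, P k.
  by exists i; rewrite /P leqnn ltij subrr divr_ge0.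
have ubP k : P k -> (k <= j)%N by case/and3P => _ /ltnW.
case: (ex_maxnP exP ubP) => k /and3P[ik kj kw] kmax.
have kw2 : tau j - tau k.+1 <= w / 2.
  have [kj1|kj1] := ltnP k.+1 j; last first.
    have -> : k.+1 = j by apply/eqP; rewrite eqn_leq kj kj1.
    by rewrite subrr divr_ge0.
  have : ~~ P k.+1 by apply: contraTN isT => /kmax; rewrite ltnn.
  rewrite /P kj1 (leq_trans ik) //= -ltNge => h.
  rewrite /w in h *; lra.
have n0k : (n0 <= k)%N by exact: leq_trans ik.
have n0k1 : (n0 <= k.+1)%N by exact: leqW.
have kn : (k.+1 <= n)%N by apply: leq_trans jn.
have e1 : `|\sum_(i <= l < k) A l l.+1 - A i k| <= K * M * (w / 2) `^ mu.
  apply: (le_trans (IH i k _ n0i ik (ltnW kn))).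
    by apply: (@leq_trans (j - i)) => //; rewrite ltn_sub2r.
  rewrite ler_wpM2l ?mulr_ge0 // le_powR ?(ltW mu0) // subr_ge0 htau //.
  exact: ltnW.
have e2 : `|\sum_(k.+1 <= l < j) A l l.+1 - A k.+1 j| <= K * M * (w / 2) `^ mu.
  apply: (le_trans (IH k.+1 j _ n0k1 kj jn)).
    by apply: (@leq_trans (j - i)) => //; rewrite ltn_sub2l // ltnS.
  by rewrite ler_wpM2l ?mulr_ge0 // le_powR ?(ltW mu0) // subr_ge0 htau.
have e3 : `|A i j - A i k - A k j| <= M * w `^ mu by apply: hA => //; apply: ltnW.
have e4 : `|A k j - A k k.+1 - A k.+1 j| <= M * w `^ mu.
  apply: (le_trans (hA k k.+1 j n0k _ kj jn)); first by [].
  rewrite ler_wpM2l // le_powR ?(ltW mu0) ?subr_ge0 ?htau //; first exact: ltnW.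
  by rewrite /w lerD2l lerN2 htau // ltnW.
rewrite (big_cat_nat _ (n:=k)) //=; last exact: ltnW.
rewrite (big_ltn kj) /=.
set s1 := \sum_(i <= l < k) _ in e1 *.
set s2 := \sum_(k.+1 <= l < j) _ in e2 *.
have -> : s1 + (A k k.+1 + s2) - A i j =
  (s1 - A i k) + (s2 - A k.+1 j) - (A i j - A i k - A k j)
   - (A k j - A k k.+1 - A k.+1 j) by ring.
apply: (le_trans (ler_normB _ _)).
apply: (le_trans (lerD (ler_normB _ _) (lexx _))).
apply: (le_trans (lerD (lerD (ler_normD _ _) (lexx _)) (lexx _))).
apply: (le_trans (lerD (lerD (lerD e1 e2) e3) e4)).
have -> : (w / 2) `^ mu = 2 `^ (1 - mu) / 2 * w `^ mu.
  rewrite powRM ?invr_ge0 // mulrC; congr (_ * _).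
  rewrite powRB ?pnatr_eq0 ?implybT // powRr1 // mulrAC divff ?pnatr_eq0 // mul1r.
  by rewrite -powR_inv1 // -powRrM mulN1r powRN.
have W0 := powR_ge0 w mu.
have := ler_wpM2r (mulr_ge0 M0 W0) hK.
nra.
Qed.

End Sewing.

(** * Existence of Young integrals *)

Section YoungExistence.
Context {R : realType}.
Implicit Types (a b s t u v mu K M al be A B C : R) (f g F Phi : R -> R).

Definition holder_on a b al A f := forall u v,
  a <= u -> u <= v -> v <= b -> `|f v - f u| <= A * (v - u) `^ al.

Lemma holder_on_sub a b a' b' al A f : a <= a' -> b' <= b ->
  holder_on a b al A f -> holder_on a' b' al A f.
Proof.
move=> aa bb h u v au uv vb; apply: h => //; first exact: le_trans au.
exact: le_trans bb.
Qed.

(** Bounded sequences converge along an ultrafilter, and the inequality that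
    characterises the integral passes to such limits. *)
Lemma ultra_cvg_bounded (U : set_system nat) (x : nat -> R) M :
  UltraFilter U -> (forall n, `|x n| <= M) ->
  exists l : R, x n @[n --> U] --> l.
Proof.
move=> UU xM.
have [|l [_ lx]] := @segment_compact R (- M) M (x @ U) (fmap_proper_filter _ _).
  rewrite /fmap /=; apply: (@filterE _ U) => n /=; rewrite in_itv /= -ler_norml.
  exact: xM.
exists l => B Bl.
have [//|nB] := in_ultra_setVsetC (x @^-1` B) UU.
have [z [/= z1 z2]] := lx (~` B) B nB Bl.
by [].
Qed.

(** A left-point sum for the integrator stopped at [t].  One partition serves
    all [t], which makes the limit additive in the interval. *)
Definition stopped_sum f g a h n t :=
  \sum_(0 <= i < n) f (a + i%:R * h) *
     (g (Num.min (a + i.+1%:R * h) t) - g (Num.min (a + i%:R * h) t)).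

(** The increment is a left-point sum over the points clamped to [[s, t]],
    except that [f] is read at the unclamped points; the last term bounds this
    discrepancy cell by cell, and tends to [0] with the mesh. *)
Lemma stopped_sum_increment f g a b al be A B K n s t :
  0 < al -> 0 < be -> 1 < al + be -> sewing_constant (al + be) K ->
  0 <= A -> 0 <= B -> holder_on a b al A f -> holder_on a b be B g ->
  a <= s -> s <= t -> t <= b ->
  forall h, h = (b - a) / n.+1%:R ->
  `|stopped_sum f g a h n.+1 t - stopped_sum f g a h n.+1 s
     - f s * (g t - g s)| <=
  K * (A * B) * (t - s) `^ (al + be)
    + (b - a) * (A * B) * h `^ (al + be - 1).
Proof.
move=> al0 be0 mu1 hK A0 B0 hf hg as_ st tb h hE.
have ab : a <= b by rewrite (le_trans as_) // (le_trans st).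
have h0 : 0 <= h by rewrite hE divr_ge0 // subr_ge0.
pose tau i : R := a + i%:R * h.
pose c i : R := Num.max s (Num.min (tau i) t).
have taun : tau n.+1 = b.
  by rewrite /tau hE mulrC divfK ?pnatr_eq0 // addrC subrK.
have tauS i : tau i.+1 = tau i + h by rewrite /tau -natr1 mulrDl mul1r addrA.
have tau_mono i j : (i <= j)%N -> tau i <= tau j.
  by move=> ij; rewrite lerD2l ler_wpM2r // ler_nat.
have tau0 : tau 0%N = a by rewrite /tau mul0r addr0.
have atau i : a <= tau i by rewrite -tau0 tau_mono.
have c_mono i j : (i <= j)%N -> c i <= c j.
  move=> ij; rewrite /c ge_max le_max lexx /= le_max; apply/orP; right.
  by rewrite le_min !ge_min tau_mono // lexx orbT.
have cS i : c i.+1 - c i <= h.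
  have min_h : Num.min (tau i + h) t <= Num.min (tau i) t + h.
    by case: (leP (tau i) t) => ?; rewrite ge_min ?lexx // lerDl h0 orbT.
  rewrite lerBlDl /c tauS ge_max; apply/andP; split.
    by rewrite ler_wpDr // le_max lexx.
  by apply: (le_trans min_h); rewrite lerD2r le_max lexx orbT.
have sc i : s <= c i by rewrite /c le_max lexx.
have ct i : c i <= t by rewrite /c ge_max st ge_min lexx orbT.
have ac i : a <= c i by apply: le_trans (sc i).
have cb i : c i <= b by apply: le_trans tb.
have c0 : c 0%N = s.
  by rewrite /c tau0 min_l ?(le_trans as_) // max_l.
have cn : c n.+1 = t.
  by rewrite /c taun min_r // max_r.
have gc i : g (Num.min (tau i) t) - g (Num.min (tau i) s) = g (c i) - g s.
  rewrite /c; have [H|H] := leP (tau i) s.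
    by rewrite (min_l (le_trans H st)) max_l // !subrr.
  by congr (g _ - _); rewrite max_r // le_min ltW.
rewrite /stopped_sum -sumrB.
rewrite (eq_bigr (fun i : nat => f (tau i) * (g (c i.+1) - g (c i)))); last first.
  move=> i _; rewrite -mulrBr; congr (_ * _).
  have := gc i.+1; have := gc i; rewrite /tau; move=> e1 e2.
  rewrite [LHS](_ : _ = g (Num.min (a + i.+1%:R * h) t) -
    g (Num.min (a + i.+1%:R * h) s) - (g (Num.min (a + i%:R * h) t) -
    g (Num.min (a + i%:R * h) s))); last by ring.
  by rewrite e1 e2; ring.
have sew : `|\sum_(0 <= i < n.+1) f (c i) * (g (c i.+1) - g (c i))
     - f s * (g t - g s)| <= K * (A * B) * (t - s) `^ (al + be).
  have := @discrete_sewing R c (fun i j => f (c i) * (g (c j) - g (c i)))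
    (al + be) K (A * B) 0%N n.+1 mu1 hK (mulr_ge0 A0 B0) _ _ 0%N n.+1 isT isT (leqnn _).
  rewrite c0 cn; apply.
    by move=> i j _ ij _; exact: c_mono.
  move=> i j k _ ij jk _.
  have -> : f (c i) * (g (c k) - g (c i)) - f (c i) * (g (c j) - g (c i)) -
    f (c j) * (g (c k) - g (c j)) = - ((f (c j) - f (c i)) * (g (c k) - g (c j))).
    by ring.
  have [cij cjk] := (c_mono _ _ ij, c_mono _ _ jk).
  rewrite normrN normrM powRD_pos // mulrACA ler_pM //.
    apply: (le_trans (hf _ _ (ac i) cij (cb j))).
    rewrite ler_wpM2l // le_powR ?subr_ge0 ?(ltW al0) //; lra.
  apply: (le_trans (hg _ _ (ac j) cjk (cb k))).
  rewrite ler_wpM2l // le_powR ?subr_ge0 ?(ltW be0) //; lra.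
(* A term does not vanish only if its cell contains [s] in its interior, when
   [f] is read at a distance at most [h] from [s]. *)
have corr : `|\sum_(0 <= i < n.+1) (f (tau i) - f (c i)) * (g (c i.+1) - g (c i))|
   <= (b - a) * (A * B) * h `^ (al + be - 1).
  have -> : (b - a) * (A * B) * h `^ (al + be - 1) =
     \sum_(0 <= i < n.+1) A * h `^ al * (B * h `^ be).
    rewrite big_const_nat iter_addr_0 subn0 -mulr_natl.
    rewrite mulrACA -powRD_pos // -(mulr_powRB1 h0 (lt_trans ltr01 mu1)).
    have -> : b - a = n.+1%:R * h by rewrite hE mulrC divfK ?pnatr_eq0.
    by ring.
  apply: (le_trans (ler_norm_sum _ _ _)).
  rewrite !big_nat; apply: ler_sum => i /andP[_ iN].
  have tib : tau i <= b by rewrite -taun tau_mono // ltnW.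
  have [H1|H1] := leP (tau i) s; last first.
    have [H2|H2] := leP (tau i) t.
      have -> : c i = tau i by rewrite /c min_l // max_r // ltW.
      by rewrite subrr mul0r normr0 !mulr_ge0 ?powR_ge0.
    have -> : c i = t by rewrite /c min_r ?(ltW H2) // max_r.
    have -> : c i.+1 = t.
      by rewrite /c min_r ?max_r // (le_trans (ltW H2)) // tau_mono.
    by rewrite subrr mulr0 normr0 !mulr_ge0 ?powR_ge0.
  have ci : c i = s by rewrite /c min_l ?max_l // (le_trans H1).
  have [H3|H3] := leP (tau i.+1) s.
    have -> : c i.+1 = s by rewrite /c min_l ?max_l // (le_trans H3).
    by rewrite ci subrr mulr0 normr0 !mulr_ge0 ?powR_ge0.
  rewrite normrM ler_pM // ?ci.
    rewrite distrC; apply: (le_trans (hf _ _ (atau i) H1 (le_trans st tb))).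
    rewrite ler_wpM2l // le_powR ?subr_ge0 ?(ltW al0) //.
    by move: H3; rewrite tauS; lra.
  rewrite -ci; apply: (le_trans (hg _ _ (ac i) (c_mono _ _ (leqnSn i)) (cb _))).
  by rewrite ler_wpM2l // le_powR ?subr_ge0 ?(ltW be0) ?c_mono.
rewrite -(addr0 (\sum_(0 <= i < n.+1) f (tau i) * _)) .
have -> : \sum_(0 <= i < n.+1) f (tau i) * (g (c i.+1) - g (c i)) =
  \sum_(0 <= i < n.+1) f (c i) * (g (c i.+1) - g (c i)) +
  \sum_(0 <= i < n.+1) (f (tau i) - f (c i)) * (g (c i.+1) - g (c i)).
  rewrite -big_split /=; apply: eq_bigr => i _; ring.
rewrite addr0 addrAC; apply: (le_trans (ler_normD _ _)); exact: lerD.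
Qed.

Lemma young_primitive_exists f g a b al be A B K :
  0 < al -> 0 < be -> 1 < al + be -> sewing_constant (al + be) K ->
  0 <= A -> 0 <= B -> a <= b -> holder_on a b al A f -> holder_on a b be B g ->
  exists Phi, forall s t, a <= s -> s <= t -> t <= b ->
    `|Phi t - Phi s - f s * (g t - g s)| <= K * (A * B) * (t - s) `^ (al + be).
Proof.
move=> al0 be0 mu1 hK A0 B0 ab hf hg.
have [U [UU subU]] := @ultraFilterLemma nat \oo _.
pose S n t := stopped_sum f g a ((b - a) / n.+1%:R) n.+1 t.
pose e n := (b - a) * (A * B) * ((b - a) / n.+1%:R) `^ (al + be - 1).
have S0 n : S n a = 0.
  rewrite /S /stopped_sum big1 // => i _.
  by rewrite !min_r ?subrr ?mulr0 // lerDl mulr_ge0 // divr_ge0 // subr_ge0.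
have Sinc n s t := @stopped_sum_increment f g a b al be A B K n s t
   al0 be0 mu1 hK A0 B0 hf hg.
have {}Sinc n s t as_ st tb := Sinc n s t as_ st tb _ erefl.
have ba0 : 0 <= b - a by rewrite subr_ge0.
have e_le n : e n <= e 0%N.
  rewrite ler_wpM2l ?mulr_ge0 // le_powR ?subr_ge0 ?(ltW mu1) //.
    by rewrite divr_ge0.
  by rewrite ler_wpM2l // lef_pV2 ?posrE // ler1n.
have lims (t : R) : exists l : R, (a <= t <= b -> S n t @[n --> U] --> l).
  have [tab|] := boolP (a <= t <= b); last by exists 0.
  have /andP[at_ tb] := tab.
  have [|l ?] := @ultra_cvg_bounded U (S ^~ t)
    (`|f a * (g t - g a)| + (K * (A * B) * (t - a) `^ (al + be) + e 0%N)) UU.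
    move=> n; have := Sinc n a t (lexx a) at_ tb.
    rewrite -/(S n t) -/(S n a) S0 subr0 -/(e n) => H.
    rewrite -(subrK (f a * (g t - g a)) (S n t)) addrC.
    apply: (le_trans (ler_normD _ _)); rewrite lerD2l.
    by apply: (le_trans H); rewrite lerD2l.
  by exists l.
have [Phi HPhi] := choice lims.
exists Phi => s t as_ st tb.
have sb := le_trans st tb; have at_ := le_trans as_ st.
have cs := HPhi s (introT andP (conj as_ sb)).
have ct := HPhi t (introT andP (conj at_ tb)).
have ce : e n @[n --> U] --> 0.
  apply: cvg_trans (_ : e n @[n --> \oo] --> 0).
    by move=> X; exact: subU.
  rewrite -(mulr0 ((b - a) * (A * B))).
  by apply: cvgMl_tmp; apply: cvg_mesh_powR => //; rewrite subr_gt0.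
have l1 : `|S n t - S n s - f s * (g t - g s)| @[n --> U] -->
    `|Phi t - Phi s - f s * (g t - g s)|.
  by apply: cvg_norm; apply: cvgB; [exact: cvgB|exact: cvg_cst].
have l2 : K * (A * B) * (t - s) `^ (al + be) + e n @[n --> U] -->
    K * (A * B) * (t - s) `^ (al + be).
  by rewrite -[X in _ --> X]addr0; apply: cvgD => //; exact: cvg_cst.
by apply: (ler_cvg_to l1 l2); apply: nearW => n; exact: Sinc.
Qed.

End YoungExistence.

(** * Riemann-Stieltjes integrals of Hölder functions *)

Section RiemannStieltjes.
Context {R : realType}.
Implicit Types (a b s t u v mu K M al be A B C : R) (f g F Phi : R -> R).

Lemma RS_sum_cons f g a x (p : seq R) (xi : nat -> R) :
  RS_sum f g a (x :: p) xi =
  f (xi 0%N) * (g x - g a) + RS_sum f g x p (fun k => xi k.+1).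
Proof. by rewrite /RS_sum /= big_ord_recl. Qed.

(** In each cell the sum misses the increment of [Phi] by [C (t - s) `^ mu],
    which is at most [C eta `^ (mu - 1)] times the length of the cell. *)
Lemma RS_sum_primitive f g Phi b mu C eta (p : seq R) a xi :
  1 < mu -> 0 <= C -> 0 <= eta ->
  (forall s x t, a <= s -> s <= x -> x <= t -> t <= b ->
    `|Phi t - Phi s - f x * (g t - g s)| <= C * (t - s) `^ mu) ->
  tagged_partition a b p xi -> mesh_lt a p eta ->
  `|RS_sum f g a p xi - (Phi b - Phi a)| <= C * eta `^ (mu - 1) * (b - a).
Proof.
move=> mu1 C0 eta0; elim: p a xi => [|x p IH] a xi hPhi [part tags] mesh.
  have -> : a = b by exact: itv_partition_nil part.
  by rewrite /RS_sum big_ord0 !subrr mulr0 normr0.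
have xb : x <= b by exact: itv_partition_le (itv_partition_cons part).
have /andP[ax1 ax2] := tags 0%N isT; rewrite /= in ax1 ax2.
have ax : a <= x by exact: le_trans ax2.
have hx := mesh 0%N isT; rewrite /= in hx.
rewrite RS_sum_cons.
have H1 := hPhi a (xi 0%N) x (lexx a) ax1 ax2 xb.
have H2 : `|RS_sum f g x p (fun k => xi k.+1) - (Phi b - Phi x)| <=
   C * eta `^ (mu - 1) * (b - x).
  apply: IH.
  - by move=> s y t xs; apply: hPhi; exact: le_trans xs.
  - split; first exact: itv_partition_cons part.
    by move=> k kp; exact: (tags k.+1).
  - by move=> k kp; exact: (mesh k.+1).
have H3 : C * (x - a) `^ mu <= C * eta `^ (mu - 1) * (x - a).
  rewrite -mulrA ler_wpM2l // -mulr_powRB1 ?subr_ge0 ?(lt_trans ltr01) //.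
  by rewrite mulrC ler_wpM2r ?subr_ge0 // le_powR ?subr_ge0 ?(ltW mu1) ?(ltW hx) //.
set r := RS_sum _ _ _ _ _ in H2 *.
rewrite (_ : _ + r - _ = (r - (Phi b - Phi x)) -
  (Phi x - Phi a - f (xi 0%N) * (g x - g a))); last by ring.
apply: (le_trans (ler_normB _ _)).
apply: (le_trans (lerD H2 (le_trans H1 H3))).
by rewrite -mulrDr addrA subrK.
Qed.

Lemma is_RS_integral_primitive f g Phi a b mu C :
  a <= b -> 1 < mu -> 0 <= C ->
  (forall s x t, a <= s -> s <= x -> x <= t -> t <= b ->
    `|Phi t - Phi s - f x * (g t - g s)| <= C * (t - s) `^ mu) ->
  is_RS_integral f g a b (Phi b - Phi a).
Proof.
move=> ab mu1 C0 hPhi e e0.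
have D0 : 0 <= C * (b - a) by rewrite mulr_ge0 // subr_ge0.
have D1 : 0 < C * (b - a) + 1 by rewrite ltr_wpDl.
have q0 : 0 < e / (C * (b - a) + 1) by rewrite divr_gt0.
exists ((e / (C * (b - a) + 1)) `^ (mu - 1)^-1); first by rewrite powR_gt0.
move=> p xi hp mesh.
apply: le_lt_trans (RS_sum_primitive mu1 C0 (powR_ge0 _ _) hPhi hp mesh) _.
rewrite -powRrM mulVf ?gt_eqF ?subr_gt0 // powRr1 ?(ltW q0) //.
rewrite mulrAC mulrA ltr_pdivrMr // mulrC ltr_pM2l //.
by rewrite ltrDl.
Qed.

Lemma fine_partition_exists a b eta : a <= b -> 0 < eta ->
  exists p, itv_partition a b p /\ mesh_lt a p eta.
Proof.
move=> ab eta0; have [n] : exists n : nat, b - a <= n%:R * (eta / 2).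
  have e2 : 0 < eta / 2 by rewrite divr_gt0.
  exists (Num.bound ((b - a) / (eta / 2))).
  rewrite -ler_pdivrMr //; apply: ltW; apply: archi_boundP.
  by rewrite divr_ge0 ?subr_ge0 // ltW.
elim: n a ab => [|n IH] a.
  rewrite mul0r subr_le0 => ab ba; exists [::]; split => //.
  by split => //=; rewrite eq_le ab ba.
move=> ab nab; have [H|H] := leP b (a + eta / 2).
  move: ab; rewrite le_eqVlt => /predU1P[->|ab].
    by exists [::]; split => //; split.
  exists [:: b]; split; first exact: itv_partition1.
  by case=> // _ /=; move: eta0 H; lra.
have [||p [part mesh]] := IH (a + eta / 2).
- exact: ltW.
- by move: nab; rewrite -natr1 mulrDl mul1r; lra.
exists (a + eta / 2 :: p); split.
  case: part => pp lp; split => //=; rewrite pp andbT.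
  by rewrite ltrDl divr_gt0.
case=> [|k] /=; last by move=> kp; exact: mesh.
by move=> _; move: eta0; lra.
Qed.

Lemma is_RS_integral_unique f g a b I J : a <= b ->
  is_RS_integral f g a b I -> is_RS_integral f g a b J -> I = J.
Proof.
move=> ab hI hJ; apply/eqP; rewrite -subr_eq0 -normr_le0.
apply/ler_addgt0Pl => e e0; rewrite addr0.
have e2 : 0 < e / 2 by rewrite divr_gt0.
have [e1 e10 H1] := hI _ e2.
have [e3 e30 H3] := hJ _ e2.
have [|p [part mesh]] := @fine_partition_exists a b (Num.min e1 e3) ab.
  by rewrite lt_min e10.
pose xi k := nth 0 (a :: p) k.
have tp : tagged_partition a b p xi.
  split=> // k kp; rewrite /xi lexx /=.
  have : sorted <%O (a :: p) by case: part.
  move=> /(sortedP 0)/(_ k) /= /(_ kp); exact: ltW.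
have K1 : `|RS_sum f g a p xi - I| < e / 2.
  apply: H1 => // k kp; apply: lt_le_trans (mesh k kp) _.
  by rewrite ge_min lexx.
have K3 : `|RS_sum f g a p xi - J| < e / 2.
  apply: H3 => // k kp; apply: lt_le_trans (mesh k kp) _.
  by rewrite ge_min lexx orbT.
have -> : I - J = (RS_sum f g a p xi - J) - (RS_sum f g a p xi - I) by ring.
apply: le_trans (ler_normB _ _) _.
by move: K1 K3; lra.
Qed.

Lemma RS_integralE f g a b I : a <= b ->
  is_RS_integral f g a b I -> RS_integral f g a b = I.
Proof.
move=> ab hI; rewrite /RS_integral; case: xgetP => [J _ hJ|].
  exact: is_RS_integral_unique hJ hI.
by move=> /(_ I).
Qed.

(** The germs have tags at the left ends; for Hölder functions a tag elsewhere
    in the cell changes the germ by a term of the same order. *)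
Definition local_primitive a b mu f g Phi := exists2 C, 0 <= C &
  forall s t, a <= s -> s <= t -> t <= b ->
    `|Phi t - Phi s - f s * (g t - g s)| <= C * (t - s) `^ mu.

Lemma RS_integral_primitive f g Phi a b al be A B :
  0 <= al -> 0 <= be -> 1 < al + be -> 0 <= A -> 0 <= B ->
  holder_on a b al A f -> holder_on a b be B g ->
  local_primitive a b (al + be) f g Phi ->
  forall s t, a <= s -> s <= t -> t <= b -> RS_integral f g s t = Phi t - Phi s.
Proof.
move=> al0 be0 mu1 A0 B0 hf hg [C C0 hPhi] s t as_ st tb.
apply: RS_integralE => //.
apply: (@is_RS_integral_primitive _ _ _ _ _ (al + be) (C + A * B)) => //.
  by rewrite addr_ge0 // mulr_ge0.
move=> s' x t' ss' s'x xt' t't.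
have as' := le_trans as_ ss'; have t'b := le_trans t't tb.
have s't' := le_trans s'x xt'.
rewrite (_ : _ - f x * _ = (Phi t' - Phi s' - f s' * (g t' - g s')) -
  (f x - f s') * (g t' - g s')); last by ring.
apply: le_trans (ler_normB _ _) _; rewrite [leRHS]mulrDl; apply: lerD.
  exact: hPhi.
rewrite normrM powRD; last by rewrite gt_eqF // (lt_trans ltr01).
rewrite mulrACA ler_pM //; last exact: hg.
apply: le_trans (hf _ _ as' s'x (le_trans xt' t'b)) _.
by rewrite ler_wpM2l // le_powR ?subr_ge0 // lerD2r.
Qed.

(** The difference of two primitives has increments of order [mu > 1]: it is a
    primitive of [0], hence has the increments of a constant. *)
Lemma local_primitive_unique a b mu f g Phi Psi : a <= b -> 1 < mu ->
  local_primitive a b mu f g Phi -> local_primitive a b mu f g Psi ->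
  Phi b - Phi a = Psi b - Psi a.
Proof.
move=> ab mu1 [C C0 hC] [D D0 hD].
pose h x := Phi x - Psi x.
have : is_RS_integral (fun=> 0) (fun=> 0) a b (h b - h a).
  apply: (@is_RS_integral_primitive _ _ _ _ _ mu (C + D)) => //.
    exact: addr_ge0.
  move=> s x t as_ sx xt tb; have st := le_trans sx xt.
  rewrite mul0r subr0 [leRHS]mulrDl.
  rewrite (_ : h t - h s = (Phi t - Phi s - f s * (g t - g s)) -
     (Psi t - Psi s - f s * (g t - g s))); last by rewrite /h; ring.
  by apply: le_trans (ler_normB _ _) _; apply: lerD; [exact: hC|exact: hD].
have : is_RS_integral (fun=> 0) (fun=> 0) a b ((fun=> 0) b - (fun=> 0) a).
  apply: (@is_RS_integral_primitive _ _ _ _ _ mu 0) => //.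
  by move=> *; rewrite !subrr mulr0 subr0 normr0 mul0r.
move=> /(is_RS_integral_unique ab)/[apply].
rewrite subrr /h => e; apply/eqP; rewrite -subr_eq0 e; apply/eqP; ring.
Qed.

Section Young.
Variables (a b al be A B K : R) (f g : R -> R).
Hypotheses (al0 : 0 < al) (be0 : 0 < be) (mu1 : 1 < al + be).
Hypothesis (hK : sewing_constant (al + be) K).
Hypotheses (A0 : 0 <= A) (B0 : 0 <= B).
Hypotheses (hf : holder_on a b al A f) (hg : holder_on a b be B g).

Lemma RS_integral_local_primitive :
  local_primitive a b (al + be) f g (RS_integral f g a).
Proof.
have [ab|ba] := leP a b; last first.
  exists 0 => // s t as_ st tb; exfalso.
  by have := le_trans (le_trans as_ st) tb; rewrite leNgt ba.
have [Phi H] := young_primitive_exists al0 be0 mu1 hK A0 B0 ab hf hg.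
have KAB : 0 <= K * (A * B) by case: hK => K0 _; rewrite !mulr_ge0.
have HPhi : local_primitive a b (al + be) f g Phi by exists (K * (A * B)).
exists (K * (A * B)) => // s t as_ st tb.
have P := RS_integral_primitive (ltW al0) (ltW be0) mu1 A0 B0 hf hg HPhi (lexx a).
rewrite !P ?(le_trans as_) // ?(le_trans st) //.
by rewrite opprB addrA subrK; exact: H.
Qed.

Lemma RS_integralB s t : a <= s -> s <= t -> t <= b ->
  RS_integral f g s t = RS_integral f g a t - RS_integral f g a s.
Proof.
exact: (RS_integral_primitive (ltW al0) (ltW be0) mu1 A0 B0 hf hg
  RS_integral_local_primitive).
Qed.

Lemma young_bound s t : a <= s -> s <= t -> t <= b ->
  `|RS_integral f g s t - f s * (g t - g s)| <= K * (A * B) * (t - s) `^ (al + be).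
Proof.
move=> as_ st tb; have ab := le_trans as_ (le_trans st tb).
have [Phi H] := young_primitive_exists al0 be0 mu1 hK A0 B0 ab hf hg.
have KAB : 0 <= K * (A * B) by case: hK => K0 _; rewrite !mulr_ge0.
have HPhi : local_primitive a b (al + be) f g Phi by exists (K * (A * B)).
rewrite (RS_integral_primitive (ltW al0) (ltW be0) mu1 A0 B0 hf hg HPhi) //.
exact: H.
Qed.

End Young.

End RiemannStieltjes.

(** * Iterated integrals *)

Section IteratedIntegrals.
Context {R : realType}.
Implicit Types (a b s t u v K M al be sg c A B S : R) (f g F Q : R -> R).

Lemma holder_on_ge0 s t al A F : s <= t -> 0 < al ->
  holder_on s t al A F -> exists2 A', 0 <= A' & holder_on s t al A' F.
Proof.
move=> st al0 h; exists (Num.max A 0); first by rewrite le_max lexx orbT.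
move=> u v su uv vt; apply: le_trans (h _ _ su uv vt) _.
by rewrite ler_wpM2r ?powR_ge0 // le_max lexx.
Qed.

Lemma holder_on_linear s t al A1 A2 k (F F1 F2 : R -> R) :
  holder_on s t al A1 F1 -> holder_on s t al A2 F2 ->
  (forall u, s <= u -> u <= t -> F u = k * F1 u + F2 u) ->
  holder_on s t al (`|k| * A1 + A2) F.
Proof.
move=> h1 h2 e u v su uv vt.
rewrite (e v (le_trans su uv) vt) (e u su (le_trans uv vt)).
rewrite (_ : _ - _ = k * (F1 v - F1 u) + (F2 v - F2 u)); last by ring.
apply: le_trans (ler_normD _ _) _; rewrite normrM [leRHS]mulrDl.
by apply: lerD; [rewrite -mulrA ler_wpM2l //; exact: h1|exact: h2].
Qed.

Section OneIntegral.
Variables (s t al be A B K : R) (F g : R -> R).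
Hypotheses (al0 : 0 < al) (be0 : 0 < be) (mu1 : 1 < al + be).
Hypothesis (hK : sewing_constant (al + be) K).
Hypotheses (A0 : 0 <= A) (B0 : 0 <= B).
Hypotheses (hF : holder_on s t al A F) (hg : holder_on s t be B g).

Lemma RS_integral_increment M u v : s <= u -> u <= v -> v <= t ->
  `|F u| <= M ->
  `|RS_integral F g s v - RS_integral F g s u| <=
    B * (M + K * A * (v - u) `^ al) * (v - u) `^ be.
Proof.
move=> su uv vt FM.
rewrite -(RS_integralB al0 be0 mu1 hK A0 B0 hF hg) //.
have := young_bound al0 be0 mu1 hK A0 B0 hF hg su uv vt.
set I := RS_integral _ _ _ _ => H.
rewrite -(subrK (F u * (g v - g u)) I).
apply: le_trans (ler_normD _ _) _.
rewrite [leRHS](_ : _ = K * (A * B) * ((v - u) `^ al * (v - u) `^ be) +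
  M * (B * (v - u) `^ be)); last by ring.
by apply: lerD; [rewrite -powRD_pos|rewrite normrM ler_pM // hg].
Qed.

Lemma RS_integral_base : s <= t -> RS_integral F g s s = 0.
Proof.
by move=> st; rewrite (RS_integralB al0 be0 mu1 hK A0 B0 hF hg (lexx s) (lexx s)) // subrr.
Qed.

Lemma holder_on_RS_integral M : (forall u, s <= u -> u <= t -> `|F u| <= M) ->
  holder_on s t be (B * (M + K * A * (t - s) `^ al)) (RS_integral F g s).
Proof.
move=> hM u v su uv vt.
have K0 : 0 <= K by case: hK.
apply: le_trans (RS_integral_increment su uv vt (hM _ su (le_trans uv vt))) _.
rewrite ler_wpM2r ?powR_ge0 // ler_wpM2l // lerD2l ler_wpM2l ?mulr_ge0 //.
rewrite le_powR ?(ltW al0) ?subr_ge0 //; lra.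
Qed.

End OneIntegral.

Lemma RS_integral_linear s t al be A1 A2 B K k F F1 F2 g :
  0 < al -> 0 < be -> 1 < al + be -> sewing_constant (al + be) K ->
  0 <= A1 -> 0 <= A2 -> 0 <= B ->
  holder_on s t al A1 F1 -> holder_on s t al A2 F2 -> holder_on s t be B g ->
  (forall u, s <= u -> u <= t -> F u = k * F1 u + F2 u) ->
  forall u, s <= u -> u <= t ->
  RS_integral F g s u = k * RS_integral F1 g s u + RS_integral F2 g s u.
Proof.
move=> al0 be0 mu1 hK A10 A20 B0 h1 h2 hg e u su ut.
have hF := holder_on_linear h1 h2 e.
have A0 : 0 <= `|k| * A1 + A2 by rewrite addr_ge0 ?mulr_ge0.
have [C1 C10 p1] := RS_integral_local_primitive al0 be0 mu1 hK A10 B0 h1 hg.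
have [C2 C20 p2] := RS_integral_local_primitive al0 be0 mu1 hK A20 B0 h2 hg.
have b1 := RS_integral_base al0 be0 mu1 hK A10 B0 h1 hg (le_trans su ut).
have b2 := RS_integral_base al0 be0 mu1 hK A20 B0 h2 hg (le_trans su ut).
rewrite (@RS_integral_primitive _ F g (fun u => k * RS_integral F1 g s u +
  RS_integral F2 g s u) s t al be _ _ (ltW al0) (ltW be0) mu1 A0 B0 hF hg) //.
  by rewrite b1 b2 mulr0 addr0 subr0.
exists (`|k| * C1 + C2); first by rewrite addr_ge0 ?mulr_ge0.
move=> x y sx xy yt; rewrite e ?(le_trans xy) //.
have H1 := p1 _ _ sx xy yt; have H2 := p2 _ _ sx xy yt.
move: H1 H2; set I1 := RS_integral F1 g s; set I2 := RS_integral F2 g s => H1 H2.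
rewrite (_ : _ - _ = k * (I1 y - I1 x - F1 x * (g y - g x)) +
  (I2 y - I2 x - F2 x * (g y - g x))); last by ring.
apply: le_trans (ler_normD _ _) _; rewrite normrM [leRHS]mulrDl.
by apply: lerD => //; rewrite -mulrA ler_wpM2l.
Qed.

(** An integrand that vanishes at [s] like a power passes on its order, and the
    integrator adds its own exponent; iterating this accumulates the exponents
    of the letters of a word.  One [K] serves all pairs of exponents because
    both are at least [beta]. *)
Lemma RS_integral_growth s t sg c be beta B K M Q g : s <= t ->
  1 < beta + beta -> beta <= c -> beta <= be -> 0 <= sg ->
  sewing_constant (beta + beta) K -> 0 <= B -> 0 <= M ->
  Q s = 0 -> holder_on s t be B g ->
  (forall u v, s <= u -> u <= v -> v <= t ->
     `|Q v - Q u| <= M * (v - s) `^ sg * (v - u) `^ c) ->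
  RS_integral Q g s s = 0 /\
  forall u v, s <= u -> u <= v -> v <= t ->
     `|RS_integral Q g s v - RS_integral Q g s u| <=
       (1 + K) * B * M * (v - s) `^ (sg + c) * (v - u) `^ be.
Proof.
move=> st b1 bc bbe sg0 hK0 B0 M0 Q0 hg hQ.
have c0 : 0 < c by lra.
have be0 : 0 < be by lra.
have mu1 : 1 < c + be by lra.
have hK : sewing_constant (c + be) K.
  by apply: sewing_constant_le hK0; exact: lerD.
have K0 : 0 <= K by case: hK.
have loc v : v <= t -> holder_on s v c (M * (v - s) `^ sg) Q.
  move=> vt p q sp pq qv; apply: le_trans (hQ _ _ sp pq (le_trans qv vt)) _.
  rewrite ler_wpM2r ?powR_ge0 // ler_wpM2l // le_powR // ?subr_ge0 ?lerD2r //.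
  exact: le_trans pq.
have hgv v : v <= t -> holder_on s v be B g by move=> vt; apply: holder_on_sub hg.
split.
  apply: (@RS_integral_base s t c be (M * (t - s) `^ sg) B K) => //.
    by rewrite mulr_ge0 ?powR_ge0.
  exact: loc.
move=> u v su uv vt.
have sv := le_trans su uv.
have MA0 : 0 <= M * (v - s) `^ sg by rewrite mulr_ge0 ?powR_ge0.
have Qu : `|Q u| <= M * (v - s) `^ sg * (v - s) `^ c.
  rewrite -[Q u]subr0 -Q0; apply: le_trans (hQ _ _ (lexx s) su (le_trans uv vt)) _.
  by rewrite ler_pM ?mulr_ge0 ?powR_ge0 // ?ler_wpM2l // le_powR ?subr_ge0 ?lerD2r // ltW.
apply: le_trans (RS_integral_increment c0 be0 mu1 hK MA0 B0 (loc _ vt) (hgv _ vt)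
  su uv (lexx v) Qu) _.
rewrite ler_wpM2r ?powR_ge0 // powRD; last by rewrite gt_eqF // ltr_wpDl.
have uvc : (v - u) `^ c <= (v - s) `^ c.
  by rewrite le_powR ?(ltW c0) ?subr_ge0 //; lra.
set P := M * (v - s) `^ sg in MA0 *.
have -> : (1 + K) * B * M * ((v - s) `^ sg * (v - s) `^ c) =
   B * (P * (v - s) `^ c + K * P * (v - s) `^ c) by rewrite /P; ring.
by rewrite ler_wpM2l // lerD2l ler_wpM2l // mulr_ge0.
Qed.

Variables (m : nat) (x : R -> 'rV[R]_m).

(** The iterated integral with an arbitrary integrand [F] in place of [1], as
    it occurs in the remainder of the Taylor expansion. *)
Definition iter_int (w : seq 'I_m) F s : R -> R :=
  foldl (fun F (j : 'I_m) => fun u => RS_integral F (fun v => x v 0 j) s u) F w.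

Lemma iterated_integralE w s t :
  iterated_integral x w s t = iter_int w (fun=> 1) s t.
Proof. by []. Qed.

Lemma iter_int_growth s t beta K S (e : 'I_m -> R) w sg c M Q :
  1 < beta + beta -> beta <= c -> (forall j, beta <= e j) -> 0 <= sg ->
  sewing_constant (beta + beta) K -> 0 <= S -> 0 <= M -> s <= t ->
  (forall j, holder_on s t (e j) S (fun v => x v 0 j)) ->
  Q s = 0 ->
  (forall u v, s <= u -> u <= v -> v <= t ->
     `|Q v - Q u| <= M * (v - s) `^ sg * (v - u) `^ c) ->
  `|iter_int w Q s t| <= ((1 + K) * S) ^+ size w * M *
     (t - s) `^ (sg + c + \sum_(j <- w) e j).
Proof.
move=> b1 + be + hK S0 + st hx.
have K0 : 0 <= K by case: hK.
elim: w Q sg c M => [|j w IH] Q sg c M bc sg0 M0 Q0 hQ.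
  rewrite /= big_nil addr0 expr0 mul1r powRD; last by rewrite gt_eqF //; lra.
  have := hQ s t (lexx _) st (lexx _).
  by rewrite Q0 subr0 mulrA.
have [q0 hq] := RS_integral_growth st b1 bc (be j) sg0 hK S0 M0 Q0 (hx j) hQ.
have := IH _ _ _ _ (be j) _ _ q0 hq; rewrite /= => {}IH.
apply: le_trans (IH _ _) _.
- by rewrite addr_ge0 //; lra.
- by rewrite !mulr_ge0 // addr_ge0.
rewrite big_cons exprS addrA.
by rewrite le_eqVlt; apply/orP; left; apply/eqP; ring.
Qed.

(** The first integral is of the order of its integrator only, since [F] need
    not vanish at [s]; from then on [iter_int_growth] applies. *)
Lemma iter_int_bound s t beta K S (e : 'I_m -> R) w A M F :
  1 < beta + beta -> (forall j, beta <= e j) ->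
  sewing_constant (beta + beta) K -> 0 <= S -> 0 <= M -> 0 <= A -> s <= t ->
  (forall j, holder_on s t (e j) S (fun v => x v 0 j)) ->
  holder_on s t beta A F -> (forall u, s <= u -> u <= t -> `|F u| <= M) ->
  `|iter_int w F s t| <= ((1 + K) * S) ^+ size w * (M + A * (t - s) `^ beta) *
     (t - s) `^ (\sum_(j <- w) e j).
Proof.
move=> b1 be hK S0 M0 A0 st hx hF hM.
have K0 : 0 <= K by case: hK.
have bt0 : 0 < beta by lra.
have AP0 : 0 <= A * (t - s) `^ beta by rewrite mulr_ge0 ?powR_ge0.
case: w => [|j w].
  rewrite /= big_nil powRr0 mulr1 expr0 mul1r.
  by apply: le_trans (hM _ st (lexx t)) _; rewrite lerDl.
have e0 : 0 < e j by apply: lt_le_trans (be j).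
have mu1 : 1 < beta + e j by have := be j; lra.
have hKj : sewing_constant (beta + e j) K.
  by apply: sewing_constant_le hK; rewrite lerD2l.
have h1 := holder_on_RS_integral bt0 e0 mu1 hKj A0 S0 hF (hx j) hM.
have b0 := RS_integral_base bt0 e0 mu1 hKj A0 S0 hF (hx j) st.
have C0 : 0 <= S * (M + K * A * (t - s) `^ beta).
  by rewrite mulr_ge0 // addr_ge0 // mulr_ge0 ?powR_ge0 // mulr_ge0.
have := @iter_int_growth s t beta K S e w 0 (e j) _ (RS_integral F (fun v => x v 0 j) s)
  b1 (be j) be (lexx 0) hK S0 C0 st hx b0 _.
rewrite add0r => H; rewrite big_cons; apply: le_trans (H _) _.
  by move=> u v su uv vt; rewrite powRr0 mulr1; exact: h1.
rewrite ler_wpM2r ?powR_ge0 //= exprSr -[leRHS]mulrA ler_wpM2l ?exprn_ge0 ?mulr_ge0 ?addr_ge0 //.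
rewrite [(1 + K) * S]mulrC -[leRHS]mulrA ler_wpM2l //.
have KM : 0 <= K * M by rewrite mulr_ge0.
rewrite mulrDr !mulrDl !mul1r; lra.
Qed.

Section Linearity.
Variables (s t beta X K : R).
Hypotheses (st : s <= t) (b1 : 1 < beta + beta) (X0 : 0 <= X).
Hypothesis hK : sewing_constant (beta + beta) K.
Hypothesis hx : forall j, holder_on s t beta X (fun v => x v 0 j).

(** The class in which linearity of the iterated integrals is proved; it is
    stable under integration. *)
Definition regular F := exists A, holder_on s t beta A F.

Lemma regular_cst c : regular (fun=> c).
Proof. by exists 0 => u v _ _ _; rewrite /= subrr normr0 mul0r lexx. Qed.

Let bt0 : 0 < beta. Proof. by move: b1; lra. Qed.

Lemma regular_RS F j : regular F -> regular (RS_integral F (fun v => x v 0 j) s).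
Proof.
move=> [A hA]; have {A hA}[A A0 hA] := holder_on_ge0 st bt0 hA.
eexists; apply: (holder_on_RS_integral bt0 bt0 b1 hK A0 X0 hA (hx j)
  (M := `|F s| + A * (t - s) `^ beta)).
move=> u su ut; rewrite -(subrK (F s) (F u)) addrC.
apply: le_trans (ler_normD _ _) _; rewrite lerD2l.
apply: le_trans (hA _ _ (lexx s) su ut) _.
by rewrite ler_wpM2l // le_powR ?(ltW bt0) ?subr_ge0 ?lerD2r.
Qed.

Lemma iter_int_linear w k F F1 F2 : regular F1 -> regular F2 ->
  (forall u, s <= u -> u <= t -> F u = k * F1 u + F2 u) ->
  forall u, s <= u -> u <= t ->
  iter_int w F s u = k * iter_int w F1 s u + iter_int w F2 s u.
Proof.
elim: w F F1 F2 => [|j w IH] F F1 F2 r1 r2 e; first exact: e.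
apply: IH; [exact: regular_RS|exact: regular_RS|].
case: r1 r2 => [A1 h1] [A2 h2].
have {A1 h1}[A1 A10 h1] := holder_on_ge0 st bt0 h1.
have {A2 h2}[A2 A20 h2] := holder_on_ge0 st bt0 h2.
exact: (RS_integral_linear bt0 bt0 b1 hK A10 A20 X0 h1 h2 (hx j) e).
Qed.

Lemma iter_int_sum w c F (I : Type) (r : seq I) (G : I -> R -> R) :
  (forall i, regular (G i)) ->
  (forall u, s <= u -> u <= t -> F u = c + \sum_(i <- r) G i u) ->
  iter_int w F s t = c * iter_int w (fun=> 1) s t + \sum_(i <- r) iter_int w (G i) s t.
Proof.
move=> rG e.
have rS (r' : seq I) : regular (fun u => \sum_(i <- r') G i u).
  elim: r' => [|i r' [A hA]].
    by exists 0 => u v _ _ _; rewrite !big_nil subrr normr0 mul0r lexx.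
  have [A1 h1] := rG i; exists (`|1| * A1 + A).
  by apply: (holder_on_linear h1 hA) => u _ _; rewrite big_cons mul1r.
rewrite (@iter_int_linear w c F (fun=> 1) (fun u => \sum_(i <- r) G i u)) //;
  [|exact: regular_cst|by move=> u su ut; rewrite mulr1 e].
congr (_ + _); elim: r {e} => [|i r IH].
  rewrite big_nil (@iter_int_linear w 0 _ (fun=> 0) (fun=> 0)) //;
    [|exact: regular_cst|exact: regular_cst|by move=> u _ _; rewrite big_nil mul0r addr0].
  rewrite mul0r add0r.
  have := @iter_int_linear w 1 (fun=> 0) (fun=> 0) (fun=> 0) (regular_cst 0) (regular_cst 0).
  move=> /(_ _ t st (lexx t)) H.
  have {}H : iter_int w (fun=> 0) s t = 1 * iter_int w (fun=> 0) s t + iter_int w (fun=> 0) s t.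
    by apply: H => u _ _; rewrite mulr0 addr0.
  by move: H; rewrite mul1r; lra.
rewrite big_cons (@iter_int_linear w 1 _ (G i) (fun u => \sum_(i <- r) G i u)) //.
  by rewrite mul1r IH.
by move=> u _ _; rewrite big_cons mul1r.
Qed.

End Linearity.

End IteratedIntegrals.

(** * Differences along coordinate directions *)

Section CoordinateCalculus.
Context {R : realType} {d : nat}.
Implicit Types (f g : 'rV[R]_d -> R) (z w p : 'rV[R]_d) (i k : 'I_d).

Lemma coord_le_norm z i : `|z 0 i| <= `|z|.
Proof.
rewrite [leRHS]/Num.norm /= mx_normrE.
by apply/bigmax_geP; right; exists (0, i).
Qed.

Lemma norm_le_coord z (B : R) : 0 <= B -> (forall i, `|z 0 i| <= B) -> `|z| <= B.
Proof.
move=> B0 h; rewrite [leLHS]/Num.norm /= mx_normrE.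
by apply/bigmax_leP; split => // -[j i] _ /=; rewrite (ord1 j).
Qed.

Lemma is_derive_line f i p (a : R) : (forall z, derivable f z (delta_mx 0 i)) ->
  forall t : R, is_derive t 1 (fun s : R => f (p + (s * a) *: delta_mx 0 i))
    (a * partial i f (p + (t * a) *: delta_mx 0 i)).
Proof.
move=> df t.
have h1 (s : R) : is_derive s 1 (fun s : R => f (p + s *: delta_mx 0 i))
    (partial i f (p + s *: delta_mx 0 i)).
  have eqf : (fun h : R => h^-1 *: (((fun s : R => f (p + s *: delta_mx 0 i))
        \o shift s) (h *: 1) - f (p + s *: delta_mx 0 i))) =
    (fun h : R => h^-1 *: ((f \o shift (p + s *: delta_mx 0 i))
        (h *: delta_mx 0 i) - f (p + s *: delta_mx 0 i))).
    apply/funext => h /=; congr (_ *: (f _ - _)).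
    by rewrite [h *: 1]mulr1 scalerDl addrCA.
  split; first by rewrite /derivable eqf; exact: df.
  by rewrite /partial /derive eqf.
have h2 : is_derive t 1 (fun s : R => s * a) a.
  have -> : (fun s : R => s * a) = a \*: (@id R).
    by apply/funext => s /=; rewrite mulrC.
  by apply: is_derive_eq; rewrite /GRing.scale /= mulr1.
have := @is_derive1_comp R (fun s : R => f (p + s *: delta_mx 0 i))
  (fun s : R => s * a) t _ _ (h1 (t * a)) h2.
by rewrite mulrC.
Qed.

(** The path from [w] to [z] that changes one coordinate after the other, here
    while coordinate [k] moves: only partial derivatives occur along it. *)
Definition corner_path k (c : R) z w : 'rV[R]_d :=
  \row_i (if (i < k)%N then z 0 i
          else if i == k then w 0 i + c * (z 0 i - w 0 i) else w 0 i).

Lemma corner_pathE k c z w : corner_path k c z w =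
  corner_path k 0 z w + (c * (z 0 k - w 0 k)) *: delta_mx 0 k.
Proof.
apply/rowP => i; rewrite !mxE ?eqxx /=.
have [->|ik] := eqVneq i k; first by rewrite ltnn mul0r addr0 mulr1.
by rewrite mulr0 addr0.
Qed.

Lemma corner_path_telescope f z w :
  f z - f w = \sum_k (f (corner_path k 1 z w) - f (corner_path k 0 z w)).
Proof.
pose hyb (n : nat) : 'rV[R]_d := \row_i (if (i < n)%N then z 0 i else w 0 i).
have -> : z = hyb d by apply/rowP => i; rewrite mxE ltn_ord.
have e0 : w = hyb 0%N by apply/rowP => i; rewrite mxE.
rewrite [in LHS]e0 -(telescope_sumr (fun n => f (hyb n)) (leq0n d)) big_mkord.
apply: eq_bigr => k _; congr (f _ - f _); apply/rowP => i; rewrite !mxE ltn_ord.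
- rewrite ltnS leq_eqVlt mul1r subrKC.
  have [->|ik] := eqVneq i k; first by rewrite eqxx ltnn.
  by rewrite [(i == k :> nat)](negbTE ik).
- by rewrite mul0r addr0; case: ifP => //; case: ifP.
Qed.

Lemma corner_path_dist k c z w : 0 <= c <= 1 -> `|corner_path k c z w - w| <= `|z - w|.
Proof.
move=> /andP[c0 c1]; apply: norm_le_coord => // i; rewrite !mxE.
have H := coord_le_norm (z - w) i; rewrite !mxE in H.
case: ifP => // _; case: ifP => _; last by rewrite subrr normr0.
rewrite addrC addKr normrM ger0_norm //; apply: le_trans H.
by rewrite ler_piMl.
Qed.

Lemma corner_path_dist2 k c z w z' w' : 0 <= c <= 1 ->
  `|corner_path k c z' w' - corner_path k c z w| <= `|z' - z| + `|w' - w|.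
Proof.
move=> /andP[c0 c1]; apply: norm_le_coord => [|i]; first by rewrite addr_ge0.
have H := coord_le_norm (z' - z) i; have H' := coord_le_norm (w' - w) i.
rewrite !mxE in H H' *.
case: ifP => _; first by apply: le_trans H _; rewrite lerDl.
case: ifP => _; last by apply: le_trans H' _; rewrite lerDr.
rewrite [X in `|X|](_ : _ = c * (z' 0 i - z 0 i) + (1 - c) * (w' 0 i - w 0 i));
  last by ring.
apply: le_trans (ler_normD _ _) _; rewrite !normrM.
have c1' : 0 <= 1 - c by rewrite subr_ge0.
rewrite (ger0_norm c0) (ger0_norm c1').
by apply: lerD; [apply: le_trans H|apply: le_trans H']; rewrite ler_piMl // lerBlDr lerDl.
Qed.

Lemma corner_path_mvt f k z w : (forall z, derivable f z (delta_mx 0 k)) ->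
  exists2 c, 0 <= c <= 1 & f (corner_path k 1 z w) - f (corner_path k 0 z w) =
    (z 0 k - w 0 k) * partial k f (corner_path k c z w).
Proof.
move=> df; pose a := z 0 k - w 0 k.
have D := is_derive_line (corner_path k 0 z w) a df.
have [|c c01] := @MVT R _ _ 0 1 ltr01 (fun t _ => D t).
  by apply: derivable_within_continuous => t _; case: (D t).
rewrite mul0r scale0r addr0 mul1r subr0 mulr1 => e.
exists c; first by rewrite !ltW // (itvP c01).
by rewrite (corner_pathE k 1) mul1r e (corner_pathE k c).
Qed.

(** The mean value theorem for the difference of two segments gives a common
    parameter [c], without which second differences could not be compared. *)
Lemma corner_path_mvt2 f k z w z' w' (B : R) :
  (forall z, derivable f z (delta_mx 0 k)) ->
  (forall c, 0 <= c <= 1 ->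
    `|(z' 0 k - w' 0 k) * partial k f (corner_path k c z' w') -
      (z 0 k - w 0 k) * partial k f (corner_path k c z w)| <= B) ->
  `|(f (corner_path k 1 z' w') - f (corner_path k 0 z' w')) -
    (f (corner_path k 1 z w) - f (corner_path k 0 z w))| <= B.
Proof.
move=> df hB.
have D' := is_derive_line (corner_path k 0 z' w') (z' 0 k - w' 0 k) df.
have D := is_derive_line (corner_path k 0 z w) (z 0 k - w 0 k) df.
have DD t := @is_deriveB R R R _ _ t 1 _ _ (D' t) (D t).
have [|c c01] := @MVT R _ _ 0 1 ltr01 (fun t _ => DD t).
  by apply: derivable_within_continuous => t _; case: (DD t).
rewrite !fctE !mul0r !scale0r !addr0 !mul1r subr0 mulr1 => e.
rewrite (corner_pathE k 1 z') (corner_pathE k 1 z) !mul1r.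
rewrite [X in `|X|](_ : _ = (z' 0 k - w' 0 k) * partial k f (corner_path k c z' w') -
      (z 0 k - w 0 k) * partial k f (corner_path k c z w)).
  by apply: hB; rewrite !ltW // (itvP c01).
rewrite (corner_pathE k c z') (corner_pathE k c z) -e; ring.
Qed.

Lemma lipschitz_partial f (M : R) : (forall k z, derivable f z (delta_mx 0 k)) ->
  (forall k z, `|partial k f z| <= M) ->
  forall z w, `|f z - f w| <= d%:R * M * `|z - w|.
Proof.
move=> df hM z w; rewrite corner_path_telescope.
apply: le_trans (ler_norm_sum _ _ _) _.
rewrite -mulrA mulr_natl -[X in _ *+ X]card_ord -sumr_const; apply: ler_sum => k _.
have [c _ ->] := corner_path_mvt z w (df k).
rewrite normrM mulrC ler_pM //.
by have := coord_le_norm (z - w) k; rewrite !mxE.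
Qed.

Lemma taylor_partial f (L : R) : 0 <= L -> (forall k z, derivable f z (delta_mx 0 k)) ->
  (forall k z w, `|partial k f z - partial k f w| <= L * `|z - w|) ->
  forall z w, `|f z - f w - \sum_k partial k f w * (z 0 k - w 0 k)| <=
    d%:R * L * `|z - w| ^+ 2.
Proof.
move=> L0 df hL z w; rewrite corner_path_telescope -sumrB.
apply: le_trans (ler_norm_sum _ _ _) _.
rewrite -mulrA mulr_natl -[X in _ *+ X]card_ord -sumr_const; apply: ler_sum => k _.
have [c c01 ->] := corner_path_mvt z w (df k).
rewrite [X in `|X|](_ : _ = (partial k f (corner_path k c z w) - partial k f w) *
  (z 0 k - w 0 k)); last by ring.
have H := coord_le_norm (z - w) k; rewrite !mxE in H.
rewrite normrM expr2 mulrA ler_pM //; apply: le_trans (hL _ _ _) _.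
by rewrite ler_wpM2l // corner_path_dist.
Qed.

Lemma four_point_partial f (M L : R) : 0 <= L ->
  (forall k z, derivable f z (delta_mx 0 k)) ->
  (forall k z, `|partial k f z| <= M) ->
  (forall k z w, `|partial k f z - partial k f w| <= L * `|z - w|) ->
  forall z w z' w', `|(f z' - f w') - (f z - f w)| <=
    d%:R * (M * `|(z' - w') - (z - w)| + L * (`|z' - z| + `|w' - w|) * `|z - w|).
Proof.
move=> L0 df hM hL z w z' w'; rewrite !corner_path_telescope -sumrB.
apply: le_trans (ler_norm_sum _ _ _) _.
rewrite mulr_natl -[X in _ *+ X]card_ord -sumr_const; apply: ler_sum => k _.
apply: corner_path_mvt2 => // c c01.
set P' := partial _ _ _; set P := partial k f (corner_path k c z w).
rewrite [X in `|X|](_ : _ = P' * ((z' 0 k - w' 0 k) - (z 0 k - w 0 k)) +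
  (P' - P) * (z 0 k - w 0 k)); last by ring.
apply: le_trans (ler_normD _ _) _; rewrite !normrM.
have H := coord_le_norm (z - w) k; have H' := coord_le_norm ((z' - w') - (z - w)) k.
rewrite !mxE in H H'.
apply: lerD; apply: ler_pM => //.
  exact: hM.
by apply: le_trans (hL _ _ _) _; rewrite ler_wpM2l // corner_path_dist2.
Qed.

End CoordinateCalculus.

(** * Functions with bounded derivatives *)

Section BoundedDerivatives.
Context {R : realType} {d : nat}.
Implicit Types (f g : 'rV[R]_d -> R).

Lemma CbW k f : Cb k.+1 f -> Cb k f.
Proof.
elim: k f => [|k IH] f [cf bf h]; first by split.
by split => // i; have [df hf] := h i; split => //; exact: IH.
Qed.

Lemma Cb_le k l f : (k <= l)%N -> Cb l f -> Cb k f.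
Proof.
move=> /subnKC <-; elim: (l - k)%N => [|n IH]; first by rewrite addn0.
by rewrite addnS => /CbW.
Qed.

Lemma Cb_derivable k f : Cb k.+1 f -> forall i z, derivable f z (delta_mx 0 i).
Proof. by move=> [_ _ h] i; case: (h i). Qed.

Lemma Cb_partial k f : Cb k.+1 f -> forall i, Cb k (partial i f).
Proof. by move=> [_ _ h] i; case: (h i). Qed.

Lemma Cb_bounded k f : Cb k f -> exists2 M, 0 <= M & forall z, `|f z| <= M.
Proof.
by case: k => [|k] [_ [M hM] _]; exists M => //; apply: le_trans (hM 0).
Qed.

Lemma Cb_continuous k f : Cb k f -> forall z, {for z, continuous f}.
Proof. by case: k => [|k] [cf _ _] z; exact: cf. Qed.
#[local] Arguments Cb_continuous {k f} _ z _ _.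

Lemma Cb_cst k (c : R) : Cb k (fun _ : 'rV[R]_d => c).
Proof.
elim: k c => [|k IH] c; split => //; try exact: cst_continuous.
- by exists `|c|.
- by exists `|c|.
move=> i; split; first by move=> z; exact: derivable_cst.
by rewrite (_ : partial _ _ = fun=> 0) //; apply/funext => z; rewrite /partial derive_cst.
Qed.

Lemma CbD k f g : Cb k f -> Cb k g -> Cb k (fun z => f z + g z).
Proof.
elim: k f g => [|k IH] f g hf hg.
  have [M _ hM] := Cb_bounded hf; have [M' _ hM'] := Cb_bounded hg.
  split => //.
    by move=> z; exact: (continuousD (Cb_continuous hf z) (Cb_continuous hg z)).
  by exists (M + M') => z; apply: le_trans (ler_normD _ _) _; exact: lerD.
have df := Cb_derivable hf; have dg := Cb_derivable hg.
split.
- move=> z; exact: (Cb_continuous (IH _ _ (CbW hf) (CbW hg))).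
- by have [M _ hM] := Cb_bounded (IH _ _ (CbW hf) (CbW hg)); exists M.
move=> i; split; first by move=> z; exact: derivableD.
rewrite (_ : partial _ _ = fun z => partial i f z + partial i g z).
  by apply: IH; exact: Cb_partial.
by apply/funext => z; rewrite /partial -deriveD.
Qed.

Lemma CbM k f g : Cb k f -> Cb k g -> Cb k (fun z => f z * g z).
Proof.
elim: k f g => [|k IH] f g hf hg.
  have [M M0 hM] := Cb_bounded hf; have [M' M'0 hM'] := Cb_bounded hg.
  split => //.
    by move=> z; exact: (continuousM (Cb_continuous hf z) (Cb_continuous hg z)).
  by exists (M * M') => z; rewrite normrM ler_pM.
have df := Cb_derivable hf; have dg := Cb_derivable hg.
split.
- move=> z; exact: (Cb_continuous (IH _ _ (CbW hf) (CbW hg))).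
- by have [M _ hM] := Cb_bounded (IH _ _ (CbW hf) (CbW hg)); exists M.
move=> i; split; first by move=> z; exact: derivableM.
rewrite (_ : partial _ _ = fun z => f z * partial i g z + g z * partial i f z).
  by apply: CbD; apply: IH; (exact: Cb_partial || exact: CbW).
by apply/funext => z; rewrite /partial (deriveM (df i z) (dg i z)).
Qed.

Lemma Cb_sum k (I : Type) (r : seq I) (f : I -> 'rV[R]_d -> R) :
  (forall i, Cb k (f i)) -> Cb k (fun z => \sum_(i <- r) f i z).
Proof.
move=> hf; elim: r => [|i r IH].
  rewrite (_ : (fun _ => _) = fun=> 0); first exact: Cb_cst.
  by apply/funext => z; rewrite big_nil.
rewrite (_ : (fun _ => _) = fun z => f i z + \sum_(j <- r) f j z).
  exact: CbD.
by apply/funext => z; rewrite big_cons.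
Qed.

Lemma Cb_lipschitz f : Cb 1 f ->
  exists2 L, 0 <= L & forall z w, `|f z - f w| <= L * `|z - w|.
Proof.
move=> hf; have df := Cb_derivable hf.
have /choice[M hM] : forall i, exists M, 0 <= M /\ forall z, `|partial i f z| <= M.
  by move=> i; have [M M0 hM] := Cb_bounded (Cb_partial hf i); exists M.
have M0 : 0 <= \sum_i M i by apply: sumr_ge0 => i _; case: (hM i).
exists (d%:R * \sum_i M i); first by rewrite mulr_ge0.
apply: lipschitz_partial => // k z; have [Mk h] := hM k.
apply: le_trans (h z) _; rewrite (bigD1 k) //= lerDl.
by apply: sumr_ge0 => i _; case: (hM i).
Qed.

Lemma Cb_second_order f : Cb 2 f -> exists2 L, 0 <= L &
  [/\ forall k z, `|partial k f z| <= L,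
      forall z w, `|f z - f w - \sum_k partial k f w * (z 0 k - w 0 k)| <=
        L * `|z - w| ^+ 2 &
      forall z w z' w', `|(f z' - f w') - (f z - f w)| <=
        L * (`|(z' - w') - (z - w)| + (`|z' - z| + `|w' - w|) * `|z - w|)].
Proof.
move=> hf; have df := Cb_derivable hf.
have /choice[M hM] : forall i, exists M, [/\ 0 <= M,
   forall z, `|partial i f z| <= M &
   forall z w, `|partial i f z - partial i f w| <= M * `|z - w|].
  move=> i; have [M M0 hM] := Cb_bounded (Cb_partial hf i).
  have [L L0 hL] := Cb_lipschitz (Cb_partial hf i).
  exists (M + L); split; first exact: addr_ge0.
    by move=> z; apply: le_trans (hM z) _; rewrite lerDl.
  by move=> z w; apply: le_trans (hL z w) _; rewrite ler_wpM2r // lerDr.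
pose B := \sum_i M i.
have M0 i : 0 <= M i by case: (hM i).
have MB i : M i <= B by rewrite /B (bigD1 i) //= lerDl sumr_ge0.
have B0 : 0 <= B by exact: sumr_ge0.
have hB1 k z : `|partial k f z| <= B.
  by apply: le_trans (MB k); case: (hM k).
have hB2 k z w : `|partial k f z - partial k f w| <= B * `|z - w|.
  have [_ _ h] := hM k; apply: le_trans (h z w) _.
  by rewrite ler_wpM2r.
have dB : d%:R * B <= d.+1%:R * B by rewrite ler_wpM2r // ler_nat.
exists (d.+1%:R * B); first by rewrite mulr_ge0.
split.
- by move=> k z; apply: le_trans (hB1 k z) _; rewrite ler_peMl // ler1n.
- move=> z w; apply: le_trans (taylor_partial B0 df hB2 z w) _.
  by rewrite ler_wpM2r // exprn_ge0.
move=> z w z' w'; apply: le_trans (four_point_partial B0 df hB1 hB2 _ _ _ _) _.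
rewrite -[B * _ * _]mulrA -mulrDr mulrA ler_wpM2r // addr_ge0 // mulr_ge0 // addr_ge0.
Qed.

Lemma partial_coord (i k : 'I_d) :
  partial k (fun w : 'rV[R]_d => w 0 i) = fun=> (i == k)%:R.
Proof.
apply/funext => z; rewrite /partial.
have D : derivable (@id 'rV[R]_d) z (delta_mx 0 k) by exact: derivable_id.
have := derive_mx D.
by rewrite derive_id => /matrixP/(_ 0 i); rewrite !mxE eqxx /= => <-.
Qed.

End BoundedDerivatives.

(** * Iterated vector fields and the chain rule *)

Section VectorFields.
Context {R : realType} {d m : nat}.
Variables (N : nat) (V : 'rV[R]_d -> 'M[R]_(d, m)).
Hypothesis hV : forall i j, Cb N.+1 (fun z => V z i j).

Definition coord (i : 'I_d) : 'rV[R]_d -> R := fun z => z 0 i.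

Lemma calV_coord i j : calV V j (coord i) = fun z => V z i j.
Proof.
apply/funext => z; rewrite /calV (bigD1 i) //= /coord partial_coord eqxx mulr1.
rewrite big1 ?addr0 // => k ki.
by rewrite partial_coord eq_sym (negbTE ki) mulr0.
Qed.

(** The first field applied to a coordinate gives an entry of [V]; every further
    letter costs one derivative. *)
Lemma Cb_calVs i w : (0 < size w <= N.+2)%N ->
  Cb (N.+2 - size w) (calVs V w (coord i)).
Proof.
elim: w => // j [|l w] IH /andP[_ wN].
  by rewrite /calVs /= calV_coord; exact: hV.
have wN' : (size (l :: w) < N.+2)%N by [].
have := IH (ltnW wN'); rewrite -(subnSK wN') => hw.
rewrite /calVs /= -/(calVs V (l :: w) (coord i)) /calV.
apply: Cb_sum => k; apply: CbM.
  by apply: Cb_le (hV k j); rewrite leq_subLR addSn ltnS leq_addl.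
exact: Cb_partial hw k.
Qed.

(** What remains true for the longest words of the remainder, whose fields have
    one derivative only. *)
Definition word_bounds (L : R) i (w : seq 'I_m) :=
  (forall z, `|calVs V w (coord i) z| <= L) /\
  (forall z z', `|calVs V w (coord i) z - calVs V w (coord i) z'| <= L * `|z - z'|).

(** For the words of the scheme: the Taylor estimate is for the chain rule, the
    four-point estimate for the difference of the solution and the scheme. *)
Definition word_bounds2 (L : R) i (w : seq 'I_m) :=
  let f := calVs V w (coord i) in
  [/\ forall k z, `|partial k f z| <= L,
      forall z z', `|f z - f z' - \sum_k partial k f z' * (z 0 k - z' 0 k)| <=
        L * `|z - z'| ^+ 2 &
      forall z w z' w', `|(f z' - f w') - (f z - f w)| <=
        L * (`|(z' - w') - (z - w)| + (`|z' - z| + `|w' - w|) * `|z - w|)].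

Lemma word_bounds_le L L' i w : L <= L' -> word_bounds L i w -> word_bounds L' i w.
Proof.
move=> LL [h1 h2]; split => [z|z z'].
  exact: le_trans (h1 z) LL.
by apply: le_trans (h2 z z') _; rewrite ler_wpM2r.
Qed.

Lemma word_bounds2_le L L' i w : L <= L' -> word_bounds2 L i w -> word_bounds2 L' i w.
Proof.
move=> LL [h1 h2 h3]; split => [k z|z z'|z u z' u'].
- exact: le_trans (h1 k z) LL.
- by apply: le_trans (h2 z z') _; rewrite ler_wpM2r // exprn_ge0.
- by apply: le_trans (h3 z u z' u') _; rewrite ler_wpM2r // addr_ge0 // mulr_ge0 // addr_ge0.
Qed.

Lemma finite_common_bound (I : finType) (P : I -> R -> Prop) :
  (forall i L L', L <= L' -> P i L -> P i L') ->
  (forall i, exists2 L, 0 <= L & P i L) ->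
  exists2 L, 1 <= L & forall i, P i L.
Proof.
move=> mono h; have /choice[L hL] : forall i, exists L, 0 <= L /\ P i L.
  by move=> i; have [L L0 hL] := h i; exists L.
have L0 i : 0 <= L i by case: (hL i).
exists (1 + \sum_i L i); first by rewrite lerDl sumr_ge0.
move=> i; apply: mono (proj2 (hL i)); rewrite (bigD1 i) //= addrCA lerDl addr_ge0 //.
exact: sumr_ge0.
Qed.

(** There are finitely many words, encoded here as tuples of bounded length. *)
Lemma vector_field_bounds : exists2 L, 1 <= L & forall i w, (0 < size w)%N ->
  ((size w <= N.+1)%N -> word_bounds L i w) /\
  ((size w <= N)%N -> word_bounds2 L i w).
Proof.
pose W := {n : 'I_N.+2 & (val n).-tuple 'I_m}.
pose P (p : 'I_d * W) L := (0 < size (tagged p.2))%N ->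
  word_bounds L p.1 (tagged p.2) /\
  ((size (tagged p.2) <= N)%N -> word_bounds2 L p.1 (tagged p.2)).
have [||L L1 hL] := @finite_common_bound _ P.
- move=> p L L' LL hp h0; have [h1 h2] := hp h0; split.
    exact: word_bounds_le h1.
  by move=> /h2; exact: word_bounds2_le.
- move=> [i [n w]]; rewrite /P /=.
  have [w0|w0] := posnP (size w); first by exists 0 => //; rewrite w0.
  have wN : (size w <= N.+1)%N by rewrite size_tuple -ltnS ltn_ord.
  have hw : Cb (N.+2 - size w) (calVs V w (coord i)).
    by apply: Cb_calVs; rewrite w0 leqW.
  have hw1 : Cb 1 (calVs V w (coord i)) by apply: Cb_le hw; rewrite subn_gt0 ltnS.
  have [M M0 hM] := Cb_bounded hw1; have [L L0 hL] := Cb_lipschitz hw1.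
  have b1 : word_bounds (M + L) i w.
    split => [z|z z']; first by apply: le_trans (hM z) _; rewrite lerDl.
    by apply: le_trans (hL z z') _; rewrite ler_wpM2r // lerDr.
  have [wN1|wN1] := leqP (size w) N; last first.
    exists (M + L); first exact: addr_ge0.
    by split => // H; move: wN1; rewrite ltnNge H.
  have [|L2 L20 b2] := @Cb_second_order R d (calVs V w (coord i)).
    by apply: Cb_le hw; rewrite ltn_subRL addn1 ltnS.
  exists (M + L + L2); first by rewrite !addr_ge0.
  split; first by apply: word_bounds_le b1; rewrite lerDl.
  by move=> _; apply: (@word_bounds2_le L2) => //; rewrite lerDr addr_ge0.
exists L => // i w w0; split => wN.
  have wN2 : (size w < N.+2)%N by [].
  by have := hL (i, Tagged (fun n : 'I_N.+2 => (val n).-tuple 'I_m)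
    (in_tuple w : (val (Ordinal wN2)).-tuple 'I_m)) w0; case.
have wN2 : (size w < N.+2)%N by rewrite ltnS leqW.
have := hL (i, Tagged (fun n : 'I_N.+2 => (val n).-tuple 'I_m)
    (in_tuple w : (val (Ordinal wN2)).-tuple 'I_m)) w0; case => _; exact.
Qed.

End VectorFields.

Section ChainRule.
Context {R : realType} {d m : nat}.
Variables (V : 'rV[R]_d -> 'M[R]_(d, m)) (x : R -> 'rV[R]_m) (y : R -> 'rV[R]_d).
Variables (s t beta K X H C : R).
Hypotheses (st : s <= t) (b1 : 1 < beta + beta) (X0 : 0 <= X) (H0 : 0 <= H) (C0 : 0 <= C).
Hypothesis hK : sewing_constant (beta + beta) K.
Hypothesis hx : forall j, holder_on s t beta X (fun v => x v 0 j).
Hypothesis hy : forall u v, s <= u -> u <= v -> v <= t ->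
  `|y v - y u| <= H * (v - u) `^ beta.
Hypothesis hyl : forall k u v, s <= u -> u <= v -> v <= t ->
  `|y v 0 k - y u 0 k - \sum_j V (y u) k j * (x v 0 j - x u 0 j)| <=
    C * (v - u) `^ (beta + beta).

(** The increment of [f (y u)] and that of the sum of the integrals have the
    same germ up to order [beta + beta > 1]: the first by Taylor's formula and
    the germ of [y], the second by the estimate of Young. *)
Lemma young_chain_rule (f : 'rV[R]_d -> R) (L Lg : R) : 0 <= L -> 0 <= Lg ->
  (forall k z, `|partial k f z| <= L) ->
  (forall z z', `|f z - f z' - \sum_k partial k f z' * (z 0 k - z' 0 k)| <=
        L * `|z - z'| ^+ 2) ->
  (forall j z z', `|calV V j f z - calV V j f z'| <= Lg * `|z - z'|) ->
  forall u, s <= u -> u <= t ->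
  f (y u) = f (y s) +
    \sum_j RS_integral (fun r => calV V j f (y r)) (fun v => x v 0 j) s u.
Proof.
move=> L0 Lg0 hL hT hg u su ut.
have bt0 : 0 < beta by move: b1; lra.
have hG j : holder_on s t beta (Lg * H) (fun r => calV V j f (y r)).
  move=> p q sp pq qt; apply: le_trans (hg _ _ _) _.
  by rewrite -mulrA ler_wpM2l // hy.
have LH0 : 0 <= Lg * H by exact: mulr_ge0.
have prim j := RS_integral_local_primitive bt0 bt0 b1 hK LH0 X0 (hG j) (hx j).
have base j := RS_integral_base bt0 bt0 b1 hK LH0 X0 (hG j) (hx j) st.
pose I j v := RS_integral (fun r => calV V j f (y r)) (fun v => x v 0 j) s v.
(* The increments of [h] are of order [beta + beta], hence [h] is constant. *)
pose h v := f (y v) - \sum_j I j v.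
have /choice[D hD] : forall j, exists D, 0 <= D /\ forall p q, s <= p -> p <= q -> q <= t ->
    `|I j q - I j p - calV V j f (y p) * (x q 0 j - x p 0 j)| <= D * (q - p) `^ (beta + beta).
  by move=> j; have [D D0 hD] := prim j; exists D.
have loc : local_primitive s u (beta + beta) (fun=> 0) (fun=> 0) h.
  exists (L * H ^+ 2 + d%:R * (L * C) + \sum_j D j).
    rewrite !addr_ge0 ?mulr_ge0 ?exprn_ge0 //.
    by apply: sumr_ge0 => j _; case: (hD j).
  move=> p q sp pq qu; have qt := le_trans qu ut.
  rewrite mul0r subr0.
  pose P := \sum_k partial k f (y p) * (y q 0 k - y p 0 k).
  have -> : h q - h p = (f (y q) - f (y p) - P) +
     \sum_k partial k f (y p) * (y q 0 k - y p 0 k -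
         \sum_j V (y p) k j * (x q 0 j - x p 0 j))
     - \sum_j (I j q - I j p - calV V j f (y p) * (x q 0 j - x p 0 j)).
    have -> : \sum_k partial k f (y p) * (y q 0 k - y p 0 k -
         \sum_j V (y p) k j * (x q 0 j - x p 0 j)) =
      P - \sum_j calV V j f (y p) * (x q 0 j - x p 0 j).
      have -> : \sum_j calV V j f (y p) * (x q 0 j - x p 0 j) =
        \sum_k partial k f (y p) * (\sum_j V (y p) k j * (x q 0 j - x p 0 j)).
        under [RHS]eq_bigr do rewrite mulr_sumr.
        rewrite exchange_big /=; apply: eq_bigr => j _.
        rewrite /calV mulr_suml; apply: eq_bigr => k _; ring.
      by rewrite -sumrB; apply: eq_bigr => k _; ring.
    rewrite /h !sumrB; ring.
  set W := (q - p) `^ (beta + beta).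
  have T1 : `|f (y q) - f (y p) - P| <= L * H ^+ 2 * W.
    apply: le_trans (hT _ _) _; rewrite -mulrA ler_wpM2l // /W powRD_pos //.
    rewrite -expr2 -exprMn ler_pXn2r // ?nnegrE ?mulr_ge0 ?powR_ge0 //.
    exact: hy.
  apply: le_trans (ler_normB _ _) _; rewrite [leRHS]mulrDl; apply: lerD; last first.
    apply: le_trans (ler_norm_sum _ _ _) _; rewrite mulr_suml.
    by apply: ler_sum => j _; case: (hD j) => _; apply.
  apply: le_trans (ler_normD _ _) _; rewrite [leRHS]mulrDl; apply: lerD => //.
  apply: le_trans (ler_norm_sum _ _ _) _.
  rewrite -[leRHS]mulrA mulr_natl -[X in _ *+ X]card_ord -sumr_const.
  apply: ler_sum => k _; rewrite normrM -mulrA ler_pM //; exact: hyl.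
have loc0 : local_primitive s u (beta + beta) (fun=> 0) (fun=> 0) (fun=> 0).
  by exists 0 => // p q _ _ _; rewrite !subrr mulr0 subr0 normr0 mul0r.
have := local_primitive_unique su b1 loc loc0.
rewrite subrr /h (eq_bigr (fun=> 0) (r := index_enum _) (P := predT)
  (F1 := fun j => I j s)); last by move=> j _; exact: base.
rewrite big1_eq subr0 => /eqP; rewrite subr_eq0 => /eqP <-.
by rewrite subrK.
Qed.

End ChainRule.

(** * The expansion of the solution *)

Section TaylorExpansion.
Context {R : realType} {d m : nat}.
Variables (V : 'rV[R]_d -> 'M[R]_(d, m)) (x : R -> 'rV[R]_m) (y : R -> 'rV[R]_d).
Variables (s t beta K X : R) (N : nat) (Gs : seq (seq 'I_m)).
Hypotheses (st : s <= t) (b1 : 1 < beta + beta) (X0 : 0 <= X).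
Hypothesis hK : sewing_constant (beta + beta) K.
Hypothesis hx : forall j, holder_on s t beta X (fun v => x v 0 j).
Hypothesis Gs_uniq : uniq Gs.
Hypothesis Gs_size : forall w, w \in Gs -> (0 < size w <= N)%N.
Hypothesis Gs_closed : forall j w, (0 < size w)%N -> j :: w \in Gs -> w \in Gs.

(** The words produced by one application of the chain rule: those of [Gs], and
    those that index the remainder. *)
Definition one_letter_more : seq (seq 'I_m) :=
  [seq j :: w | w <- [::] :: Gs, j <- index_enum 'I_m].

Lemma mem_one_letter_more w : w \in one_letter_more -> w \notin Gs ->
  (0 < size w <= N.+1)%N.
Proof.
case/allpairsP => -[u j] /= [uG _ ->] _ /=; rewrite ltnS.
by move: uG; rewrite inE => /orP[/eqP-> //|/Gs_size/andP[]].
Qed.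

(** Apply the chain rule once below every word of [Gs] and below the empty one,
    and add up.  Since [Gs] is closed under removal of the first letter, the
    integrals along the words of [Gs] occur once on either side and cancel. *)
Lemma taylor_expansion (F : seq 'I_m -> 'rV[R]_d -> R) :
  (forall w, (size w <= N.+1)%N -> regular s t beta (fun u => F w (y u))) ->
  (forall w, (size w <= N)%N -> forall u, s <= u -> u <= t ->
    F w (y u) = F w (y s) +
      \sum_j RS_integral (fun r => F (j :: w) (y r)) (fun v => x v 0 j) s u) ->
  F [::] (y t) - F [::] (y s) -
    \sum_(w <- Gs) iter_int x w (fun=> 1) s t * F w (y s) =
  \sum_(w <- one_letter_more | w \notin Gs) iter_int x w (fun u => F w (y u)) s t.
Proof.
move=> hreg hchain.
pose J w := iter_int x w (fun u => F w (y u)) s t.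
have expand w : (size w <= N)%N ->
    J w = F w (y s) * iter_int x w (fun=> 1) s t + \sum_j J (j :: w).
  move=> wN; rewrite /J (@iter_int_sum _ _ x s t beta X K st b1 X0 hK hx w
    (F w (y s)) _ _ (index_enum 'I_m)
    (fun j u => RS_integral (fun r => F (j :: w) (y r)) (fun v => x v 0 j) s u)) //.
    by move=> j; apply: (regular_RS st b1 X0 hK hx); exact: hreg.
  exact: hchain.
have sum0 : \sum_(w <- [::] :: Gs) J w =
    \sum_(w <- [::] :: Gs) F w (y s) * iter_int x w (fun=> 1) s t +
    \sum_(w <- one_letter_more) J w.
  rewrite /one_letter_more big_allpairs_dep -big_split /= [LHS]big_seq [RHS]big_seq; apply: eq_bigr => w.
  by rewrite inE => /orP[/eqP->|/Gs_size/andP[_ wN]]; exact: expand.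
have split1 : \sum_(w <- one_letter_more | w \in Gs) J w = \sum_(w <- Gs) J w.
  rewrite -big_filter; apply: perm_big; apply: uniq_perm => //.
    apply: filter_uniq; apply: allpairs_uniq.
    - rewrite /= Gs_uniq andbT; apply/negP => /Gs_size.
      by [].
    - exact: index_enum_uniq.
    - by move=> [u j] [u' j'] /= _ _ [-> ->].
  move=> w; rewrite mem_filter; apply: andb_idr => wG.
  have := Gs_size wG; case: w wG => // j w wG _.
  apply/allpairsP; exists (w, j); split => //=; last exact: mem_index_enum.
  rewrite inE; case: (posnP (size w)) => [/eqP|w0].
    by rewrite size_eq0 => ->.
  by rewrite (Gs_closed w0 wG) orbT.
move: sum0; rewrite !big_cons [X in _ = _ + X](bigID (mem Gs)) /= split1 /J /= mulr1.
set A := \sum_(w <- Gs) iter_int x w _ s t.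
set B := \sum_(w <- Gs) F w (y s) * _.
have -> : \sum_(w <- Gs) iter_int x w (fun=> 1) s t * F w (y s) = B.
  by apply: eq_bigr => w _; rewrite mulrC.
lra.
Qed.

End TaylorExpansion.

Section ContractionPrinciple.
Context {R : realType}.

(** A supremum that is known to be finite absorbs its own half. *)
Lemma ubound_contraction (A : set R) (a : R) :
  (forall r, A r -> 0 <= r) -> has_ubound A ->
  (forall B, 0 <= B -> ubound A B -> ubound A (a + B / 2)) -> ubound A (2 * a).
Proof.
move=> A0 Aub h r Ar.
have Asup : has_sup A by split => //; exists r.
have sup_ub : ubound A (sup A) by exact: sup_upper_bound.
have s0 : 0 <= sup A by apply: le_trans (A0 _ Ar) (sup_ub _ Ar).
have : sup A <= a + sup A / 2.
  by apply: ge_sup; [exists r|exact: h].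
have := sup_ub _ Ar; lra.
Qed.

End ContractionPrinciple.

(** * Hölder regularity of the solution *)

Section SolutionRegularity.
Context {R : realType} {d m : nat}.
Variables (T beta X L K : R) (V : 'rV[R]_d -> 'M[R]_(d, m)).
Variables (x : R -> 'rV[R]_m) (y : R -> 'rV[R]_d) (y0 : 'rV[R]_d) (lam A : R).
Hypotheses (b1 : 1 < beta + beta) (X0 : 0 <= X) (L0 : 0 <= L).
Hypothesis hK : sewing_constant (beta + beta) K.
Hypothesis hx : forall j, holder_on 0 T beta X (fun v => x v 0 j).
Hypothesis hVb : forall i j z, `|V z i j| <= L.
Hypothesis hVl : forall i j z z', `|V z i j - V z' i j| <= L * `|z - z'|.
Hypotheses (lam0 : 0 < lam) (lam1 : 1 < lam + beta) (A0 : 0 <= A).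
Hypothesis hyA : forall u v, 0 <= u -> u <= v -> v <= T ->
  `|y v - y u| <= A * (v - u) `^ lam.
Hypothesis hy : forall t, 0 <= t <= T ->
  y t = y0 + \row_i \sum_j RS_integral (fun u => V (y u) i j) (fun u => x u 0 j) 0 t.

Let bt0 : 0 < beta. Proof. by move: b1; lra. Qed.

Lemma solution_increment k u v : 0 <= u -> u <= v -> v <= T ->
  y v 0 k - y u 0 k =
  \sum_j RS_integral (fun r => V (y r) k j) (fun r => x r 0 j) u v.
Proof.
move=> u0 uv vT; have v0 := le_trans u0 uv; have uT := le_trans uv vT.
rewrite (hy (introT andP (conj v0 vT))) (hy (introT andP (conj u0 uT))) !mxE.
rewrite opprD addrACA subrr add0r -sumrB; apply: eq_bigr => j _.
have [K' hK'] := sewing_constant_exists lam1.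
have hG : holder_on 0 T lam (L * A) (fun r => V (y r) k j).
  move=> p q p0 pq qT; apply: le_trans (hVl _ _ _ _) _.
  by rewrite -mulrA ler_wpM2l // hyA.
by rewrite -(RS_integralB lam0 bt0 lam1 hK' (mulr_ge0 L0 A0) X0 hG (hx j)).
Qed.

Lemma solution_germ_bound al B K' u v k : 0 < al -> 1 < al + beta ->
  sewing_constant (al + beta) K' -> 0 <= B -> 0 <= u -> u <= v -> v <= T ->
  (forall p q, u <= p -> p <= q -> q <= v -> `|y q - y p| <= B * (q - p) `^ al) ->
  `|y v 0 k - y u 0 k - \sum_j V (y u) k j * (x v 0 j - x u 0 j)| <=
    m%:R * (K' * (L * B * X)) * (v - u) `^ (al + beta).
Proof.
move=> al0 al1 hK' B0 u0 uv vT hB.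
rewrite solution_increment // -sumrB.
apply: le_trans (ler_norm_sum _ _ _) _.
rewrite -mulrA mulr_natl -[X in _ *+ X]card_ord -sumr_const; apply: ler_sum => j _.
apply: (@young_bound _ u v al beta (L * B) X) => //; first exact: mulr_ge0.
  move=> p q up pq qv; apply: le_trans (hVl _ _ _ _) _.
  by rewrite -mulrA ler_wpM2l // hB.
exact: holder_on_sub (hx j).
Qed.

Lemma solution_first_order u v k : 0 <= u -> u <= v -> v <= T ->
  `|\sum_j V (y u) k j * (x v 0 j - x u 0 j)| <= m%:R * (L * X) * (v - u) `^ beta.
Proof.
move=> u0 uv vT; apply: le_trans (ler_norm_sum _ _ _) _.
rewrite -mulrA mulr_natl -[X in _ *+ X]card_ord -sumr_const; apply: ler_sum => j _.
by rewrite normrM -mulrA ler_pM // hx.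
Qed.

(** A bound on the Hölder constant of [y] for some exponent returns one for the
    exponent of the driver: used once with the given exponent of [y], for
    finiteness, and once with [beta], for the contraction. *)
Lemma solution_increment_bound al B K' u v : 0 < al -> 1 < al + beta ->
  sewing_constant (al + beta) K' -> 0 <= B -> 0 <= u -> u <= v -> v <= T ->
  (forall p q, u <= p -> p <= q -> q <= v -> `|y q - y p| <= B * (q - p) `^ al) ->
  `|y v - y u| <=
    (m%:R * (L * X) + m%:R * (K' * (L * B * X)) * (v - u) `^ al) * (v - u) `^ beta.
Proof.
move=> al0 al1 hK' B0 u0 uv vT hB.
have K'0 : 0 <= K' by case: hK'.
have c0 : 0 <= m%:R * (K' * (L * B * X)) by rewrite !mulr_ge0.
apply: norm_le_coord => [|k].
  by rewrite mulr_ge0 ?addr_ge0 ?mulr_ge0 ?powR_ge0.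
rewrite !mxE -(subrK (\sum_j V (y u) k j * (x v 0 j - x u 0 j)) (y v 0 k - y u 0 k)).
apply: le_trans (ler_normD _ _) _; rewrite [leRHS]mulrDl addrC; apply: lerD.
  exact: solution_first_order.
rewrite -[leRHS]mulrA -powRD_pos //.
exact: solution_germ_bound.
Qed.

Section Window.
Variable h : R.
Hypothesis small : m%:R * (K * (L * X)) * h `^ beta <= 2^-1.

(** On short intervals the Hölder constant [B] of [y] is bounded by a constant
    plus [B / 2]. *)
Lemma solution_holder u v : 0 <= u -> u <= v -> v <= T -> v - u <= h ->
  `|y v - y u| <= 2 * (m%:R * (L * X)) * (v - u) `^ beta.
Proof.
have K0 : 0 <= K by case: hK.
pose Q := [set r : R | exists u v, [/\ 0 <= u, u < v, v <= T, v - u <= h &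
  r = `|y v - y u| / (v - u) `^ beta]].
have Qub : ubound Q (2 * (m%:R * (L * X))).
  apply: ubound_contraction.
  - by move=> r [p [q [_ _ _ _ ->]]]; rewrite divr_ge0 ?powR_ge0.
  - have [K' hK'] := sewing_constant_exists lam1.
    have K'0 : 0 <= K' by case: hK'.
    exists (m%:R * (L * X) + m%:R * (K' * (L * A * X)) * T `^ lam).
    move=> r [p [q [p0 pq qT _ ->]]]; rewrite ler_pdivrMr ?powR_gt0 ?subr_gt0 //.
    have hpq : forall p' q', p <= p' -> p' <= q' -> q' <= q ->
       `|y q' - y p'| <= A * (q' - p') `^ lam.
      move=> p' q' pp pq' qq; apply: hyA => //; first exact: le_trans pp.
      exact: le_trans qT.
    apply: le_trans (solution_increment_bound lam0 lam1 hK' A0 p0 (ltW pq) qT hpq) _.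
    rewrite ler_wpM2r ?powR_ge0 // lerD2l ler_wpM2l ?mulr_ge0 //.
    rewrite le_powR ?(ltW lam0) ?subr_ge0 ?(ltW pq) //.
    by apply: le_trans qT; rewrite gerBl.
  - move=> B B0 hB r [p [q [p0 pq qT qph ->]]].
    rewrite ler_pdivrMr ?powR_gt0 ?subr_gt0 //.
    have hpq : forall p' q', p <= p' -> p' <= q' -> q' <= q ->
       `|y q' - y p'| <= B * (q' - p') `^ beta.
      move=> p' q' pp; rewrite le_eqVlt => /predU1P[->|pq'] qq.
        by rewrite !subrr normr0 mulr_ge0 ?powR_ge0.
      rewrite -ler_pdivrMr ?powR_gt0 ?subr_gt0 //; apply: hB.
      exists p', q'; split => //; first exact: le_trans pp.
        exact: le_trans qT.
      by apply: le_trans qph; move: pp qq; lra.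
    apply: le_trans (solution_increment_bound bt0 b1 hK B0 p0 (ltW pq) qT hpq) _.
    rewrite ler_wpM2r ?powR_ge0 // lerD2l.
    have -> : m%:R * (K * (L * B * X)) = m%:R * (K * (L * X)) * B by ring.
    rewrite mulrAC [leRHS]mulrC ler_wpM2r //; apply: le_trans small.
    rewrite ler_wpM2l ?mulr_ge0 // le_powR ?(ltW bt0) ?subr_ge0 ?(ltW pq) //.
move=> u0; rewrite le_eqVlt => /predU1P[->|uv] vT vuh.
  by rewrite !subrr normr0 !mulr_ge0 ?powR_ge0.
rewrite -ler_pdivrMr ?powR_gt0 ?subr_gt0 //; apply: Qub.
by exists u, v; split.
Qed.

(** Reach [t] in [k] windows of length [h]. *)
Lemma solution_displacement (k : nat) t : 0 <= t -> t <= T -> t <= k%:R * h -> 0 < h ->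
  `|y t - y 0| <= k%:R * (2 * (m%:R * (L * X)) * h `^ beta).
Proof.
move=> + + + h0; elim: k t => [|k IH] t t0 tT.
  rewrite mul0r => t0'; have -> : t = 0 by apply/eqP; rewrite eq_le t0 t0'.
  by rewrite subrr normr0 mul0r.
move=> tk; have c0 : 0 <= 2 * (m%:R * (L * X)) by rewrite !mulr_ge0.
have [th|th] := leP t (k%:R * h).
  apply: le_trans (IH _ t0 tT th) _.
  by rewrite ler_wpM2r ?ler_nat // mulr_ge0 ?powR_ge0.
have kh0 : 0 <= k%:R * h by rewrite mulr_ge0 // ltW.
have E : y t - y 0 = (y t - y (k%:R * h)) + (y (k%:R * h) - y 0).
  by rewrite addrA subrK.
rewrite E; apply: le_trans (ler_normD _ _) _.
rewrite -natr1 mulrDl mul1r addrC; apply: lerD.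
  by apply: IH => //; apply: le_trans tT; exact: ltW.
have tkh : t - k%:R * h <= h by move: tk; rewrite -natr1 mulrDl mul1r; lra.
apply: le_trans (solution_holder kh0 (ltW th) tT tkh) _.
by rewrite ler_wpM2l // le_powR ?(ltW bt0) ?subr_ge0 ?(ltW th).
Qed.

End Window.

End SolutionRegularity.

(** * The error of one step *)

Section LocalError.
Context {R : realType} {d m : nat}.
Variables (T beta X S L K lam A theta : R) (V : 'rV[R]_d -> 'M[R]_(d, m)).
Variables (x : R -> 'rV[R]_m) (y : R -> 'rV[R]_d) (y0 : 'rV[R]_d) (b : 'I_m -> R).
Variables (N : nat) (Gs : seq (seq 'I_m)).
Hypotheses (T0 : 0 < T) (b1 : 1 < beta + beta) (X0 : 0 <= X) (S0 : 0 <= S) (L1 : 1 <= L).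
Hypothesis hK : sewing_constant (beta + beta) K.
Hypothesis hb : forall j, beta <= b j.
Hypothesis hx : forall j, holder_on 0 T beta X (fun v => x v 0 j).
Hypothesis hxS : forall j, holder_on 0 T (b j) S (fun v => x v 0 j).
Hypothesis hV : forall i w, (0 < size w)%N ->
  ((size w <= N.+1)%N -> word_bounds V L i w) /\
  ((size w <= N)%N -> word_bounds2 V L i w).
Hypotheses (lam0 : 0 < lam) (lam1 : 1 < lam + beta) (A0 : 0 <= A).
Hypothesis hyA : forall u v, 0 <= u -> u <= v -> v <= T ->
  `|y v - y u| <= A * (v - u) `^ lam.
Hypothesis hy : forall t, 0 <= t <= T ->
  y t = y0 + \row_i \sum_j RS_integral (fun u => V (y u) i j) (fun u => x u 0 j) 0 t.
Hypothesis Gs_uniq : uniq Gs.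
Hypothesis Gs_size : forall w, w \in Gs -> (0 < size w <= N)%N.
Hypothesis Gs_closed : forall j w, (0 < size w)%N -> j :: w \in Gs -> w \in Gs.
Hypothesis Gs_order : forall w, (0 < size w)%N -> w \notin Gs ->
  1 + theta <= \sum_(j <- w) b j.

Let bt0 : 0 < beta. Proof. by move: b1; lra. Qed.
Let L0 : 0 <= L. Proof. by apply: le_trans L1. Qed.
Let K0 : 0 <= K. Proof. by case: hK. Qed.

Lemma field_bounded i j z : `|V z i j| <= L.
Proof.
have [/(_ isT)[h _] _] := hV i (isT : 0 < size [:: j])%N.
by have := h z; rewrite /calVs /= calV_coord.
Qed.

Lemma field_lipschitz i j z z' : `|V z i j - V z' i j| <= L * `|z - z'|.
Proof.
have [/(_ isT)[_ h] _] := hV i (isT : 0 < size [:: j])%N.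
by have := h z z'; rewrite /calVs /= calV_coord.
Qed.

Section Window.
Variables (h s t : R).
Hypothesis small : m%:R * (K * (L * X)) * h `^ beta <= 2^-1.
Hypotheses (s0 : 0 <= s) (st : s <= t) (tT : t <= T) (sth : t - s <= h).

Let H := 2 * (m%:R * (L * X)).

Let H0 : 0 <= H. Proof. by rewrite !mulr_ge0. Qed.

Let hyH u v : s <= u -> u <= v -> v <= t -> `|y v - y u| <= H * (v - u) `^ beta.
Proof.
move=> su uv vt.
apply: (solution_holder b1 X0 L0 hK hx field_bounded field_lipschitz lam0 lam1 A0
  hyA hy small) => //.
- exact: le_trans su.
- exact: le_trans tT.
- by move: sth su vt; lra.
Qed.

Let hxs j : holder_on s t beta X (fun v => x v 0 j).
Proof. exact: holder_on_sub (hx j). Qed.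

Lemma local_taylor_identity i :
  y t 0 i - y s 0 i -
    \sum_(w <- Gs) iter_int x w (fun=> 1) s t * calVs V w (coord i) (y s) =
  \sum_(w <- one_letter_more Gs | w \notin Gs)
     iter_int x w (fun u => calVs V w (coord i) (y u)) s t.
Proof.
apply: (taylor_expansion st b1 X0 hK hxs Gs_uniq Gs_size Gs_closed
  (F := fun w => calVs V w (coord i))).
  move=> w wN; have [w0|w0] := posnP (size w).
    rewrite (size0nil w0); exists H => u v su uv vt.
    rewrite /= /coord; apply: le_trans (hyH su uv vt).
    by have := coord_le_norm (y v - y u) i; rewrite !mxE.
  have [/(_ wN)[_ hl] _] := hV i w0.
  exists (L * H) => u v su uv vt; apply: le_trans (hl _ _) _.
  by rewrite -mulrA ler_wpM2l // hyH.
move=> w wN u su ut; have [w0|w0] := posnP (size w).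
  rewrite (size0nil w0) /= /coord.
  have uT := le_trans ut tT.
  have := solution_increment b1 X0 L0 hx field_lipschitz lam0 lam1 A0 hyA hy i s0 su uT.
  move/eqP; rewrite subr_eq addrC => /eqP ->; congr (_ + _).
  by apply: eq_bigr => j _; rewrite -/(coord i) calV_coord.
have [_ /(_ wN)[hp ht _]] := hV i w0.
have C0 : 0 <= m%:R * (K * (L * H * X)) by rewrite !mulr_ge0.
apply: (@young_chain_rule _ _ _ V x y s t beta K X H (m%:R * (K * (L * H * X)))
  st b1 X0 H0 C0 hK hxs hyH _ (calVs V w (coord i)) L L) => //.
- move=> k p q sp pq qt.
  apply: (solution_germ_bound b1 X0 L0 hx field_lipschitz lam0 lam1 A0
    hyA hy k bt0 b1 hK H0) => //.
  + exact: le_trans sp.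
  + exact: le_trans tT.
  + move=> p' q' pp pq' qq; apply: hyH => //; [exact: le_trans pp|exact: le_trans qt].
- move=> j z z'; have [/(_ wN)[_ hl] _] := hV i (isT : 0 < size (j :: w))%N.
  exact: hl.
Qed.

Definition taylor_constant := \sum_(w <- one_letter_more Gs) T `^ (\sum_(j <- w) b j).

Lemma taylor_constant_ge0 : 0 <= taylor_constant.
Proof. by apply: sumr_ge0 => w _; exact: powR_ge0. Qed.

(** The factor depending on the driver is kept as a power of
    [(1 + K) * (1 + S)], which the exponential absorbs in the end. *)
Lemma local_taylor_error i (n : nat) : (0 < n)%N -> t - s <= T / n%:R ->
  X * (t - s) `^ beta <= 1 ->
  `|y t 0 i - y s 0 i -
    \sum_(w <- Gs) iter_int x w (fun=> 1) s t * calVs V w (coord i) (y s)| <=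
  taylor_constant * ((1 + K) * (1 + S)) ^+ N.+1 * (L * (1 + 2 * (m%:R * L))) *
    n%:R `^ (- (1 + theta)).
Proof.
move=> n0 stn Xst; rewrite local_taylor_identity.
apply: le_trans (ler_norm_sum _ _ _) _.
rewrite /taylor_constant !mulr_suml big_mkcond /= !big_seq; apply: ler_sum => w wO.
set c := L * (1 + 2 * (m%:R * L)).
have c0 : 0 <= c by rewrite mulr_ge0 ?addr_ge0 ?mulr_ge0.
have Y1 : 1 <= (1 + K) * (1 + S).
  by apply: mulr_ege1; rewrite lerDl.
have Y0 : 0 <= (1 + K) * (1 + S) by exact: le_trans Y1.
case: ifPn => [wG|_]; last by do 3?[apply: mulr_ge0 => //]; rewrite ?powR_ge0 ?exprn_ge0.
have /andP[w0 wN] := mem_one_letter_more Gs_size wO wG.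
have [/(_ wN)[hb0 hl] _] := hV i w0.
have hF : holder_on s t beta (L * H) (fun u => calVs V w (coord i) (y u)).
  move=> u v su uv vt; apply: le_trans (hl _ _) _.
  by rewrite -mulrA ler_wpM2l // hyH.
have hxSs j : holder_on s t (b j) S (fun v => x v 0 j).
  exact: holder_on_sub (hxS j).
apply: le_trans (iter_int_bound w b1 hb hK S0 L0 (mulr_ge0 L0 H0) st hxSs hF _) _.
  by move=> u _ _; exact: hb0.
have e0 : 0 <= \sum_(j <- w) b j.
  by apply: sumr_ge0 => j _; apply: le_trans (ltW bt0) (hb j).
have P1 : ((1 + K) * S) ^+ size w <= ((1 + K) * (1 + S)) ^+ N.+1.
  apply: (@le_trans _ _ (((1 + K) * (1 + S)) ^+ size w)).
    rewrite ler_pXn2r // ?nnegrE ?mulr_ge0 ?addr_ge0 // ler_wpM2l ?addr_ge0 //.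
    by rewrite lerDr.
  exact: ler_weXn2l.
have P2 : L + L * H * (t - s) `^ beta <= c.
  rewrite /c mulrDr mulr1 lerD2l -mulrA ler_wpM2l // /H.
  have -> : 2 * (m%:R * (L * X)) * (t - s) `^ beta =
     2 * (m%:R * L) * (X * (t - s) `^ beta) by ring.
  by rewrite ler_piMr // !mulr_ge0.
have n1 : 1 <= n%:R :> R by rewrite ler1n.
have P3 : (t - s) `^ (\sum_(j <- w) b j) <=
    T `^ (\sum_(j <- w) b j) * n%:R `^ (- (1 + theta)).
  apply: (@le_trans _ _ ((T / n%:R) `^ (\sum_(j <- w) b j))).
    by rewrite le_powR ?subr_ge0.
  rewrite powRM ?invr_ge0 ?(ltW T0) // ler_wpM2l ?powR_ge0 //.
  rewrite -powR_inv1 // -powRrM mulN1r ler_powR // lerN2.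
  exact: Gs_order.
set Y := ((1 + K) * (1 + S)) ^+ N.+1 in P1 *.
set p := T `^ _ in P3 *.
rewrite (_ : p * Y * c * _ = Y * c * (p * n%:R `^ (- (1 + theta)))); last by ring.
have q0 : 0 <= ((1 + K) * S) ^+ size w by rewrite exprn_ge0 // mulr_ge0 // addr_ge0.
have r0 : 0 <= L + L * H * (t - s) `^ beta.
  by rewrite addr_ge0 // mulr_ge0 ?powR_ge0 // mulr_ge0.
by do 2?[apply: ler_pM => //]; rewrite ?powR_ge0 // mulr_ge0.
Qed.

End Window.
End LocalError.

(** * Young sums on a grid *)

Section DiscreteYoung.
Context {R : realType}.
Implicit Types (delta beta K X B H r : R).

(** The form of [ubound_contraction] for the pairs of points of a block, whose
    suprema are finite. *)
Lemma pair_contraction (f : nat -> nat -> R) a e (alpha : R) :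
  (forall i j, 0 <= f i j) ->
  (forall B, 0 <= B ->
    (forall i j, (a <= i)%N -> (i <= j)%N -> (j <= e)%N -> f i j <= B) ->
    forall i j, (a <= i)%N -> (i <= j)%N -> (j <= e)%N -> f i j <= alpha + B / 2) ->
  forall i j, (a <= i)%N -> (i <= j)%N -> (j <= e)%N -> f i j <= 2 * alpha.
Proof.
move=> f0 hf i j ai ij je.
pose Q := [set r : R | exists i j, [/\ (a <= i)%N, (i <= j)%N, (j <= e)%N & r = f i j]].
suff : ubound Q (2 * alpha) by apply; exists i, j.
apply: ubound_contraction.
- by move=> r [p [q [_ _ _ ->]]].
- exists (\sum_(p < e.+1) \sum_(q < e.+1) f p q) => r [p [q [ap pq qe ->]]].
  have pe : (p < e.+1)%N by rewrite ltnS (leq_trans pq).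
  rewrite (bigD1 (Ordinal pe)) //= (bigD1 (Ordinal (qe : (q < e.+1)%N))) //=.
  by rewrite -addrA lerDl addr_ge0 // sumr_ge0 // => k _; rewrite sumr_ge0.
- move=> B B0 hB r [p [q [ap pq qe ->]]]; apply: hf => // p' q' ap' pq' qe'.
  by apply: hB; exists p', q'.
Qed.

(** A sum of [k] terms of order [mu >= 1] in the mesh is of order [mu] in the
    total length. *)
Lemma natmul_powR_le delta mu (k : nat) : 0 <= delta -> 1 <= mu ->
  k%:R * delta `^ mu <= (k%:R * delta) `^ mu.
Proof.
move=> d0 mu1; rewrite powRM // ler_wpM2r ?powR_ge0 //.
case: k => [|k]; first by rewrite powR_ge0.
by rewrite le1r_powR // ler1n.
Qed.

(** A sum of [k] local errors, seen as an increment, is Hölder with a constant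
    proportional to the number [n] of all steps. *)
Lemma natmul_le_powR delta beta (k n : nat) : 0 < delta -> 0 < beta <= 1 ->
  (0 < n)%N -> (k <= n)%N ->
  k%:R <= n%:R / (n%:R * delta) `^ beta * (k%:R * delta) `^ beta.
Proof.
move=> d0 /andP[be0 be1] n0 kn.
have nd0 : 0 < n%:R * delta by rewrite mulr_gt0 // ltr0n.
case: k kn => [|k] kn.
  by rewrite !mulr_ge0 ?invr_ge0 ?powR_ge0.
have n0' : n%:R != 0 :> R by rewrite pnatr_eq0 -lt0n.
have -> : k.+1%:R * delta = (k.+1%:R / n%:R) * (n%:R * delta).
  by rewrite mulrA divfK.
rewrite (@powRM _ (k.+1%:R / n%:R)) ?divr_ge0 ?(ltW nd0) //.
set P := (n%:R * delta) `^ beta; set q := (k.+1%:R / n%:R) `^ beta.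
have P0 : P != 0 by rewrite gt_eqF ?powR_gt0.
have -> : n%:R / P * (q * P) = n%:R * q by field.
rewrite -ler_pdivrMl ?ltr0n // mulrC ger1_powR // divr_gt0 ?ltr0n //=.
by rewrite ler_pdivrMr ?ltr0n // mul1r ler_nat.
Qed.

Lemma sumr_const_list (I : Type) (G : seq I) (c : R) :
  \sum_(w <- G) c = (size G)%:R * c.
Proof. by rewrite big_const_seq count_predT iter_addr_0 mulr_natl. Qed.

Lemma discrete_young (I : eqType) (G : seq I) (g xi : I -> nat -> R)
    (u : nat -> R) delta beta K X B H r a e :
  0 <= delta -> 1 < beta + beta -> sewing_constant (beta + beta) K ->
  0 <= X -> 0 <= B -> 0 <= H ->
  (forall p, (a <= p)%N -> (p < e)%N ->
    `|u p.+1 - u p - \sum_(w <- G) g w p * (xi w p.+1 - xi w p)| <= r) ->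
  (forall w p, w \in G -> (a <= p)%N -> (p <= e)%N -> `|g w p| <= B) ->
  (forall w p q, w \in G -> (a <= p)%N -> (p <= q)%N -> (q <= e)%N ->
    `|g w q - g w p| <= H * ((q - p)%:R * delta) `^ beta) ->
  (forall w p q, w \in G -> (a <= p)%N -> (p <= q)%N -> (q <= e)%N ->
    `|xi w q - xi w p| <= X * ((q - p)%:R * delta) `^ beta) ->
  forall i j, (a <= i)%N -> (i <= j)%N -> (j <= e)%N ->
  `|u j - u i| <=
    (size G)%:R * (B * X * ((j - i)%:R * delta) `^ beta +
                   K * (H * X) * ((j - i)%:R * delta) `^ (beta + beta)) +
    (j - i)%:R * r.
Proof.
move=> d0 b1 hK X0 B0 H0 hu hg hgH hxi i j ai ij je.
have bt0 : 0 < beta by lra.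
have -> : u j - u i =
  \sum_(w <- G) \sum_(i <= p < j) g w p * (xi w p.+1 - xi w p) +
  \sum_(i <= p < j) (u p.+1 - u p - \sum_(w <- G) g w p * (xi w p.+1 - xi w p)).
  by rewrite sumrB exchange_big /= telescope_sumr // [RHS]addrC subrK.
apply: le_trans (ler_normD _ _) _; apply: lerD; last first.
  apply: le_trans (ler_norm_sum _ _ _) _.
  rewrite mulr_natl -sumr_const_nat !big_nat; apply: ler_sum => p /andP[ip pj].
  by apply: hu; [exact: leq_trans ip|exact: leq_trans je].
apply: le_trans (ler_norm_sum _ _ _) _.
rewrite -sumr_const_list !big_seq; apply: ler_sum => w wG.
pose tau p : R := p%:R * delta.
have tauB p q : (p <= q)%N -> tau q - tau p = (q - p)%:R * delta.
  by move=> pq; rewrite /tau -mulrBl natrB.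
have := @discrete_sewing R tau (fun p q => g w p * (xi w q - xi w p))
  (beta + beta) K (H * X) a e b1 hK (mulr_ge0 H0 X0) _ _ i j ai ij je.
rewrite /= (tauB _ _ ij) => sew.
set I1 := \sum_(_ <= _ < _) _ in sew *.
rewrite -(subrK (g w i * (xi w j - xi w i)) I1) addrC.
apply: le_trans (ler_normD _ _) _; apply: lerD.
  rewrite normrM -mulrA ler_pM //; first exact: hg (leq_trans ij je).
  exact: hxi.
apply: sew => [p q _ pq _|p q r' ap pq qr re].
  by rewrite -subr_ge0 tauB // mulr_ge0.
have pr := leq_trans pq qr.
rewrite tauB // [X in `|X|](_ : _ = - ((g w q - g w p) * (xi w r' - xi w q)));
  last by ring.
rewrite normrN normrM powRD_pos // mulrACA.
have mono p' q' : (p' <= q')%N -> (p'%:R * delta) `^ beta <= (q'%:R * delta) `^ beta.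
  move=> pq'; rewrite le_powR ?(ltW bt0) ?mulr_ge0 //.
  by rewrite ler_wpM2r // ler_nat.
apply: ler_pM => //.
  apply: le_trans (hgH _ _ _ wG ap pq (leq_trans qr re)) _.
  by rewrite ler_wpM2l // mono // leq_sub2r.
apply: le_trans (hxi _ _ _ wG (leq_trans ap pq) qr re) _.
by rewrite ler_wpM2l // mono // leq_sub2l.
Qed.

End DiscreteYoung.

(** * Stability of the scheme *)

Section DiscreteStability.
Context {R : realType} {d : nat} {W : eqType}.
Variables (n : nat) (delta beta K X L C h : R) (G : seq W) (one : pred W).
Variables (xi J : W -> nat -> R) (F : 'I_d -> W -> 'rV[R]_d -> R).
Hypotheses (d0 : 0 < delta) (b1 : 1 < beta + beta).
Hypothesis hK : sewing_constant (beta + beta) K.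
Hypotheses (X1 : 1 <= X) (L0 : 0 <= L) (C0 : 0 <= C).
Hypothesis FB : forall i w z, w \in G -> `|F i w z| <= L.
Hypothesis FL : forall i w z z', w \in G -> `|F i w z - F i w z'| <= L * `|z - z'|.
Hypothesis F4 : forall i w z u z' u', w \in G ->
  `|(F i w z' - F i w u') - (F i w z - F i w u)| <=
     L * (`|(z' - u') - (z - u)| + (`|z' - z| + `|u' - u|) * `|z - u|).
Hypothesis J1 : forall w p, w \in G -> one w -> (p < n)%N ->
  J w p = xi w p.+1 - xi w p.
Hypothesis xiH : forall w p q, w \in G -> one w -> (p <= q)%N -> (q <= n)%N ->
  `|xi w q - xi w p| <= X * ((q - p)%:R * delta) `^ beta.
Hypothesis J2 : forall w p, w \in G -> ~~ one w -> (p < n)%N ->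
  `|J w p| <= C * X ^+ 2 * delta `^ (beta + beta).

Let ns : R := (size G)%:R.
Let X0 : 0 <= X. Proof. exact: le_trans X1. Qed.
Let K0 : 0 <= K. Proof. by case: hK. Qed.
Let bt0 : 0 < beta. Proof. by move: b1; lra. Qed.

Hypothesis small0 : X * h `^ beta <= 1.
Hypothesis small1 : ns * (K * L) * (X * h `^ beta) <= 2^-1.

Section Block.
Variables (a e : nat).
Hypotheses (en : (e <= n)%N) (ae : (e - a)%:R * delta <= h).

Let tau i j : R := (j - i)%:R * delta.

Let tau0 i j : 0 <= tau i j. Proof. by rewrite mulr_ge0 // ltW. Qed.

Let tau_h i j : (a <= i)%N -> (i <= j)%N -> (j <= e)%N ->
  X * tau i j `^ beta <= X * h `^ beta.
Proof.
move=> ai ij je; rewrite ler_wpM2l // le_powR ?(ltW bt0) //.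
apply: le_trans ae; rewrite ler_wpM2r ?(ltW d0) // ler_nat.
by apply: leq_sub => //.
Qed.

(** Words of length one form a discrete Young sum.  The longer ones, of order
    [beta + beta] per step, can be added up without any cancellation. *)
Lemma block_increment (u : nat -> R) (g : W -> nat -> R) (B H r : R) :
  0 <= B -> 0 <= H ->
  (forall p, (a <= p)%N -> (p < e)%N ->
    `|u p.+1 - u p - \sum_(w <- G) J w p * g w p| <= r) ->
  (forall w p, w \in G -> (a <= p)%N -> (p <= e)%N -> `|g w p| <= B) ->
  (forall w p q, w \in G -> (a <= p)%N -> (p <= q)%N -> (q <= e)%N ->
    `|g w q - g w p| <= H * tau p q `^ beta) ->
  forall i j, (a <= i)%N -> (i <= j)%N -> (j <= e)%N ->
  `|u j - u i| <=
    (ns * ((1 + C) * X * B) + ns * K * (X * h `^ beta) * H) * tau i j `^ beta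
    + (j - i)%:R * r.
Proof.
move=> B0 H0 hu hg hgH i j ai ij je.
pose G1 := [seq w <- G | one w].
have ns0 : 0 <= ns by rewrite /ns.
have G1s : (size G1)%:R <= ns by rewrite ler_nat size_filter count_size.
have D0 : 0 <= delta `^ (beta + beta) by exact: powR_ge0.
have step : forall p, (a <= p)%N -> (p < e)%N ->
    `|u p.+1 - u p - \sum_(w <- G1) g w p * (xi w p.+1 - xi w p)| <=
    r + ns * (C * X ^+ 2 * delta `^ (beta + beta) * B).
  move=> p ap pe; have pn : (p < n)%N by exact: leq_trans en.
  have -> : u p.+1 - u p - \sum_(w <- G1) g w p * (xi w p.+1 - xi w p) =
    (u p.+1 - u p - \sum_(w <- G) J w p * g w p) +
    \sum_(w <- G | ~~ one w) J w p * g w p.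
    rewrite [\sum_(w <- G) _](bigID one) /= big_filter.
    rewrite [X in _ - X = _](_ : _ = \sum_(w <- G | one w) J w p * g w p); last first.
      rewrite [LHS]big_seq_cond [RHS]big_seq_cond; apply: eq_bigr => w /andP[wG ow].
      by rewrite J1 // mulrC.
    by rewrite opprD addrA subrK.
  apply: le_trans (ler_normD _ _) _; apply: lerD; first exact: hu.
  apply: le_trans (ler_norm_sum _ _ _) _.
  rewrite /ns -sumr_const_list big_mkcond /= !big_seq; apply: ler_sum => w wG.
  case: ifPn => ow; last by do 3?[apply: mulr_ge0 => //]; rewrite exprn_ge0.
  by rewrite normrM ler_pM // ?J2 // hg // ltnW.
have := @discrete_young R W G1 g xi u delta beta K X B H _ a e (ltW d0) b1 hK X0 B0 H0
  step _ _ _ i j ai ij je.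
rewrite -/(tau i j) => dy; apply: le_trans (dy _ _ _) _.
- by move=> w p; rewrite mem_filter => /andP[_ wG]; exact: hg.
- by move=> w p q; rewrite mem_filter => /andP[_ wG]; exact: hgH.
- move=> w p q; rewrite mem_filter => /andP[ow wG] ap pq qe.
  by apply: xiH => //; exact: leq_trans en.
set t := tau i j `^ beta.
have t0 : 0 <= t by exact: powR_ge0.
have Xt : X * t <= X * h `^ beta by exact: tau_h.
move: small0 Xt; set kap := X * h `^ beta => sm0 Xt.
have kap0 : 0 <= kap by rewrite mulr_ge0 ?powR_ge0.
have E1 : (j - i)%:R * delta `^ (beta + beta) <= t * t.
  rewrite /t -powRD_pos //; apply: natmul_powR_le; [exact: ltW|exact: ltW].
rewrite powRD_pos // -/t [X in _ + X <= _]mulrDr.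
have T1 : (size G1)%:R * (B * X * t + K * (H * X) * (t * t)) <=
    ns * (X * B * t + K * kap * H * t).
  apply: ler_pM => //; first by rewrite addr_ge0 ?mulr_ge0.
  have -> : K * (H * X) * (t * t) = K * H * t * (X * t) by ring.
  have -> : K * kap * H * t = K * H * t * kap by ring.
  have -> : B * X * t = X * B * t by ring.
  by rewrite lerD2l ler_wpM2l // !mulr_ge0.
have T2 : (j - i)%:R * (ns * (C * X ^+ 2 * delta `^ (beta + beta) * B)) <=
    ns * (C * X * B * t).
  have -> : (j - i)%:R * (ns * (C * X ^+ 2 * delta `^ (beta + beta) * B)) =
    ns * (C * X ^+ 2 * B * ((j - i)%:R * delta `^ (beta + beta))) by ring.
  rewrite ler_wpM2l //; apply: (@le_trans _ _ (C * X ^+ 2 * B * (t * t))).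
    by rewrite ler_wpM2l // !mulr_ge0 // exprn_ge0.
  have -> : C * X ^+ 2 * B * (t * t) = C * X * B * t * (X * t) by ring.
  by rewrite ler_piMr ?mulr_ge0 //; exact: le_trans sm0.
have -> : (ns * ((1 + C) * X * B) + ns * K * kap * H) * t + (j - i)%:R * r =
  ns * (X * B * t + K * kap * H * t) + ((j - i)%:R * r + ns * (C * X * B * t)) by ring.
by apply: lerD => //; rewrite lerD2l.
Qed.

Variables (z : nat -> 'rV[R]_d).
Hypothesis hz : forall p i, (p < n)%N ->
  z p.+1 0 i - z p 0 i = \sum_(w <- G) J w p * F i w (z p).

Let quotient_bound (f : nat -> 'rV[R]_d) (B : R) :
  (forall i j, (a <= i)%N -> (i <= j)%N -> (j <= e)%N ->
     `|f j - f i| / tau i j `^ beta <= B) ->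
  forall i j, (a <= i)%N -> (i <= j)%N -> (j <= e)%N ->
     `|f j - f i| <= B * tau i j `^ beta.
Proof.
move=> hB i j ai; rewrite leq_eqVlt => /predU1P[<-|ij] je.
  by rewrite subrr normr0 /tau subnn mul0r powR0 ?mulr0 // gt_eqF.
rewrite -ler_pdivrMr ?powR_gt0 //; first by apply: hB => //; exact: ltnW.
by rewrite mulr_gt0 // ltr0n subn_gt0.
Qed.

Let bound_quotient (f : nat -> 'rV[R]_d) (B : R) i j : 0 <= B ->
  `|f j - f i| <= B * tau i j `^ beta -> `|f j - f i| / tau i j `^ beta <= B.
Proof.
move=> B0 h1; have := tau0 i j; rewrite le_eqVlt => /predU1P[e0|t0].
  by rewrite -e0 powR0 ?gt_eqF // invr0 mulr0.
by rewrite ler_pdivrMr // powR_gt0.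
Qed.

(** The contraction of [solution_holder], for the scheme. *)
Lemma scheme_block_holder i j : (a <= i)%N -> (i <= j)%N -> (j <= e)%N ->
  `|z j - z i| <= 2 * (ns * ((1 + C) * X * L)) * tau i j `^ beta.
Proof.
have ns0 : 0 <= ns by rewrite /ns.
have c0 : 0 <= ns * ((1 + C) * X * L) by rewrite !mulr_ge0 ?addr_ge0.
apply: quotient_bound.
apply: pair_contraction => [p q|B B0 hB].
  by rewrite divr_ge0 ?powR_ge0.
move=> p q ap pq qe; apply: bound_quotient.
  by rewrite addr_ge0 // divr_ge0.
have {}hB := quotient_bound hB.
apply: norm_le_coord => [|k].
  by rewrite mulr_ge0 ?powR_ge0 // addr_ge0 // divr_ge0.
rewrite !mxE.
have := @block_increment (fun p => z p 0 k) (fun w p => F k w (z p)) L (L * B) 0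
  L0 (mulr_ge0 L0 B0) _ _ _ p q ap pq qe.
move=> H; apply: le_trans (H _ _ _) _.
- by move=> r ar re; rewrite hz ?subrr ?normr0 // (leq_trans re).
- by move=> w r wG _ _; exact: FB.
- move=> w r r' wG ar rr re; apply: le_trans (FL _ _ _ wG) _.
  by rewrite -mulrA ler_wpM2l // hB.
rewrite mulr0 addr0 ler_wpM2r ?powR_ge0 // lerD2l.
have -> : ns * K * (X * h `^ beta) * (L * B) = ns * (K * L) * (X * h `^ beta) * B by ring.
by rewrite mulrC ler_wpM2l.
Qed.

Variables (y : nat -> 'rV[R]_d) (C1 eps eps' : R).
Hypotheses (C10 : 0 <= C1) (eps'0 : 0 <= eps').
Hypothesis hy : forall p i, (p < n)%N ->
  `|y p.+1 0 i - y p 0 i - \sum_(w <- G) J w p * F i w (y p)| <= eps.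
Hypothesis hyz : forall i j, (a <= i)%N -> (i <= j)%N -> (j <= e)%N ->
  `|y j - y i| + `|z j - z i| <= C1 * X * tau i j `^ beta.
Hypothesis heps : forall k, (k <= n)%N -> k%:R * eps <= eps' * (k%:R * delta) `^ beta.
Hypothesis small2 : 2 * (ns * ((1 + C) * L) + C1 / 2) * (X * h `^ beta) <= 2^-1.

Let D p := y p - z p.

(** The coefficients of the linear recursion for [D] have Hölder constants
    controlled by those of [D], of the solution and of the scheme, through the
    four-point estimate; the part that involves [D] is a contraction. *)
Lemma block_difference_holder M i j : 0 <= M ->
  (forall p, (a <= p)%N -> (p <= e)%N -> `|D p| <= M) ->
  (a <= i)%N -> (i <= j)%N -> (j <= e)%N ->
  `|D j - D i| <= 2 * ((ns * ((1 + C) * L) + C1 / 2) * (X * M) + eps') * tau i j `^ beta.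
Proof.
move=> M0 hM; have ns0 : 0 <= ns by rewrite /ns.
have c0 : 0 <= ns * ((1 + C) * L) + C1 / 2.
  by rewrite addr_ge0 ?mulr_ge0 ?addr_ge0 ?invr_ge0.
set al := (ns * ((1 + C) * L) + C1 / 2) * (X * M) + eps'.
have al0 : 0 <= al by rewrite addr_ge0 ?mulr_ge0.
move: i j; apply: quotient_bound.
apply: pair_contraction => [p q|B B0 hB].
  by rewrite divr_ge0 ?powR_ge0.
move=> p q ap pq qe; apply: bound_quotient.
  by rewrite addr_ge0 // divr_ge0.
have {}hB := quotient_bound hB.
apply: norm_le_coord => [|k].
  by rewrite mulr_ge0 ?powR_ge0 // addr_ge0 // divr_ge0.
rewrite !mxE.
have C1XM : 0 <= C1 * X * M by rewrite !mulr_ge0.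
have := @block_increment (fun p => y p 0 k - z p 0 k)
  (fun w p => F k w (y p) - F k w (z p)) (L * M) (L * (B + C1 * X * M)) eps
  (mulr_ge0 L0 M0) (mulr_ge0 L0 (addr_ge0 B0 C1XM)) _ _ _ p q ap pq qe.
move=> H; apply: le_trans (H _ _ _) _.
- move=> r ar re; have rn : (r < n)%N by exact: leq_trans re en.
  rewrite [X in `|X|](_ : _ = y r.+1 0 k - y r 0 k - \sum_(w <- G) J w r * F k w (y r)).
    exact: hy.
  under eq_bigr do rewrite mulrBr.
  by rewrite sumrB -hz //; ring.
- move=> w r wG ar re; apply: le_trans (FL _ _ _ wG) _.
  by rewrite ler_wpM2l // hM.
- move=> w r r' wG ar rr re; apply: le_trans (F4 _ _ _ _ _ wG) _.
  rewrite -[leRHS]mulrA ler_wpM2l // [leRHS]mulrDl; apply: lerD; first exact: hB.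
  rewrite [leRHS]mulrAC; apply: ler_pM => //; first exact: hyz.
  by apply: hM => //; exact: leq_trans re.
have E : (q - p)%:R * eps <= eps' * tau p q `^ beta.
  by apply: heps; apply: leq_trans en; apply: leq_trans (leq_subr _ _) qe.
apply: le_trans (lerD (lexx _) E) _.
rewrite -mulrDl ler_wpM2r ?powR_ge0 //.
move: small1; set kap := X * h `^ beta => sm1.
have -> : ns * K * kap * (L * (B + C1 * X * M)) =
  ns * (K * L) * kap * (B + C1 * X * M) by ring.
have : ns * (K * L) * kap * (B + C1 * X * M) <= 2^-1 * (B + C1 * X * M).
  by rewrite ler_wpM2r // addr_ge0.
rewrite /al; lra.
Qed.

(** Within the block [D] varies by at most half of its maximum, up to the local
    errors. *)
Lemma block_stability j : (a <= j)%N -> (j <= e)%N ->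
  `|D j| <= 2 * (`|D a| + 2 * eps').
Proof.
have ns0 : 0 <= ns by rewrite /ns.
have c0 : 0 <= ns * ((1 + C) * L) + C1 / 2.
  by rewrite addr_ge0 ?mulr_ge0 ?addr_ge0 ?invr_ge0.
move=> aj je.
apply: (@pair_contraction R (fun _ j => `|D j|) a e _ _ _ a j) => //.
move=> B B0 hB i q ai iq qe; have aq := leq_trans ai iq.
have hM p : (a <= p)%N -> (p <= e)%N -> `|D p| <= B by move=> ap pe; exact: (hB a p).
have := block_difference_holder B0 hM (leqnn a) aq qe.
move: c0 small2; set t := tau a q `^ beta; set c := (ns * ((1 + C) * L) + C1 / 2).
move=> c0 sm2 H.
have t0 : 0 <= t by exact: powR_ge0.
have Xt : X * t <= X * h `^ beta by exact: tau_h.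
have t1 : t <= 1.
  apply: le_trans small0; apply: le_trans Xt; by rewrite ler_peMl.
have H1 : 2 * (c * (X * B) + eps') * t <= B / 2 + 2 * eps'.
  have -> : 2 * (c * (X * B) + eps') * t = 2 * c * (X * t) * B + 2 * eps' * t by ring.
  apply: lerD.
    rewrite [leRHS]mulrC ler_wpM2r //; apply: le_trans sm2.
    by rewrite ler_wpM2l // mulr_ge0.
  by rewrite ler_piMr // mulr_ge0.
rewrite -(subrK (D a) (D q)) addrC.
apply: le_trans (ler_normD _ _) _; move: (le_trans H H1); lra.
Qed.

End Block.

Variables (y z : nat -> 'rV[R]_d) (Cy eps eps' : R).
Hypotheses (Cy0 : 0 <= Cy) (eps'0 : 0 <= eps').
Hypothesis hz : forall p i, (p < n)%N ->
  z p.+1 0 i - z p 0 i = \sum_(w <- G) J w p * F i w (z p).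
Hypothesis hy : forall p i, (p < n)%N ->
  `|y p.+1 0 i - y p 0 i - \sum_(w <- G) J w p * F i w (y p)| <= eps.
Hypothesis hyH : forall i j, (i <= j)%N -> (j <= n)%N -> (j - i)%:R * delta <= h ->
  `|y j - y i| <= Cy * X * ((j - i)%:R * delta) `^ beta.
Hypothesis heps : forall k, (k <= n)%N -> k%:R * eps <= eps' * (k%:R * delta) `^ beta.
Hypothesis small2 : 2 * (ns * ((1 + C) * L) + (Cy + 2 * (ns * ((1 + C) * L))) / 2) *
  (X * h `^ beta) <= 2^-1.

(** Since [D] vanishes at [0], the factor [2] per block acts only on the errors
    contributed by the preceding blocks. *)
Lemma grid_stability (q : nat) : q%:R * delta <= h -> y 0%N = z 0%N ->
  forall k j, (j <= k * q)%N -> (j <= n)%N ->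
  `|y j - z j| <= (2 ^+ k - 1) * (4 * eps').
Proof.
move=> qh yz0; have ns0 : 0 <= ns by rewrite /ns.
elim=> [|k IH] j.
  by rewrite mul0n leqn0 => /eqP-> _; rewrite yz0 subrr normr0 expr0 subrr mul0r.
move=> jk jn; have e4 : 0 <= 4 * eps' by rewrite mulr_ge0.
have pow_le : (2 ^+ k - 1) * (4 * eps') <= (2 ^+ k.+1 - 1) * (4 * eps').
  by rewrite ler_wpM2r // lerD2r ler_weXn2l // ler1n.
have [jkq|kqj] := leqP j (k * q).
  by apply: le_trans pow_le; exact: IH.
have kqn : (k * q <= n)%N by rewrite (leq_trans (ltnW kqj)).
have IHa := IH _ (leqnn (k * q)) kqn.
have je : ((j - k * q)%:R * delta <= h).
  apply: le_trans qh; rewrite ler_wpM2r ?(ltW d0) // ler_nat leq_subLR.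
  by rewrite -mulSnr.
have c0 : 0 <= Cy + 2 * (ns * ((1 + C) * L)).
  by rewrite addr_ge0 // !mulr_ge0 ?addr_ge0.
have sub_h p r : (k * q <= p)%N -> (p <= r)%N -> (r <= j)%N -> (r - p)%:R * delta <= h.
  move=> ap pr rj; apply: le_trans je; rewrite ler_wpM2r ?(ltW d0) // ler_nat.
  by rewrite leq_sub.
have := @block_stability (k * q) j jn je z hz y (Cy + 2 * (ns * ((1 + C) * L)))
  eps eps' c0 eps'0 hy _ heps small2 j (ltnW kqj) (leqnn j).
move=> H; apply: le_trans (H _) _; last by rewrite exprS; lra.
move=> p r ap pr rj.
have -> : (Cy + 2 * (ns * ((1 + C) * L))) * X * ((r - p)%:R * delta) `^ beta =
  Cy * X * ((r - p)%:R * delta) `^ beta +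
  2 * (ns * ((1 + C) * X * L)) * ((r - p)%:R * delta) `^ beta by ring.
apply: lerD.
  by apply: hyH => //; [exact: leq_trans jn|exact: sub_h].
exact: (scheme_block_holder jn je hz).
Qed.

End DiscreteStability.

(** * The error of the scheme for a given driver *)

Section OneScheme.
Context {R : realType} {d m : nat}.
Variables (T beta X S L K lam A theta h : R) (V : 'rV[R]_d -> 'M[R]_(d, m)).
Variables (x : R -> 'rV[R]_m) (y yn : R -> 'rV[R]_d) (y0 : 'rV[R]_d) (b : 'I_m -> R).
Variables (N n : nat) (Gs : seq (seq 'I_m)).
Hypotheses (T0 : 0 < T) (b1 : 1 < beta + beta) (bt1 : beta <= 1).
Hypotheses (X1 : 1 <= X) (S0 : 0 <= S) (L1 : 1 <= L).
Hypothesis hK : sewing_constant (beta + beta) K.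
Hypothesis hb : forall j, beta <= b j.
Hypothesis hx : forall j, holder_on 0 T beta X (fun v => x v 0 j).
Hypothesis hxS : forall j, holder_on 0 T (b j) S (fun v => x v 0 j).
Hypothesis hV : forall i w, (0 < size w)%N ->
  ((size w <= N.+1)%N -> word_bounds V L i w) /\
  ((size w <= N)%N -> word_bounds2 V L i w).
Hypotheses (lam0 : 0 < lam) (lam1 : 1 < lam + beta) (A0 : 0 <= A).
Hypothesis hyA : forall u v, 0 <= u -> u <= v -> v <= T ->
  `|y v - y u| <= A * (v - u) `^ lam.
Hypothesis hy : forall t, 0 <= t <= T ->
  y t = y0 + \row_i \sum_j RS_integral (fun u => V (y u) i j) (fun u => x u 0 j) 0 t.
Hypothesis Gs_uniq : uniq Gs.
Hypothesis Gs_size : forall w, w \in Gs -> (0 < size w <= N)%N.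
Hypothesis Gs_closed : forall j w, (0 < size w)%N -> j :: w \in Gs -> w \in Gs.
Hypothesis Gs_order : forall w, (0 < size w)%N -> w \notin Gs ->
  1 + theta <= \sum_(j <- w) b j.
Hypothesis n0 : (0 < n)%N.
Hypothesis yn0 : yn 0 = y 0.
Hypothesis hyn : forall k, (k < n)%N -> forall t, grid T n k <= t <= grid T n k.+1 ->
  forall i, yn t 0 i - yn (grid T n k) 0 i =
    \sum_(w <- Gs) iter_int x w (fun=> 1) (grid T n k) t *
       calVs V w (coord i) (yn (grid T n k)).

Let ns : R := (size Gs)%:R.
Let C : R := (1 + K) ^+ N.
Let Cy : R := 2 * (m%:R * L).
Let Y : R := (1 + K) * (1 + S).

Hypothesis h0 : 0 < h.
Hypothesis small0 : X * h `^ beta <= 1.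
Hypothesis small : m%:R * (K * (L * X)) * h `^ beta <= 2^-1.

Let L0 : 0 <= L. Proof. exact: le_trans L1. Qed.
Let X0 : 0 <= X. Proof. exact: le_trans X1. Qed.
Let K0 : 0 <= K. Proof. by case: hK. Qed.
Let bt0 : 0 < beta. Proof. by move: b1; lra. Qed.
Let ns0 : 0 <= ns. Proof. by rewrite /ns. Qed.
Let C0 : 0 <= C. Proof. by rewrite exprn_ge0 // addr_ge0. Qed.
Let Y1 : 1 <= Y. Proof. by apply: mulr_ege1; rewrite lerDl. Qed.
Let Y0 : 0 <= Y. Proof. exact: le_trans Y1. Qed.
Let n0' : 0 < n%:R :> R. Proof. by rewrite ltr0n. Qed.
Let delta := T / n%:R.
Let delta0 : 0 < delta. Proof. by rewrite divr_gt0. Qed.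

Lemma gridE k : grid T n k = k%:R * delta.
Proof. by rewrite /grid /delta mulrA. Qed.

Lemma grid_ge0 k : 0 <= grid T n k.
Proof. by rewrite gridE mulr_ge0 // ltW. Qed.

Lemma grid_le k l : (k <= l)%N -> grid T n k <= grid T n l.
Proof. by move=> kl; rewrite !gridE ler_wpM2r ?(ltW delta0) // ler_nat. Qed.

Lemma grid_last : grid T n n = T.
Proof. by rewrite /grid mulrAC divff ?mul1r // gt_eqF. Qed.

Lemma grid_leT k : (k <= n)%N -> grid T n k <= T.
Proof. by move=> kn; rewrite -[leRHS]grid_last grid_le. Qed.

Lemma gridB k l : (k <= l)%N -> grid T n l - grid T n k = (l - k)%:R * delta.
Proof. by move=> kl; rewrite !gridE -mulrBl natrB. Qed.

Lemma grid_cell t : 0 <= t <= T ->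
  exists2 k, (k < n)%N & grid T n k <= t <= grid T n k.+1.
Proof.
move=> /andP[t0 tT].
have G : forall k, (k <= n)%N -> (0 < k)%N -> t <= grid T n k ->
    exists2 k, (k < n)%N & grid T n k <= t <= grid T n k.+1.
  elim=> // k IH kn _ tk; have [H|H] := leP t (grid T n k); last first.
    by exists k => //; rewrite tk ltW.
  case: k => [|k] in IH kn tk H *.
    by exists 0%N => //; rewrite tk andbT gridE mul0r.
  by apply: IH => //; exact: ltnW.
by apply: (G n) => //; rewrite grid_last.
Qed.

(** Only the exponent [beta] enters, so that the powers of [X] are balanced by
    those of the length; no power of [X] remains on short intervals. *)
Lemma iter_one_bound w s t : (size w <= N)%N -> 0 <= s -> s <= t -> t <= T ->
  `|iter_int x w (fun=> 1) s t| <= C * (X * (t - s) `^ beta) ^+ size w.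
Proof.
move=> wN s0 st tT.
have hxs j : holder_on s t beta X (fun v => x v 0 j) by exact: holder_on_sub (hx j).
have hF : holder_on s t beta 0 (fun=> 1 : R).
  by move=> u v _ _ _; rewrite /= subrr normr0 mul0r.
apply: le_trans (@iter_int_bound R m x s t beta K X (fun=> beta) w 0 1 _ b1 _ hK X0
  ler01 (lexx 0) st hxs hF _) _ => //.
  by move=> u _ _; rewrite normr1.
rewrite mul0r addr0 mulr1 sumr_const_list mulrC [_ * beta]mulrC powRrM powR_mulrn ?powR_ge0 //.
rewrite mulrC -exprMn -mulrA exprMn ler_wpM2r ?exprn_ge0 ?mulr_ge0 ?powR_ge0 //.
by rewrite ler_weXn2l // lerDl.
Qed.

(** For a coarse mesh, where the length of a cell is bounded by [T] only. *)
Lemma iter_one_boundS w s t : (size w <= N)%N -> 0 <= s -> s <= t -> t <= T ->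
  `|iter_int x w (fun=> 1) s t| <= Y ^+ N.+1 * T `^ (\sum_(j <- w) b j).
Proof.
move=> wN s0 st tT.
have hxs j : holder_on s t (b j) S (fun v => x v 0 j) by exact: holder_on_sub (hxS j).
have hF : holder_on s t beta 0 (fun=> 1 : R).
  by move=> u v _ _ _; rewrite /= subrr normr0 mul0r.
apply: le_trans (@iter_int_bound R m x s t beta K S b w 0 1 _ b1 hb hK S0
  ler01 (lexx 0) st hxs hF _) _ => //.
  by move=> u _ _; rewrite normr1.
rewrite mul0r addr0 mulr1; apply: ler_pM; rewrite ?powR_ge0 ?exprn_ge0 ?mulr_ge0 ?addr_ge0 //.
  apply: (@le_trans _ _ (Y ^+ size w)).
    apply: lerXn2r; rewrite ?nnegrE ?mulr_ge0 ?addr_ge0 //.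
    by rewrite /Y ler_wpM2l ?addr_ge0 // lerDr.
  by rewrite ler_weXn2l // leqW.
rewrite le_powR ?subr_ge0 //; last by apply: le_trans tT; rewrite gerBl.
by apply: sumr_ge0 => j _; apply: le_trans (ltW bt0) (hb j).
Qed.

Lemma iter_letter j s t : 0 <= s -> s <= t -> t <= T ->
  iter_int x [:: j] (fun=> 1) s t = x t 0 j - x s 0 j.
Proof.
move=> s0 st tT.
have hxs : holder_on s t beta X (fun v => x v 0 j) by exact: holder_on_sub (hx j).
have hF : holder_on s t beta 0 (fun=> 1 : R).
  by move=> u v _ _ _; rewrite /= subrr normr0 mul0r.
apply: (@RS_integral_primitive _ _ _ (fun v => x v 0 j) s t _ _ _ _ (ltW bt0)
  (ltW bt0) b1 (lexx 0) X0 hF hxs) => //.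
by exists 0 => // u v _ _ _; rewrite mul1r subrr normr0 mul0r.
Qed.

Lemma calVs_bounded i w z : (0 < size w <= N)%N -> `|calVs V w (coord i) z| <= L.
Proof.
move=> /andP[w0 wN]; have [/(_ (leqW wN))[h1 _] _] := hV i w0; exact: h1.
Qed.

Lemma calVs_lipschitz i w z z' : (0 < size w <= N)%N ->
  `|calVs V w (coord i) z - calVs V w (coord i) z'| <= L * `|z - z'|.
Proof.
move=> /andP[w0 wN]; have [/(_ (leqW wN))[_ h1] _] := hV i w0; exact: h1.
Qed.

Let P := taylor_constant T b Gs * Y ^+ N.+1 * (L * (1 + 2 * (m%:R * L))).

Let P0 : 0 <= P.
Proof.
rewrite /P; do 2?[apply: mulr_ge0 => //]; rewrite ?exprn_ge0 ?taylor_constant_ge0 //.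
by rewrite addr_ge0 // !mulr_ge0.
Qed.

Section FineMesh.
Hypothesis fine : delta <= h.
Hypothesis small1 : ns * (K * L) * (X * h `^ beta) <= 2^-1.
Hypothesis small2 : 2 * (ns * ((1 + C) * L) + (Cy + 2 * (ns * ((1 + C) * L))) / 2) *
  (X * h `^ beta) <= 2^-1.

Let eps := P * n%:R `^ (- (1 + theta)).
Let eps' := n%:R / (n%:R * delta) `^ beta * eps.

Let eps0 : 0 <= eps. Proof. by rewrite /eps mulr_ge0 ?powR_ge0. Qed.

Let eps'0 : 0 <= eps'. Proof.
by rewrite /eps' (mulr_ge0 _ eps0) // divr_ge0 ?powR_ge0.
Qed.

Lemma cell_error k t i : (k < n)%N -> grid T n k <= t -> t <= grid T n k.+1 ->
  `|y t 0 i - y (grid T n k) 0 i -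
    \sum_(w <- Gs) iter_int x w (fun=> 1) (grid T n k) t *
      calVs V w (coord i) (y (grid T n k))| <= eps.
Proof.
move=> kn kt tk.
have tT : t <= T by apply: le_trans tk (grid_leT kn).
have td : t - grid T n k <= delta.
  have := gridB (leqnSn k); rewrite subSnn mul1r; move: tk; lra.
have th : t - grid T n k <= h by exact: le_trans td fine.
apply: (local_taylor_error T0 b1 X0 S0 L1 hK hb hx hxS hV lam0 lam1 A0 hyA hy
  Gs_uniq Gs_size Gs_closed Gs_order small) => //; first exact: grid_ge0.
apply: le_trans small0; rewrite ler_wpM2l // le_powR ?(ltW bt0) // subr_ge0 //.
Qed.

(** Blocks of [q] steps, where [q] is the largest number of steps that fits into
    the length [h]; at least half of [h] is used, so there are at most
    [2 * (T / h) + 1] of them. *)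
Lemma fine_grid_error k : (k <= n)%N ->
  `|y (grid T n k) - yn (grid T n k)| <= expR (2 * (T / h) + 1) * (4 * eps').
Proof.
move=> kn.
pose q := Num.truncn (h / delta).
have hd1 : 1 <= h / delta by rewrite ler_pdivlMr // mul1r.
have hd0 : 0 <= h / delta by apply: le_trans hd1.
have /andP[q1 q2] := truncn_itv hd0; rewrite -/q in q1 q2.
have q0 : (0 < q)%N by rewrite truncn_ge_nat.
have qh : q%:R * delta <= h by rewrite -ler_pdivlMr.
(* Words of one letter have additive contributions. *)
pose xi (w : seq 'I_m) p : R := if w is j :: _ then x (grid T n p) 0 j else 0.
pose J (w : seq 'I_m) p := iter_int x w (fun=> 1) (grid T n p) (grid T n p.+1).
pose kk := (n %/ q).+1.
have nkk : (n <= kk * q)%N by rewrite ltnW // ltn_ceil.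
have kkT : kk%:R <= 2 * (T / h) + 1.
  rewrite /kk -natr1 lerD2r.
  have q0' : 0 < q%:R :> R by rewrite ltr0n.
  apply: (@le_trans _ _ (n%:R / q%:R)).
    by rewrite ler_pdivlMr // -natrM ler_nat leq_trunc_div.
  rewrite ler_pdivrMr //.
  have hq : h <= 2 * q%:R * delta.
    have q2' : h < (q%:R + 1) * delta by rewrite -ltr_pdivrMr // natr1.
    have : delta <= q%:R * delta by rewrite ler_peMl ?(ltW delta0) // ler1n.
    by move: q2'; rewrite mulrDl mul1r; lra.
  have Tn : T = n%:R * delta by rewrite /delta mulrC divfK // gt_eqF.
  rewrite Tn -[leLHS]mulr1.
  have -> : 2 * (n%:R * delta / h) * q%:R = n%:R * (2 * q%:R * delta / h) by ring.
  by rewrite ler_wpM2l // ler_pdivlMr // mul1r.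
have stab : `|y (grid T n k) - yn (grid T n k)| <= (2 ^+ kk - 1) * (4 * eps').
  have one_size w : (w : seq 'I_m) \in Gs -> ~~ (size w == 1%N) -> (1 < size w <= N)%N.
    move=> /Gs_size/andP[w0 wN] w1; rewrite wN andbT.
    by rewrite ltn_neqAle eq_sym w1 w0.
  apply: (@grid_stability R d (seq 'I_m) n delta beta K X L C h Gs
    (fun w => size w == 1%N) xi J (fun i w => calVs V w (coord i))
    delta0 b1 hK X1 L0 C0 _ _ _ _ _ _ small0 small1
    (fun k => y (grid T n k)) (fun k => yn (grid T n k)) Cy eps eps' _ eps'0
    _ _ _ _ small2 q qh _ kk k (leq_trans kn nkk) kn).
  - by move=> i w z wG; apply: calVs_bounded; exact: Gs_size.
  - by move=> i w z z' wG; apply: calVs_lipschitz; exact: Gs_size.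
  - move=> i w z u z' u' wG; have /andP[w0 wN] := Gs_size wG.
    have [_ /(_ wN)[_ _ h4]] := hV i w0; exact: h4.
  - move=> [|j [|l w]] p wG // _ pn; rewrite /J /xi.
    apply: iter_letter; [exact: grid_ge0|exact: grid_le|exact: grid_leT].
  - move=> [|j [|l w]] p r wG // _ pr rn; rewrite /xi -gridB //.
    by apply: hx; [exact: grid_ge0|exact: grid_le|exact: grid_leT].
  - move=> w p wG w1 pn; have /andP[w2 wN] := one_size w wG w1.
    apply: le_trans (iter_one_bound wN (grid_ge0 _) (grid_le (leqnSn p)) (grid_leT pn)) _.
    rewrite gridB // subSnn mul1r -mulrA ler_wpM2l // powRD_pos // -expr2 -exprMn.
    have Xd1 : X * delta `^ beta <= 1.
      apply: le_trans small0; rewrite ler_wpM2l // le_powR ?(ltW bt0) // ltW //.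
    by rewrite ler_wiXn2l // mulr_ge0 ?powR_ge0.
  - by rewrite /Cy !mulr_ge0.
  - move=> p i pn; rewrite (hyn pn) // lexx andbT grid_le //.
  - move=> p i pn; apply: cell_error => //; exact: grid_le.
  - move=> i j ij jn; rewrite -gridB // => ijh.
    apply: le_trans (solution_holder b1 X0 L0 hK hx (field_bounded hV)
      (field_lipschitz hV) lam0 lam1 A0 hyA hy small (grid_ge0 _) (grid_le ij)
      (grid_leT jn) ijh) _.
    by rewrite /Cy le_eqVlt; apply/orP; left; apply/eqP; ring.
  - move=> l ln; rewrite /eps' mulrAC ler_wpM2r //.
    by apply: natmul_le_powR => //; rewrite bt0.
  - by rewrite /grid mul0r mul0r.
apply: le_trans stab _; rewrite (ler_wpM2r (mulr_ge0 (ler0n _ 4) eps'0)) //.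
apply: (@le_trans _ _ (expR kk%:R)); last by rewrite ler_expR.
have -> : expR kk%:R = expR 1 ^+ kk :> R by rewrite -expRM_natl mulr1.
rewrite lerBlDr ler_wpDr // ler_pXn2r ?nnegrE ?expR_ge0 //.
exact: (expR_ge1Dx (1 : R)).
Qed.

(** Inside a cell the solution and the scheme are advanced by the same
    expansion, from two starting points. *)
Lemma fine_error t : 0 <= t <= T ->
  `|y t - yn t| <= P * T `^ (- beta) * (T `^ beta + 4 * (1 + ns * C * L)) *
     expR (2 * (T / h) + 1) * n%:R `^ (- theta).
Proof.
move=> tT; have [k kn /andP[kt tk]] := grid_cell tT.
set D := `|y (grid T n k) - yn (grid T n k)|.
have HD : D <= expR (2 * (T / h) + 1) * (4 * eps') by apply: fine_grid_error; exact: ltnW.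
have Tn : n%:R * delta = T by rewrite /delta mulrC divfK // gt_eqF.
have eps'E : eps' = P * T `^ (- beta) * n%:R `^ (- theta).
  rewrite /eps' /eps Tn (opprD 1 theta) powRD; last by rewrite (gt_eqF n0') implybT.
  rewrite powR_inv1 // [T `^ (- beta)]powRN.
  have tb0 : T `^ beta != 0 by rewrite gt_eqF ?powR_gt0.
  have nn0 : n%:R != 0 :> R by rewrite gt_eqF.
  set q := n%:R `^ _; set tb := T `^ beta in tb0 *.
  by field; rewrite tb0 nn0.
have epsE : eps <= eps' * T `^ beta.
  rewrite /eps' Tn mulrAC divfK ?gt_eqF ?powR_gt0 // ler_peMl // ler1n.
  by [].
have c0 : 0 <= 1 + ns * C * L.
  exact: addr_ge0 ler01 (mulr_ge0 (mulr_ge0 ns0 C0) L0).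
have key : `|y t - yn t| <= eps + (1 + ns * C * L) * D.
  have D0 : 0 <= D by rewrite normr_ge0.
  apply: norm_le_coord => [|i].
    exact: addr_ge0 eps0 (mulr_ge0 c0 D0).
  have e1 := cell_error i kn kt tk.
  have e2 := hyn kn (introT andP (conj kt tk)) i.
  set s := grid T n k in e1 e2 D HD D0 *.
  have tTT : t <= T by case/andP: tT.
  have e3 : `|\sum_(w <- Gs) iter_int x w (fun=> 1) s t * calVs V w (coord i) (y s) -
      \sum_(w <- Gs) iter_int x w (fun=> 1) s t * calVs V w (coord i) (yn s)| <=
      ns * (C * (L * D)).
    rewrite -sumrB; apply: le_trans (ler_norm_sum _ _ _) _.
    rewrite /ns -sumr_const_list !big_seq; apply: ler_sum => w wG.
    have /andP[w0 wN] := Gs_size wG.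
    rewrite -mulrBr normrM; apply: ler_pM => //; last first.
      by apply: calVs_lipschitz; exact: Gs_size.
    apply: le_trans (iter_one_bound wN (grid_ge0 _) kt tTT) _.
    rewrite ler_piMr // exprn_ile1 ?mulr_ge0 ?powR_ge0 //.
    apply: le_trans small0; rewrite ler_wpM2l // le_powR ?(ltW bt0) ?subr_ge0 //.
    apply: le_trans fine; have := gridB (leqnSn k); rewrite subSnn mul1r -/s.
    by move: tk; lra.
  have e4 := coord_le_norm (y s - yn s) i.
  rewrite !mxE -/D in e4 *.
  rewrite [X in `|X|](_ : _ = (y t 0 i - y s 0 i -
      \sum_(w <- Gs) iter_int x w (fun=> 1) s t * calVs V w (coord i) (y s)) +
    (y s 0 i - yn s 0 i) +
    (\sum_(w <- Gs) iter_int x w (fun=> 1) s t * calVs V w (coord i) (y s) -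
      \sum_(w <- Gs) iter_int x w (fun=> 1) s t * calVs V w (coord i) (yn s)));
    last by rewrite -e2; ring.
  apply: le_trans (ler_normD _ _) _.
  apply: le_trans (lerD (ler_normD _ _) e3) _.
  by apply: le_trans (lerD (lerD e1 e4) (lexx _)) _; lra.
have E1 : 1 <= expR (2 * (T / h) + 1).
  by rewrite -[leLHS]expR0 ler_expR addr_ge0 // !mulr_ge0 ?invr_ge0 // ltW.
apply: le_trans key _.
apply: (@le_trans _ _ (eps' * T `^ beta * expR (2 * (T / h) + 1) +
  (1 + ns * C * L) * (expR (2 * (T / h) + 1) * (4 * eps')))).
  apply: lerD; last by rewrite ler_wpM2l.
  by apply: le_trans epsE _; rewrite ler_peMr // (mulr_ge0 eps'0) ?powR_ge0.
by rewrite eps'E le_eqVlt; apply/orP; left; apply/eqP; ring.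
Qed.

End FineMesh.

Section CoarseMesh.
Hypothesis coarse : h < delta.

Definition scheme_constant := \sum_(w <- Gs) T `^ (\sum_(j <- w) b j).

Let scheme_constant_ge0 : 0 <= scheme_constant.
Proof. by apply: sumr_ge0 => w _; exact: powR_ge0. Qed.

Lemma scheme_step k t : (k < n)%N -> grid T n k <= t <= grid T n k.+1 ->
  `|yn t - yn (grid T n k)| <= Y ^+ N.+1 * scheme_constant * L.
Proof.
move=> kn kt; apply: norm_le_coord => [|i].
  by rewrite !mulr_ge0 // exprn_ge0.
rewrite !mxE (hyn kn kt); have /andP[k1 k2] := kt.
apply: le_trans (ler_norm_sum _ _ _) _.
rewrite /scheme_constant mulr_sumr mulr_suml !big_seq; apply: ler_sum => w wG.
have ws := Gs_size wG; have /andP[w0 wN] := ws.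
rewrite normrM; apply: ler_pM => //; last exact: calVs_bounded.
apply: iter_one_boundS => //; first exact: grid_ge0.
exact: le_trans k2 (grid_leT kn).
Qed.

Lemma scheme_displacement t : 0 <= t <= T ->
  `|yn t - yn 0| <= n%:R * (Y ^+ N.+1 * scheme_constant * L).
Proof.
have B0 : 0 <= Y ^+ N.+1 * scheme_constant * L by rewrite !mulr_ge0 // exprn_ge0.
have G k : (k <= n)%N ->
    `|yn (grid T n k) - yn 0| <= k%:R * (Y ^+ N.+1 * scheme_constant * L).
  elim: k => [|k IH] kn; first by rewrite /grid !mul0r subrr normr0.
  rewrite -(subrK (yn (grid T n k)) (yn (grid T n k.+1))) -addrA.
  apply: le_trans (ler_normD _ _) _; rewrite -natr1 mulrDl mul1r [leRHS]addrC.
  apply: lerD; last by apply: IH; exact: ltnW.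
  by apply: scheme_step => //; rewrite lexx andbT grid_le.
move=> tT; have [k kn kt] := grid_cell tT.
rewrite -(subrK (yn (grid T n k)) (yn t)) -addrA.
apply: le_trans (ler_normD _ _) _.
apply: (@le_trans _ _ (k.+1%:R * (Y ^+ N.+1 * scheme_constant * L))).
  rewrite -natr1 mulrDl mul1r [leRHS]addrC; apply: lerD; first exact: scheme_step.
  by apply: G; exact: ltnW.
by rewrite ler_wpM2r // ler_nat.
Qed.

(** As [n <= T / h], the factor [n `^ theta] is at most an exponential of
    [T / h] and can be borrowed from it. *)
Lemma coarse_error t : 0 <= t <= T ->
  `|y t - yn t| <= (Cy + scheme_constant * L) * Y ^+ N.+1 *
     expR ((1 + `|theta|) * (T / h)) * n%:R `^ (- theta).
Proof.
move=> tT; have /andP[t0 tT'] := tT.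
have Th0 : 0 <= T / h by rewrite divr_ge0 // ltW.
have nTh : n%:R <= T / h.
  by rewrite ler_pdivlMr // mulrC -ler_pdivlMr // ltW.
have YN1 : 1 <= Y ^+ N.+1 by rewrite exprn_ege1.
have Cy0 : 0 <= Cy by rewrite /Cy !mulr_ge0.
have h1 : `|y t - y 0| <= (T / h + 1) * Cy.
  have th0 : 0 <= t / h by rewrite divr_ge0 // ltW.
  have /andP[k1 k2] := truncn_itv th0.
  have tk : t <= (Num.truncn (t / h)).+1%:R * h by rewrite -ler_pdivrMr // ltW.
  apply: le_trans (solution_displacement b1 X0 L0 hK hx (field_bounded hV)
      (field_lipschitz hV) lam0 lam1 A0 hyA hy small t0 tT' tk h0) _.
  apply: ler_pM => //; first by rewrite !mulr_ge0 ?powR_ge0.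
    rewrite -natr1 lerD2r; apply: le_trans k1 _.
    by rewrite ler_wpM2r // invr_ge0 ltW.
  have -> : 2 * (m%:R * (L * X)) * h `^ beta = Cy * (X * h `^ beta) by rewrite /Cy; ring.
  by rewrite ler_piMr.
have h2 := scheme_displacement tT.
have h3 : `|y t - yn t| <= (T / h + 1) * (Cy + scheme_constant * L) * Y ^+ N.+1.
  have -> : y t - yn t = (y t - y 0) - (yn t - yn 0).
    by rewrite yn0 opprB addrA subrK.
  apply: le_trans (ler_normB _ _) _.
  apply: le_trans (lerD h1 h2) _.
  rewrite mulrDr [leRHS]mulrDl; apply: lerD.
    by rewrite ler_peMr // mulr_ge0 // addr_ge0.
  have -> : (T / h + 1) * (scheme_constant * L) * Y ^+ N.+1 =
    (T / h + 1) * (Y ^+ N.+1 * scheme_constant * L) by ring.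
  rewrite ler_wpM2r ?mulr_ge0 ?exprn_ge0 //.
  by apply: le_trans nTh _; rewrite lerDl.
apply: le_trans h3 _.
have h4 : 1 <= expR (`|theta| * (T / h)) * n%:R `^ (- theta).
  rewrite /powR gt_eqF // -expRD -[leLHS]expR0 ler_expR.
  have ln0 : 0 <= ln n%:R :> R by rewrite ln_ge0 // ler1n.
  have lnn : ln n%:R <= T / h.
    by apply: le_trans nTh; apply: ltW; exact: ln_sublinear.
  rewrite mulNr subr_ge0; apply: le_trans (_ : `|theta| * ln n%:R <= _).
    by rewrite ler_wpM2r // ler_norm.
  by rewrite ler_wpM2l.
have h5 : T / h + 1 <= expR (T / h) by rewrite addrC expR_ge1Dx.
rewrite (mulrDl 1 `|theta|) mul1r expRD.
set E := expR (T / h) in h5 *; set E' := expR _ in h4 *.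
have Q0 : 0 <= (Cy + scheme_constant * L) * Y ^+ N.+1.
  by rewrite mulr_ge0 ?addr_ge0 ?mulr_ge0 ?exprn_ge0.
have E0 : 0 <= E by exact: expR_ge0.
have -> : (Cy + scheme_constant * L) * Y ^+ N.+1 * (E * E') * n%:R `^ (- theta) =
  E * ((Cy + scheme_constant * L) * Y ^+ N.+1) * (E' * n%:R `^ (- theta)) by ring.
apply: (@le_trans _ _ (E * ((Cy + scheme_constant * L) * Y ^+ N.+1))).
  by rewrite -mulrA ler_wpM2r.
by rewrite ler_peMr // mulr_ge0.
Qed.

End CoarseMesh.

End OneScheme.

(** * Constants that do not depend on the driver *)

Section UniformConstant.
Context {R : realType} {d m : nat}.
Variables (T beta L K theta : R) (V : 'rV[R]_d -> 'M[R]_(d, m)) (b : 'I_m -> R).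
Variables (N : nat) (Gs : seq (seq 'I_m)).
Hypotheses (T0 : 0 < T) (b1 : 1 < beta + beta) (bt1 : beta <= 1) (L1 : 1 <= L).
Hypothesis hK : sewing_constant (beta + beta) K.
Hypothesis hb : forall j, beta <= b j.
Hypothesis hV : forall i w, (0 < size w)%N ->
  ((size w <= N.+1)%N -> word_bounds V L i w) /\
  ((size w <= N)%N -> word_bounds2 V L i w).
Hypothesis Gs_uniq : uniq Gs.
Hypothesis Gs_size : forall w, w \in Gs -> (0 < size w <= N)%N.
Hypothesis Gs_closed : forall j w, (0 < size w)%N -> j :: w \in Gs -> w \in Gs.
Hypothesis Gs_order : forall w, (0 < size w)%N -> w \notin Gs ->
  1 + theta <= \sum_(j <- w) b j.

(** The length [h] is chosen with [X * h `^ beta = Q^-1], where [Q] depends on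
    the fixed parameters only; then [T / h] is a multiple of [X `^ beta^-1]. *)
Lemma uniform_error_bound : exists2 C : R, 0 <= C &
  forall (X S : R) (x : R -> 'rV[R]_m), 1 <= X -> 0 <= S ->
    (forall j, holder_on 0 T beta X (fun v => x v 0 j)) ->
    (forall j, holder_on 0 T (b j) S (fun v => x v 0 j)) ->
  forall (y : R -> 'rV[R]_d) (y0 : 'rV[R]_d) (lam A : R),
    0 < lam -> 1 < lam + beta -> 0 <= A ->
    (forall u v, 0 <= u -> u <= v -> v <= T -> `|y v - y u| <= A * (v - u) `^ lam) ->
    (forall t, 0 <= t <= T ->
      y t = y0 + \row_i \sum_j
        RS_integral (fun u => V (y u) i j) (fun u => x u 0 j) 0 t) ->
  forall (n : nat) (yn : R -> 'rV[R]_d), (0 < n)%N -> yn 0 = y0 ->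
    (forall k, (k < n)%N -> forall t, grid T n k <= t <= grid T n k.+1 ->
      forall i, yn t 0 i - yn (grid T n k) 0 i =
        \sum_(w <- Gs) iter_int x w (fun=> 1) (grid T n k) t *
          calVs V w (coord i) (yn (grid T n k))) ->
  forall t, 0 <= t <= T ->
    `|y t - yn t| <= C * expR (C * X `^ beta^-1 + C * S) * n%:R `^ (- theta).
Proof.
have L0 : 0 <= L by exact: le_trans L1.
have K0 : 0 <= K by case: hK.
have bt0 : 0 < beta by move: b1; lra.
set ns : R := (size Gs)%:R; have ns0 : 0 <= ns by rewrite /ns.
pose C0 : R := (1 + K) ^+ N; have C00 : 0 <= C0 by rewrite exprn_ge0 // addr_ge0.
pose Cy : R := 2 * (m%:R * L); have Cy0 : 0 <= Cy by rewrite /Cy !mulr_ge0.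
pose q1 := m%:R * (K * L); have q10 : 0 <= q1 by rewrite /q1 !mulr_ge0.
pose q2 := ns * (K * L); have q20 : 0 <= q2 by rewrite /q2 !mulr_ge0.
pose q3 := 2 * (ns * ((1 + C0) * L) + (Cy + 2 * (ns * ((1 + C0) * L))) / 2).
have q30 : 0 <= q3.
  have c0 : 0 <= ns * ((1 + C0) * L) by rewrite !mulr_ge0 ?addr_ge0.
  by rewrite mulr_ge0 // addr_ge0 // divr_ge0 // addr_ge0 // mulr_ge0.
(* [q1], [q2], [q3] are the contraction factors per unit of [X * h `^ beta]: for
   the solution, for the scheme, and for their difference. *)
pose Q := 1 + 2 * q1 + 2 * q2 + 2 * q3.
have Q1 : 1 <= Q by rewrite /Q; lra.
have Q0 : 0 < Q by exact: lt_le_trans Q1.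
pose Lc := L * (1 + 2 * (m%:R * L)).
have Lc0 : 0 <= Lc by rewrite mulr_ge0 // addr_ge0 // mulr_ge0 // mulr_ge0.
pose tc := taylor_constant T b Gs; have tc0 : 0 <= tc by exact: taylor_constant_ge0.
pose sc := scheme_constant T b Gs.
have sc0 : 0 <= sc by apply: sumr_ge0 => w _; exact: powR_ge0.
pose M1 := tc * Lc * T `^ (- beta) * (T `^ beta + 4 * (1 + ns * C0 * L)).
have M10 : 0 <= M1.
  have c0 : 0 <= 1 + ns * C0 * L by rewrite addr_ge0 // !mulr_ge0.
  apply: mulr_ge0; last by rewrite addr_ge0 ?powR_ge0 // mulr_ge0.
  by rewrite mulr_ge0 ?powR_ge0 // mulr_ge0.
pose M2 := Cy + sc * L.
have M20 : 0 <= M2 by rewrite addr_ge0 ?mulr_ge0.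
pose E := (2 + `|theta|) * (T * Q `^ beta^-1).
have E0 : 0 <= E by rewrite !mulr_ge0 ?addr_ge0 ?powR_ge0 // ltW.
pose M := (M1 + M2) * (1 + K) ^+ N.+1 * expR 1.
have M0 : 0 <= M.
  apply: mulr_ge0; last exact: expR_ge0.
  by apply: mulr_ge0; [exact: addr_ge0|exact: exprn_ge0 (addr_ge0 ler01 K0)].
exists (M + E + N.+1%:R); first by rewrite !addr_ge0.
move=> X S x X1 S0 hx hxS y y0 lam A lam0 lam1 A0 hyA hy n yn n0 yn0 hyn t tT.
have X0 : 0 < X by exact: lt_le_trans X1.
have QX0 : 0 < Q * X by rewrite mulr_gt0.
pose h := (Q * X)^-1 `^ beta^-1.
have h0 : 0 < h by rewrite powR_gt0 // invr_gt0.
have hb' : h `^ beta = (Q * X)^-1.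
  by rewrite /h -powRrM mulVf ?gt_eqF // powRr1 // invr_ge0 ltW.
have Xh : X * h `^ beta = Q^-1 by rewrite hb' invfM mulrCA divff ?mulr1 ?gt_eqF.
have smallQ q : 2 * q <= Q -> q * Q^-1 <= 2^-1.
  by move=> H; rewrite ler_pdivrMr // mulrC ler_pdivlMr // mulrC.
have small0 : X * h `^ beta <= 1 by rewrite Xh invf_le1.
have small : m%:R * (K * (L * X)) * h `^ beta <= 2^-1.
  have -> : m%:R * (K * (L * X)) * h `^ beta = q1 * (X * h `^ beta) by rewrite /q1; ring.
  by rewrite Xh; apply: smallQ; rewrite /Q; lra.
have small1 : ns * (K * L) * (X * h `^ beta) <= 2^-1.
  by rewrite Xh; apply: smallQ; rewrite -/q2 /Q; lra.
have small2 : q3 * (X * h `^ beta) <= 2^-1.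
  by rewrite Xh; apply: smallQ; rewrite /Q; lra.
have Th : T / h = T * Q `^ beta^-1 * X `^ beta^-1.
  have -> : h = ((Q * X) `^ beta^-1)^-1.
    by rewrite /h -(powR_inv1 (ltW QX0)) -powRrM mulN1r powRN.
  by rewrite invrK powRM ?(ltW Q0) ?(ltW X0) // mulrA.
have Th0 : 0 <= T / h by rewrite divr_ge0 // ltW.
have yn0' : yn 0 = y 0.
  have [K' hK'] := sewing_constant_exists lam1.
  rewrite yn0 hy ?lexx ?(ltW T0) // (_ : \row_i _ = 0) ?addr0 //.
  apply/rowP => i; rewrite !mxE big1 // => j _.
  apply: (@RS_integral_base _ 0 T lam beta (L * A) X K') => //.
  - exact: mulr_ge0.
  - exact: ltW.
  - move=> u v u0 uv vT; apply: le_trans (field_lipschitz hV _ _ _ _) _.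
    by rewrite -mulrA ler_wpM2l // hyA.
  - exact: ltW.
set Y := (1 + K) * (1 + S); have Y0 : 0 <= Y by rewrite mulr_ge0 // addr_ge0.
have np0 : 0 <= n%:R `^ (- theta) :> R by exact: powR_ge0.
have YN0 : 0 <= Y ^+ N.+1 by exact: exprn_ge0.
have step : `|y t - yn t| <= (M1 + M2) * Y ^+ N.+1 *
    expR ((2 + `|theta|) * (T / h) + 1) * n%:R `^ (- theta).
  have [fine|coarse] := leP (T / n%:R) h.
    apply: le_trans (fine_error T0 b1 bt1 X1 S0 L1 hK hb hx hxS hV lam0 lam1 A0 hyA hy
      Gs_uniq Gs_size Gs_closed Gs_order n0 yn0' hyn h0 small0 small fine small1 small2 tT) _.
    rewrite -/tc -/Y -/Lc -/ns -/C0 ler_wpM2r //.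
    have -> : tc * Y ^+ N.+1 * Lc * T `^ (- beta) * (T `^ beta + 4 * (1 + ns * C0 * L)) =
      M1 * Y ^+ N.+1 by rewrite /M1; ring.
    apply: ler_pM; [exact: mulr_ge0|exact: expR_ge0| |].
      by rewrite ler_wpM2r // lerDl.
    by rewrite ler_expR lerD2r ler_wpM2r // lerDl.
  have H := coarse_error theta T0 b1 X1 S0 L1 hK hb hx hxS hV lam0 lam1 A0 hyA hy
      Gs_size n0 yn0' hyn h0 small0 small coarse tT.
  apply: le_trans H _.
  rewrite -/Cy -/sc -/M2 -/Y ler_wpM2r //.
  apply: ler_pM; [exact: mulr_ge0|exact: expR_ge0| |].
    by rewrite ler_wpM2r // lerDr.
  by rewrite ler_expR ler_wpDr // ler_wpM2r // lerD2r ler1n.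
apply: le_trans step _; rewrite ler_wpM2r //.
have YE : Y ^+ N.+1 <= (1 + K) ^+ N.+1 * expR (N.+1%:R * S).
  rewrite /Y exprMn ler_wpM2l ?exprn_ge0 ?addr_ge0 // expRM_natl.
  by rewrite lerXn2r ?nnegrE ?addr_ge0 ?expR_ge0 // expR_ge1Dx.
have Xb0 : 0 <= X `^ beta^-1 by exact: powR_ge0.
apply: (@le_trans _ _ (M * expR (E * X `^ beta^-1 + N.+1%:R * S))).
  rewrite expRD (_ : (2 + `|theta|) * (T / h) = E * X `^ beta^-1); last first.
    by rewrite Th /E; ring.
  rewrite [expR (E * _ + N.+1%:R * S)]expRD /M.
  set e1 := expR (E * _); set e2 := expR (N.+1%:R * S) in YE *.
  have -> : (M1 + M2) * (1 + K) ^+ N.+1 * expR 1 * (e1 * e2) =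
    (M1 + M2) * ((1 + K) ^+ N.+1 * e2) * (e1 * expR 1) by ring.
  rewrite ler_wpM2r ?mulr_ge0 ?expR_ge0 // ler_wpM2l // addr_ge0 //.
apply: ler_pM; rewrite ?expR_ge0 //.
  by rewrite -addrA lerDl addr_ge0.
rewrite ler_expR; apply: lerD.
  by rewrite ler_wpM2r // addrAC lerDr addr_ge0.
by rewrite ler_wpM2r // lerDr addr_ge0.
Qed.

End UniformConstant.

Section HolderNorms.
Context {R : realType}.

Lemma coord_le_enorm (k : nat) (z : 'rV[R]_k) i : `|z 0 i| <= enorm z.
Proof.
rewrite /enorm -sqrtr_sqr ler_wsqrtr // (bigD1 i) //= lerDl.
by apply: sumr_ge0 => j _; exact: sqr_ge0.
Qed.

Lemma norm_le_enorm (k : nat) (z : 'rV[R]_k) : `|z| <= enorm z.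
Proof.
by apply: norm_le_coord => [|i]; [exact: sqrtr_ge0|exact: coord_le_enorm].
Qed.

Lemma enorm_le_sum (k : nat) (z : 'rV[R]_k) : enorm z <= \sum_i `|z 0 i|.
Proof.
have s0 : 0 <= \sum_i `|z 0 i| by exact: sumr_ge0.
rewrite -[leRHS](ger0_norm s0) -sqrtr_sqr ler_wsqrtr // expr2 mulr_suml.
apply: ler_sum => i _; rewrite -real_normK ?num_real // expr2 ler_wpM2l //.
by rewrite (bigD1 i) //= lerDl sumr_ge0.
Qed.

Lemma holder_seminorm_ge0 (U : zmodType) (nrm : U -> R) T al (z : R -> U) : 0 < T ->
  (forall u, 0 <= nrm u) -> holder nrm T al z -> 0 <= holder_seminorm nrm T al z.
Proof.
move=> T0 n0 hz; apply: le_trans (_ : nrm (z 0 - z T) / (T - 0) `^ al <= _).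
  by rewrite divr_ge0 ?powR_ge0.
by apply: sup_upper_bound; [split => //; eexists|]; exists 0, T; split.
Qed.

Lemma holder_seminormP (U : zmodType) (nrm : U -> R) T al (z : R -> U) u v :
  holder nrm T al z -> 0 <= u -> u < v -> v <= T ->
  nrm (z u - z v) <= holder_seminorm nrm T al z * (v - u) `^ al.
Proof.
move=> hz u0 uv vT; rewrite -ler_pdivrMr ?powR_gt0 ?subr_gt0 //.
by apply: sup_upper_bound; [split => //; eexists|]; exists u, v; split.
Qed.

(** Trades the exponent [1 / beta] for the larger exponent of the statement. *)
Lemma powR_1D_le (a r p : R) : 0 <= a -> 0 <= r -> r <= p ->
  (1 + a) `^ r <= 2 `^ r * (2 + a `^ p).
Proof.
move=> a0 r0 rp; have p0 : 0 <= p by exact: le_trans rp.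
have [a1|a1] := leP a 1.
  apply: (@le_trans _ _ (2 `^ r * 1)); last first.
    by rewrite ler_wpM2l ?powR_ge0 // -[leLHS]addr0 lerD ?ler1n ?powR_ge0.
  by rewrite mulr1 le_powR ?addr_ge0 // -[leRHS]/(1 + 1) lerD2l.
apply: (@le_trans _ _ (2 `^ r * a `^ p)); last first.
  by rewrite ler_wpM2l ?powR_ge0 // lerDr.
apply: (@le_trans _ _ ((2 * a) `^ r)).
  by rewrite le_powR ?addr_ge0 // mulrDl mul1r lerD2r ltW.
by rewrite powRM // ler_wpM2l ?powR_ge0 // ler_powR // ltW.
Qed.

End HolderNorms.

(** * The incomplete Taylor scheme *)

Theorem theorem4p5 (R : realType) (d m : nat) (T : R) (hT : 0 < T)
    (b : 'I_m -> R) (hb : forall j, 1 / 2 < b j)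
    (beta : R) (hbeta : is_minimum (range b) beta)
    (Gt : set (seq 'I_m)) (hGt : Gt `<=` Gamma m) (hfin : finite_set Gt)
    (hne : Gt !=set0) (hhier : hierarchical Gt)
    (N : nat) (hN : is_maximum [set size a | a in Gt] N)
    (theta : R)
    (htheta : is_minimum
       [set (\sum_(j <- a) b j) - 1 | a in Gamma m `\` Gt] theta)
    (V : 'rV[R]_d -> 'M[R]_(d, m))
    (hV : forall i j, Cb N.+1 (fun z => V z i j)) :
  exists C : R, 0 < C /\
    forall (x : R -> 'rV[R]_m),
      (forall j, holder Num.norm T (b j) (fun t => x t 0 j)) ->
    forall (y0 : 'rV[R]_d) (y : R -> 'rV[R]_d),
      is_solution T beta V x y0 y ->
    forall (n : nat), (1 <= n)%N ->
    forall (yn : R -> 'rV[R]_d),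
      is_incomplete_taylor_scheme T Gt V x y0 n yn ->
    (ereal_sup [set (enorm (y t - yn t))%:E | t in `[0%R, T]] <=
     (C * expR (C * holder_seminorm (@enorm R m) T beta x
                      `^ (1 / beta ^+ 2 + (N%:R - 1) / beta)
                + C * \sum_(j < m)
                    holder_seminorm Num.norm T (b j) (fun t => x t 0 j))
      * n%:R `^ (- theta))%:E)%E.
Proof.
have /finite_seqP[G GE] := hfin.
pose Gs := undup G.
have GtE : Gt = [set` Gs].
  by rewrite GE; apply/seteqP; split => w /=; rewrite mem_undup.
have GsP w : reflect (Gt w) (w \in Gs) by rewrite GtE; exact: idP.
have Gs_uniq : uniq Gs by exact: undup_uniq.
have [[b_beta beta_min] [_ N_max]] := (hbeta, hN).
have beta_le j : beta <= b j by apply: beta_min; exists j.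
have beta_gt : 1 / 2 < beta by case: b_beta => j _ <-.
have Gs_size w : w \in Gs -> (0 < size w <= N)%N.
  move=> /GsP wG; apply/andP; split; first exact: (hGt _ wG).
  by have : (size w <= N)%O by [apply: N_max; exists w]; rewrite leEnat.
have N1 : (1 <= N)%N.
  by case: hne => w /GsP/Gs_size/andP[w0 wN]; exact: leq_trans wN.
have Gs_closed j w : (0 < size w)%N -> j :: w \in Gs -> w \in Gs.
  move=> w0 /GsP jw; apply/GsP; apply: contrapT => nw.
  have [] // := hhier w (j :: w) (conj w0 nw) _; split => //.
  exists (fun i => lift ord0 i); split; first exact: lift_inj.
  by move=> i; rewrite !(tnth_nth j).
have Gs_order w : (0 < size w)%N -> w \notin Gs -> 1 + theta <= \sum_(j <- w) b j.
  move=> w0 wG; rewrite addrC -lerBrDr; case: htheta => _; apply.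
  by exists w => //; split => // /GsP; apply/negP.
(* Beyond the exponent [1], adding up small lengths would lose a power of [n]:
   see [natmul_le_powR]. *)
pose bt := Num.min beta 1.
have bt1 : bt <= 1 by rewrite ge_min lexx orbT.
have bt_beta : bt <= beta by rewrite ge_min lexx.
have bt_gt : 1 / 2 < bt by rewrite lt_min beta_gt; lra.
have b1 : 1 < bt + bt by lra.
have bt0 : 0 < bt by lra.
have b_ge j : bt <= b j by apply: le_trans (beta_le j).
have [K hK] := sewing_constant_exists b1.
have [L L1 hL] := vector_field_bounds hV.
have [C C0 main] := uniform_error_bound hT b1 bt1 L1 hK b_ge hL Gs_uniq Gs_size
  Gs_closed Gs_order.
pose c1 := T `^ (beta - bt).
have c10 : 0 <= c1 by exact: powR_ge0.
pose c2 := \sum_(j < m) T `^ (b j - beta).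
have c20 : 0 <= c2 by apply: sumr_ge0 => j _; exact: powR_ge0.
pose c3 := 2 `^ bt^-1 : R.
have c30 : 0 <= c3 by exact: powR_ge0.
pose c4 := d%:R * (C * expR (C * (2 * c3 + 1))).
have c40 : 0 <= c4 by rewrite !mulr_ge0 ?expR_ge0.
have c50 : 0 <= C * c3 by exact: mulr_ge0.
have c60 : 0 <= C + C * (c1 * c2) by rewrite addr_ge0 // !mulr_ge0.
exists (1 + c4 + C * c3 + (C + C * (c1 * c2))); split.
  by have := addr_ge0 c40 (addr_ge0 c50 c60); lra.
move=> x hx y0 y [[lam [lam0 lam1 hyl]] hy] n n1 yn [yn0 hyn].
pose Sj j := holder_seminorm Num.norm T (b j) (fun t => x t 0 j).
pose S := \sum_j Sj j.
have Sj0 j : 0 <= Sj j by exact: holder_seminorm_ge0.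
have S0 : 0 <= S by exact: sumr_ge0.
have SjS j : Sj j <= S by rewrite /S (bigD1 j) //= lerDl sumr_ge0.
have hxS j : holder_on 0 T (b j) S (fun v => x v 0 j).
  move=> u v u0; rewrite le_eqVlt => /predU1P[->|uv] vT.
    by rewrite subrr normr0 mulr_ge0 ?powR_ge0.
  rewrite distrC; apply: le_trans (holder_seminormP (hx j) u0 uv vT) _.
  by rewrite ler_wpM2r ?powR_ge0 //; exact: SjS.
have quot u v : 0 <= u -> u < v -> v <= T ->
    enorm (x u - x v) <= c2 * S * (v - u) `^ beta.
  move=> u0 uv vT; apply: le_trans (enorm_le_sum _) _.
  rewrite /c2 !mulr_suml; apply: ler_sum => j _; rewrite !mxE distrC.
  apply: le_trans (hxS j u v u0 (ltW uv) vT) _.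
  rewrite mulrAC mulrC ler_wpM2r //.
  have uv0 : 0 < v - u by rewrite subr_gt0.
  have {1}-> : b j = (b j - beta) + beta by rewrite subrK.
  rewrite powRD; last by rewrite (gt_eqF uv0) implybT.
  rewrite ler_wpM2r ?powR_ge0 // le_powR ?subr_ge0 ?(ltW uv) //.
  by apply: le_trans vT; rewrite gerBl.
have hxE : holder (@enorm R m) T beta x.
  exists (c2 * S) => r [u [v [u0 uv vT ->]]].
  by rewrite ler_pdivrMr ?powR_gt0 ?subr_gt0 // quot.
pose X' := holder_seminorm (@enorm R m) T beta x.
have X'0 : 0 <= X'.
  by apply: holder_seminorm_ge0 => // u; exact: sqrtr_ge0.
have X'S : X' <= c2 * S.
  apply: ge_sup; first by eexists; exists 0, T; split.
  move=> r [u [v [u0 uv vT ->]]].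
  by rewrite ler_pdivrMr ?powR_gt0 ?subr_gt0 // quot.
(* At least [1], so that a bound on [X * h `^ beta] is one on [h `^ beta]. *)
pose X := 1 + c1 * X'.
have X1 : 1 <= X by rewrite lerDl mulr_ge0.
have hxX j : holder_on 0 T bt X (fun v => x v 0 j).
  move=> u v u0; rewrite le_eqVlt => /predU1P[->|uv] vT.
    by rewrite subrr normr0 mulr_ge0 ?powR_ge0 // (le_trans ler01).
  have uv0 : 0 < v - u by rewrite subr_gt0.
  have := coord_le_enorm (x u - x v) j; rewrite !mxE distrC => H.
  apply: le_trans H _; apply: le_trans (holder_seminormP hxE u0 uv vT) _.
  have -> : (v - u) `^ beta = (v - u) `^ (beta - bt) * (v - u) `^ bt.
    by rewrite -powRD ?subrK // (gt_eqF uv0) implybT.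
  rewrite mulrA ler_wpM2r ?powR_ge0 // /X [c1 * _]mulrC -/X'.
  apply: (@le_trans _ _ (X' * c1)); last by rewrite lerDr.
  rewrite ler_wpM2l // le_powR ?subr_ge0 ?(ltW uv) //.
  by apply: le_trans vT; rewrite gerBl.
have [A0 hA0] := hyl.
have hyA u v : 0 <= u -> u <= v -> v <= T ->
    `|y v - y u| <= Num.max A0 0 * (v - u) `^ lam.
  move=> u0; rewrite le_eqVlt => /predU1P[->|uv] vT.
    by rewrite !subrr normr0 mulr_ge0 ?powR_ge0 // le_max lexx orbT.
  rewrite distrC; apply: le_trans (norm_le_enorm _) _.
  rewrite -ler_pdivrMr ?powR_gt0 ?subr_gt0 // le_max; apply/orP; left.
  by apply: hA0; exists u, v; split.
have A00 : 0 <= Num.max A0 0 by rewrite le_max lexx orbT.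
have lam_bt : 1 < lam + bt.
  by rewrite /bt; case: (leP beta 1) => // _; rewrite ltrDr.
have scheme k : (k < n)%N -> forall t, grid T n k <= t <= grid T n k.+1 ->
    forall i, yn t 0 i - yn (grid T n k) 0 i =
      \sum_(w <- Gs) iter_int x w (fun=> 1) (grid T n k) t *
        calVs V w (coord i) (yn (grid T n k)).
  move=> kn t kt i; rewrite (hyn k kn t kt) mxE [LHS]addrC addKr.
  rewrite /incomplete_expansion GtE -fsbig_seq // summxE.
  by apply: eq_bigr => w _; rewrite !mxE iterated_integralE.
set p := 1 / beta ^+ 2 + (N%:R - 1) / beta.
have beta0 : 0 < beta by exact: lt_le_trans bt_beta.
have X'p0 : 0 <= X' `^ p by exact: powR_ge0.
have Xpow : X `^ bt^-1 <= c3 * (2 + X' `^ p) + c1 * c2 * S + 1.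
  have [b1'|b1'] := leP beta 1.
    have btE : bt = beta by rewrite /bt min_l.
    have -> : X = 1 + X' by rewrite /X /c1 btE subrr powRr0 mul1r.
    apply: (@le_trans _ _ (c3 * (2 + X' `^ p))); last first.
      by have := mulr_ge0 (mulr_ge0 c10 c20) S0; lra.
    apply: powR_1D_le => //; first by rewrite invr_ge0 ltW.
    rewrite btE /p; apply: ler_wpDr.
      by rewrite divr_ge0 ?(ltW beta0) // subr_ge0 ler1n.
    rewrite mul1r expr2 invfM ler_peMr ?invr_ge0 ?(ltW beta0) //.
    by rewrite invf_ge1.
  (* The exponent of the statement may be below [1] here, so that [S] is used
     to dominate the seminorm. *)
  have btE : bt = 1 by rewrite /bt min_r // ltW.
  rewrite btE invr1 powRr1 ?(le_trans ler01) // /X addrC lerD2r.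
  apply: (@le_trans _ _ (c1 * c2 * S)); last by rewrite lerDr mulr_ge0 ?addr_ge0.
  by rewrite -mulrA ler_wpM2l.
apply: ub_ereal_sup => _ [t tT <-]; rewrite lee_fin.
have {}tT : 0 <= t <= T by move: tT; rewrite /= in_itv.
have np0 : 0 <= n%:R `^ (- theta) :> R by exact: powR_ge0.
have err := main X S x X1 S0 hxX hxS y y0 lam _ lam0 lam_bt A00 hyA hy n yn n1 yn0
  scheme t tT.
apply: (@le_trans _ _ (d%:R * `|y t - yn t|)).
  apply: le_trans (enorm_le_sum _) _.
  rewrite mulr_natl -[X in _ *+ X]card_ord -sumr_const; apply: ler_sum => i _.
  exact: coord_le_norm.
apply: le_trans (ler_wpM2l (ler0n _ d) err) _.
rewrite [leLHS]mulrA ler_wpM2r //.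
rewrite -/X' -/p -/S.
apply: (@le_trans _ _ (c4 * expR (C * c3 * X' `^ p + (C + C * (c1 * c2)) * S))).
  rewrite /c4 -!mulrA ler_wpM2l // ler_wpM2l // -expRD ler_expR.
  have := ler_wpM2l C0 Xpow; lra.
apply: ler_pM; rewrite ?expR_ge0 //.
  by lra.
rewrite ler_expR; apply: lerD; rewrite ler_wpM2r //; lra.
Qed.
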